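(* Let $X\in\mathfrak g_{l+1}=\mathfrak{so}(2,l)$ satisfy $[X,J_1]=0$, and let $R=\{e^{\alpha X}\}_{\alpha\in\mathbb R}$ be the one-parameter group it generates. Suppose that $R\cdot\iota(AdS_l)=AdS_{l+1}$. Then 1. $R\cdot\iota(\mathcal S_l)=\mathcal S_{l+1}$; 2. $R\cdot\iota(\mathcal F_l)=\mathcal F_{l+1}$; 3. $R\cdot\iota(BH_l)=BH_{l+1}$; 4. $R\cdot\iota(\mathcal H_l)=\mathcal H_{l+1}$.
   Context: Let $l\ge 3$; the following is used both for $l$ and for $l+1$. Here $SO(p,q)$ denotes the identity component of the special orthogonal group of signature $(p,q)$. Let $G=G_l=SO(2,l-1)$ act on $\mathbb R^{2,l-1}$ (two positive and $l-1$ negative directions), let $H=SO(1,l-1)\subset G$ be the stabilizer of a vector of square norm $+1$, with Lie algebras $\mathfrak g=\mathfrak g_l$, $\mathfrak h$, let $B$ be the Killing form of $\mathfrak g$, and let $AdS_l=G/H$, $[g]=gH$, on which $G$ acts by $r\cdot[g]=[rg]$. Let $\sigma$ be the involutive automorphism of $\mathfrak g$ with $+1$-eigenspace $\mathfrak h$ and let $\mathfrak q$ be its $-1$-eigenspace. Let $\theta$ be a Cartan involution commuting with $\sigma$, with $\pm1$-eigenspaces $\mathfrak k,\mathfrak p$. Let $\mathfrak a\subset\mathfrak p$ be maximal abelian with basis $J_1\in\mathfrak h$, $J_2\in\mathfrak q$, normalized so that, with $\mathfrak g_{(\alpha,\beta)}=\{X:[J_1,X]=\alpha X,[J_2,X]=\beta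 X\}$, the restricted roots are $(\pm1,\pm1)$ and, if $l\ge4$, $(\pm1,0),(0,\pm1)$. Let $\mathfrak n=\mathfrak g_{(1,1)}\oplus\mathfrak g_{(1,-1)}\oplus\mathfrak g_{(1,0)}\oplus\mathfrak g_{(0,1)}$, $\bar{\mathfrak n}=\theta\mathfrak n$, and let $A,N,\bar N$ be the corresponding connected subgroups. Choose $X_{++}\in\mathfrak g_{(1,1)}$ with $[\theta X_{++},X_{++}]=4(J_1+J_2)$ and a basis $X^k_{0+}$ ($3\le k\le l-1$) of $\mathfrak g_{(0,1)}$ with $[\theta X^k_{0+},X^k_{0+}]=2J_2$ and $B(X^j_{0+},\theta X^k_{0+})=0$ for $j\ne k$. Put $q_0=\tfrac14(X_{++}-\sigma X_{++}+\theta X_{++}-\sigma\theta X_{++})$, $q_1=J_2$, $q_2=-[J_1,q_0]$, $q_k=\tfrac12(X^k_{0+}-\theta X^k_{0+})$ for $3\le k\le l-1$; these form a basis of $\mathfrak q$. Causal structure. The singularity $\mathcal S_l\subset AdS_l$ is the union of the closed orbits of $AN$ and of $A\bar N$ in $AdS_l$. Up to positive rescaling, the future light-like directions are $E(w)=q_0+\sum_{i=1}^{l-1}w_iq_i$ with $w\in S^{l-2}$ (unit sphere of $\mathbb R^{l-1}$); the corresponding light-like geodesic from $[g]$ is $s\mapsto[ge^{sE(w)}]$, and its future part is $s>0$. A direction escapes the singularity from $[g]$ if $[ge^{sE(w)}]\notin\mathcal S_l$ for all $s>0$. The black hole $BH_l$ is the set of points from which every light-like geodesic meets $\mathcal S_l$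 in the future (no direction escapes); the free part $\mathcal F_l=AdS_l\setminus BH_l$ is the set of points from which some direction escapes; the horizon $\mathcal H_l$ is the topological boundary of $BH_l$ in $AdS_l$. The inclusion $\iota:AdS_l\to AdS_{l+1}$ is induced by the inclusion $SO(2,l-1)\to SO(2,l)$ as the subgroup acting trivially on the last (negative) coordinate of $\mathbb R^{2,l}$, all choices being compatible (so $\theta,\sigma$ restrict to each other and $J_1,J_2,q_0,\dots,q_{l-1}$ of $\mathfrak g_l$ are sent to the elements of the same name in $\mathfrak g_{l+1}$). *)

(* Defs.v *)
From HB Require Import structures.
From mathcomp Require Import all_boot all_order all_algebra.
From mathcomp Require Import all_classical all_reals all_analysis.

Set Implicit Arguments.
Unset Strict Implicit.
Unset Printing Implicit Defensive.

Import Order.TTheory GRing.Theory Num.Theory.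
Import numFieldNormedType.Exports.

Local Open Scope classical_set_scope.
Local Open Scope ring_scope.

Section MatrixLie.
Variables (R : realType) (n : nat).
Local Notation M := 'M[R]_n.+1.

Definition expmx (X : M) : M :=
  limn (series (fun k : nat => (k`!%:R)^-1 *: X ^+ k)).

Definition bracket (X Y : M) : M := X *m Y - Y *m X.

Definition ad (X : M) : 'End(M) := linfun (bracket X).

Lemma adE (X Y : M) : ad X Y = bracket X Y.
Proof.
rewrite /ad.
have lin : linear (bracket X).
  move=> a A B; rewrite /bracket mulmxDr mulmxDl -scalemxAr -scalemxAl.
  by rewrite scalerBr opprD !addrA; congr (_ + _); rewrite -!addrA;
     congr (_ + _); rewrite addrC.
pose br := HB.pack_for {linear M -> M} (bracket X)
  (GRing.isLinear.Build R M M *:%R (bracket X) lin).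
by rewrite (lfunE br Y).
Qed.

(* B(X, Y) = tr (ad X \o ad Y), the trace being taken on the subalgebra g. *)
Definition killing (g : {vspace M}) (X Y : M) : R :=
  \sum_(i < \dim g) coord (vbasis g) i (bracket X (bracket Y (vbasis g)`_i)).

(* Automorphisms of g are represented by endomorphisms of the ambient matrix
   space, only the restriction of which to g is relevant. *)
Definition involutive_automorphism (g : {vspace M}) (s : 'End(M)) : Prop :=
  [/\ forall X, X \in g -> s X \in g,
      forall X Y, X \in g -> Y \in g -> s (bracket X Y) = bracket (s X) (s Y)
    & forall X, X \in g -> s (s X) = X].

Definition cartan_involution (g : {vspace M}) (t : 'End(M)) : Prop :=
  involutive_automorphism g t /\
  forall X, X \in g -> X != 0 -> 0 < - killing g X (t X).

Definition eigen_in (g : {vspace M}) (s : 'End(M)) (c : R) : {vspace M} :=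
  (g :&: passmx.leigenspace s c)%VS.

Definition abelian_subspace (a : {vspace M}) : Prop :=
  forall X Y, X \in a -> Y \in a -> bracket X Y = 0.

Definition maximal_abelian (p a : {vspace M}) : Prop :=
  [/\ (a <= p)%VS, abelian_subspace a
    & forall b : {vspace M},
        (b <= p)%VS -> abelian_subspace b -> (a <= b)%VS -> b = a].

Definition subgroup (K : set M) : Prop :=
  [/\ K `<=` [set g | g \in unitmx], K 1%:M,
      forall g h, K g -> K h -> K (g *m h)
    & forall g, K g -> K (invmx g)].

(* The connected Lie subgroup with Lie algebra a is generated by exp a. *)
Definition connected_subgroup (a : {vspace M}) : set M :=
  smallest subgroup (expmx @` [set X | X \in a]).

End MatrixLie.

(* Throughout, the index l stands for signature (2, l-1), so that matrices have
   size l.+1; the first two coordinates are the positive ones. *)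
Section Orthogonal.
Variables (R : realType) (l : nat).
Local Notation M := 'M[R]_l.+1.

Definition eta : M :=
  diag_mx (\row_(i < l.+1) if (i < 2)%N then 1 else -1).

Definition sqnorm (v : 'cV[R]_l.+1) : R := (v^T *m eta *m v) 0 0.

Definition SO0 : set M :=
  connected_component [set g : M | g^T *m eta *m g = eta /\ \det g = 1] 1%:M.

Definition so : {vspace M} :=
  lker (linfun (fun X : M => X^T *m eta + eta *m X)).

Lemma mem_so (X : M) : (X \in so) = (X^T *m eta + eta *m X == 0).
Proof.
rewrite /so memv_ker.
pose f (X : M) : M := X^T *m eta + eta *m X.
have lin : linear f.
  move=> a A B; rewrite /f linearP /= mulmxDl mulmxDr -scalemxAl -scalemxAr.
  by rewrite scalerDr addrACA.
pose fl := HB.pack_for {linear M -> M} f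
  (GRing.isLinear.Build R M M *:%R f lin).
by rewrite (lfunE fl X).
Qed.

Definition so_stab (v : 'cV[R]_l.+1) : {vspace M} :=
  (so :&: lker (linfun (fun X : M => X *m v)))%VS.

Lemma mem_so_stab v X : (X \in so_stab v) = (X \in so) && (X *m v == 0).
Proof.
rewrite memv_cap; congr (_ && _); rewrite memv_ker.
pose fl : {linear M -> 'cV[R]_l.+1} := mulmxr v.
by rewrite (lfunE fl X).
Qed.

End Orthogonal.

Arguments SO0 : clear implicits.

Record ads_data (R : realType) (l : nat) := AdsData {
  base_vec : 'cV[R]_l.+1;
  sigma : 'End('M[R]_l.+1);
  theta : 'End('M[R]_l.+1);
  J1 : 'M[R]_l.+1;
  J2 : 'M[R]_l.+1;
  Xpp : 'M[R]_l.+1;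
  X0p : nat -> 'M[R]_l.+1   (* only the indices 3 <= k < l are relevant *)
}.

Section AdS.
Variables (R : realType) (l : nat) (D : ads_data R l).
Local Notation M := 'M[R]_l.+1.
Local Notation g := (so R l).
Local Notation h := (so_stab (base_vec D)).
Local Notation B := (killing g).
Local Notation sg := (sigma D).
Local Notation th := (theta D).

Definition q_space : {vspace M} := eigen_in g sg (-1).
Definition p_space : {vspace M} := eigen_in g th (-1).
Definition a_space : {vspace M} := <<[:: J1 D; J2 D]>>%VS.

Definition root_space (a b : R) : {vspace M} :=
  (g :&: passmx.leigenspace (ad (J1 D)) a :&: passmx.leigenspace (ad (J2 D)) b)%VS.

Definition is_root (a b : R) : Prop :=
  (a, b) <> (0, 0) /\ root_space a b <> 0%VS.

Definition n_space : {vspace M} :=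
  (root_space 1 1 + root_space 1 (-1) + root_space 1 0 + root_space 0 1)%VS.
Definition nbar_space : {vspace M} := (th @: n_space)%VS.

Record ads_axioms : Prop := AdsAxioms {
  base_vec_norm : sqnorm (base_vec D) = 1;
  sigma_invol : involutive_automorphism g sg;
  sigma_fix : eigen_in g sg 1 = h;
  theta_cartan : cartan_involution g th;
  theta_sigma : forall X, X \in g -> th (sg X) = sg (th X);
  a_maximal : maximal_abelian p_space a_space;
  a_free : free [:: J1 D; J2 D];
  J1_h : J1 D \in h;
  J2_q : J2 D \in q_space;
  roots : forall a b : R, is_root a b <->
    ((a = 1 \/ a = -1) /\ (b = 1 \/ b = -1)) \/
    ((4 <= l)%N /\ (((a = 1 \/ a = -1) /\ b = 0) \/
                    (a = 0 /\ (b = 1 \/ b = -1))));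
  Xpp_root : Xpp D \in root_space 1 1;
  Xpp_norm : bracket (th (Xpp D)) (Xpp D) = 4%:R *: (J1 D + J2 D);
  X0p_basis : basis_of (root_space 0 1) [seq X0p D k | k <- index_iota 3 l];
  X0p_norm : forall k, (3 <= k < l)%N ->
    bracket (th (X0p D k)) (X0p D k) = 2%:R *: J2 D;
  X0p_orth : forall j k, (3 <= j < l)%N -> (3 <= k < l)%N -> j <> k ->
    B (X0p D j) (th (X0p D k)) = 0
}.

Definition q0 : M :=
  4%:R^-1 *: (Xpp D - sg (Xpp D) + th (Xpp D) - sg (th (Xpp D))).

Definition q (k : nat) : M :=
  match k with
  | 0 => q0
  | 1 => J2 D
  | 2 => - bracket (J1 D) q0
  | _ => 2%:R^-1 *: (X0p D k - th (X0p D k))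
  end.

Definition H : set M := [set r | SO0 R l r /\ r *m base_vec D = base_vec D].

(* Points of G/H are left cosets, as sets of matrices. *)
Definition pt (r : M) : set M := [set r *m k | k in H].

Definition AdS : set (set M) := pt @` SO0 R l.

(* Quotient topology of G/H, G carrying the topology induced by matrices. *)
Definition ads_open (U : set (set M)) : Prop :=
  U `<=` AdS /\
  open ([set r | SO0 R l r /\ U (pt r)] : set (subspace (SO0 R l))).

Definition ads_closed (F : set (set M)) : Prop :=
  F `<=` AdS /\ ads_open (AdS `\` F).

Definition ads_boundary (E : set (set M)) : set (set M) :=
  [set x | AdS x /\ forall U, ads_open U -> U x ->
     U `&` E !=set0 /\ U `&` (AdS `\` E) !=set0].

Definition act (r : M) (x : set M) : set M := [set r *m k | k in x].

Definition gA : set M := connected_subgroup a_space.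
Definition gN : set M := connected_subgroup n_space.
Definition gNbar : set M := connected_subgroup nbar_space.

Definition setprod (K L : set M) : set M := [set r *m k | r in K & k in L].

Definition orbit_of (K : set M) (x : set M) : set (set M) :=
  [set act r x | r in K].

Definition closed_orbits (K : set M) : set (set (set M)) :=
  [set O | ads_closed O /\ exists2 x, AdS x & O = orbit_of K x].

Definition singularity : set (set M) :=
  \bigcup_(O in closed_orbits (setprod gA gN) `|`
                closed_orbits (setprod gA gNbar)) O.

(* The coordinate w_i (1 <= i <= l-1) is the entry of w of index i-1. *)
Definition direction (w : 'rV[R]_l.-1) : M :=
  q 0 + \sum_(i < l.-1) w 0 i *: q i.+1.

Definition unit_sphere : set 'rV[R]_l.-1 :=
  [set w | \sum_(i < l.-1) w 0 i ^+ 2 = 1].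

Definition escapes (r : M) (w : 'rV[R]_l.-1) : Prop :=
  forall s : R, 0 < s -> ~ singularity (pt (r *m expmx (s *: direction w))).

Definition BH : set (set M) :=
  [set pt r | r in [set r | SO0 R l r /\
                            forall w, unit_sphere w -> ~ escapes r w]].

Definition free_part : set (set M) := AdS `\` BH.

Definition horizon : set (set M) := ads_boundary BH.

End AdS.

Section Inclusion.
Variables (R : realType) (l : nat).

Definition incl_vec (v : 'cV[R]_l.+1) : 'cV[R]_l.+2 :=
  castmx (addn1 l.+1, erefl 1%N) (col_mx v (0 : 'cV[R]_1)).

Definition incl_mx (c : R) (A : 'M[R]_l.+1) : 'M[R]_l.+2 :=
  castmx (addn1 l.+1, addn1 l.+1) (block_mx A 0 0 (c%:M : 'M[R]_1)).

Definition incl_grp := incl_mx 1.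
Definition incl_alg := incl_mx 0.

(* gH_l is sent to incl_grp(g) incl_grp(H_l) H_(l+1) = incl_grp(g) H_(l+1). *)
Definition embed (D' : ads_data R l.+1) (x : set 'M[R]_l.+1) :
    set 'M[R]_l.+2 :=
  [set incl_grp r *m k | r in x & k in H D'].

Record compatible (D : ads_data R l) (D' : ads_data R l.+1) : Prop :=
  Compatible {
  compat_vec : base_vec D' = incl_vec (base_vec D);
  compat_sigma : forall X, X \in so R l ->
    sigma D' (incl_alg X) = incl_alg (sigma D X);
  compat_theta : forall X, X \in so R l ->
    theta D' (incl_alg X) = incl_alg (theta D X);
  compat_J1 : J1 D' = incl_alg (J1 D);
  compat_J2 : J2 D' = incl_alg (J2 D);
  compat_q : forall k, (k < l)%N -> q D' k = incl_alg (q D k)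
}.

End Inclusion.

Definition sweep (R : realType) (n : nat) (X : 'M[R]_n.+1)
    (E : set (set 'M[R]_n.+1)) : set (set 'M[R]_n.+1) :=
  [set act (expmx (t *: X)) x | t in [set: R] & x in E].

(* Main.v *)
(** G/H is identified with the quadric <v, v> = 1 by [g] |-> g v0, where v0 is the vector stabilized
    by H. The normalizations of Xpp and X0p force an orthonormal frame in which J1 is the boost of a
    plane (tau, xi), J2 the boost of a plane (v0, b), and the future light-like directions at v0 are
    the tau + y with y a unit space-like vector orthogonal to v0 and tau. The closed orbits of AN (of
    AN-bar) are the v orthogonal to the eigenvector of J1 for the eigenvalue 1 (for -1), so that with
    T = <v, tau>, X = <v, xi> and S = <v, v0> the singularity is T^2 = X^2, that is |J1 v|^2 = 0.
    Light-like geodesics are straight lines in the quadric, which turns escaping into an algebraic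
    condition; solving it gives the black hole 0 < T^2 - X^2 < 1, T S < 0. These descriptions only
    involve T, X, S, which the inclusion preserves, and the flow of X preserves all the sets because
    it commutes with J1. For the horizon, a point of AdS_(l+1) is moved into AdS_l without changing
    T, X, S by rotating its last coordinate into the direction b. *)

Require Import Defs.
From HB Require Import structures.
From mathcomp Require Import all_boot all_order all_algebra.
From mathcomp Require Import all_classical all_reals all_analysis.
From mathcomp Require Import ring lra zify.

Set Implicit Arguments.
Unset Strict Implicit.
Unset Printing Implicit Defensive.

Import Order.TTheory GRing.Theory Num.Theory.
Import numFieldNormedType.Exports.

Local Open Scope classical_set_scope.
Local Open Scope ring_scope.

(** * The quadratic form and infinitesimal rotations *)

(** The involutions are known only through axioms, [sigma] by its fixed algebra and [theta] by the
    positivity of a form, so no standard matrices can be assumed: the frame has to be extracted from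
    root equations and normalizations. The threshold 1 of the black hole is the square norm of v. If
    -rho^2 is the square norm of the part of v orthogonal to tau, xi and v0, then S^2 = 1 - (T^2 -
    X^2) + rho^2, and T^2 - X^2 < 1 means |S| > rho. Two points resist pure algebra. The future
    directions at [r] are images under r of those at the base point, so escape refers to a
    representative; a time orientation depending on the point alone replaces it, and the
    connectedness of [SO0] shows that it is preserved. Moreover T, X and S are not separately
    invariant under the flow, hence the invariance of the black hole is obtained by returning to
    geodesics, where only the invariance of the singularity matters. For the horizon, approximating
    points must be carried back to the smaller quadric continuously, which dictates a sign in the
    retraction. *)

Section Form.
Variables (R : realType) (l : nat).
Local Notation M := 'M[R]_l.+1.
Local Notation V := 'cV[R]_l.+1.
Local Notation eta := (Defs.eta R l).
Implicit Types (u v w x y a b c d : V) (X Y Z g : M) (k : R).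

Definition dot u v : R := (u^T *m eta *m v) 0 0.

Lemma dotDl u v w : dot (u + v) w = dot u w + dot v w.
Proof. by rewrite /dot linearD /= !mulmxDl mxE. Qed.

Lemma dotDr u v w : dot w (u + v) = dot w u + dot w v.
Proof. by rewrite /dot mulmxDr mxE. Qed.

Lemma dotZl k u v : dot (k *: u) v = k * dot u v.
Proof. by rewrite /dot linearZ /= -!scalemxAl mxE. Qed.

Lemma dotZr k u v : dot u (k *: v) = k * dot u v.
Proof. by rewrite /dot -scalemxAr mxE. Qed.

Lemma dotNl u v : dot (- u) v = - dot u v.
Proof. by rewrite -scaleN1r dotZl mulN1r. Qed.

Lemma dotNr u v : dot u (- v) = - dot u v.
Proof. by rewrite -scaleN1r dotZr mulN1r. Qed.

Lemma dot0l u : dot 0 u = 0.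
Proof. by rewrite -(scale0r u) dotZl mul0r. Qed.

Lemma dot0r u : dot u 0 = 0.
Proof. by rewrite -(scale0r u) dotZr mul0r. Qed.

Lemma trmx_eta : eta^T = eta.
Proof. exact: tr_diag_mx. Qed.

Lemma dot_sum u v :
  dot u v = \sum_(i < l.+1) (if (i < 2)%N then 1 else -1) * (u i 0 * v i 0).
Proof.
rewrite /dot /Defs.eta mul_mx_diag mxE; apply: eq_bigr => i _.
rewrite !mxE; ring.
Qed.

Lemma dotC u v : dot u v = dot v u.
Proof.
by rewrite !dot_sum; apply: eq_bigr => i _; rewrite [u i 0 * _]mulrC.
Qed.

Definition dotE := (dotDl, dotDr, dotZl, dotZr, dotNl, dotNr, dot0l, dot0r).

Lemma eta_eta : eta *m eta = 1%:M.
Proof.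
rewrite /Defs.eta mulmx_diag; apply/matrixP => i j; rewrite !mxE.
by case: ifP => _; rewrite ?mulrNN mulr1.
Qed.

Lemma dot_eq0 v : (forall x, dot x v = 0) -> v = 0.
Proof.
move=> h; have e0 : eta *m v = 0.
  apply/matrixP => i j; rewrite ord1.
  have := h (delta_mx i 0); rewrite /dot -mulmxA trmx_delta.
  rewrite -rowE; rewrite mxE => ->; by rewrite mxE.
by rewrite -[v]mul1mx -eta_eta -mulmxA e0 mulmx0.
Qed.

Lemma eqmx_vec X Y : (forall v, X *m v = Y *m v) -> X = Y.
Proof.
move=> h; apply/matrixP => i j.
by have /matrixP/(_ i 0) := h (delta_mx j 0); rewrite -!colE !mxE.
Qed.

Lemma eqmx_bilin X Y :
  (forall u v, (u^T *m X *m v) 0 0 = (u^T *m Y *m v) 0 0) -> X = Y.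
Proof.
move=> h; apply/matrixP => i j; have := h (delta_mx i 0) (delta_mx j 0).
by rewrite trmx_delta -!rowE -!colE !mxE.
Qed.

Lemma so_dot X u v : X \in so R l -> dot (X *m u) v = - dot u (X *m v).
Proof.
rewrite mem_so addr_eq0 => /eqP h.
by rewrite /dot trmx_mul -!mulmxA (mulmxA X^T) h mulNmx mulmxN -!mulmxA [LHS]mxE.
Qed.

Lemma dot_so X : (forall u v, dot (X *m u) v = - dot u (X *m v)) -> X \in so R l.
Proof.
move=> h; rewrite mem_so addr_eq0; apply/eqP/eqmx_bilin => u v.
have := h u v; rewrite /dot trmx_mul mulmxN mulNmx -!mulmxA => ->.
by rewrite [RHS]mxE.
Qed.

Lemma so_dot_self X u : X \in so R l -> dot u (X *m u) = 0.
Proof. by move=> hX; have := so_dot u u hX; rewrite dotC; lra. Qed.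

Definition eta_isometry g := g^T *m eta *m g = eta.

Lemma isometry_dot g u v : eta_isometry g -> dot (g *m u) (g *m v) = dot u v.
Proof. by move=> h; rewrite /dot trmx_mul -!mulmxA (mulmxA g^T) (mulmxA _ g) h. Qed.

Lemma dot_isometry g : (forall u v, dot (g *m u) (g *m v) = dot u v) -> eta_isometry g.
Proof.
move=> h; apply: eqmx_bilin => u v.
by have := h u v; rewrite /dot trmx_mul -!mulmxA.
Qed.

(* Locking keeps unification from comparing vectors and matrices entrywise. *)
Fact ads_key : unit. Proof. exact: tt. Qed.
Definition wedge a b : M :=
  locked_with ads_key (a *m (b^T *m eta) - b *m (a^T *m eta)).

Lemma wedgeE a b x : wedge a b *m x = dot b x *: a - dot a x *: b.
Proof.
rewrite /wedge unlock mulmxBl -2!(mulmxA _ (_^T *m _) x) (mx11_scalar (b^T *m eta *m x)).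
by rewrite (mx11_scalar (a^T *m eta *m x)) !mul_mx_scalar.
Qed.

Lemma wedge_so a b : wedge a b \in so R l.
Proof.
apply: dot_so => u v; rewrite !wedgeE !dotE.
by rewrite (dotC u a) (dotC u b); ring.
Qed.

Lemma bracketE X Y v : bracket X Y *m v = X *m (Y *m v) - Y *m (X *m v).
Proof. by rewrite /bracket mulmxBl !mulmxA. Qed.

(** Under [wedge] the algebra [so] is the exterior square of the space, on which it acts by
    derivations. *)
Lemma bracket_wedge X a b : X \in so R l ->
  bracket X (wedge a b) = wedge (X *m a) b + wedge a (X *m b).
Proof.
move=> hX; apply: eqmx_vec => v; rewrite bracketE !wedgeE [RHS]mulmxDl !wedgeE.
rewrite mulmxBr -!scalemxAr !(so_dot _ _ hX) !scaleNr.
move: (X *m a) (X *m b) (dot _ _) (dot _ _) => p r s t.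
by apply/matrixP => i j; rewrite !mxE; ring.
Qed.

Lemma bracket_so X Y : X \in so R l -> Y \in so R l -> bracket X Y \in so R l.
Proof.
move=> hX hY; apply: dot_so => u v.
rewrite !bracketE !dotE !(so_dot _ _ hX) !(so_dot _ _ hY).
by rewrite !(so_dot _ _ hX); ring.
Qed.

End Form.

(** * The matrix exponential *)

Section MatrixLimits.
Variables (R : realType) (T : Type) (F : set_system T).
Context {FF : Filter F}.

(** A neighbourhood of a matrix contains a product of neighbourhoods of its finitely many
    entries. *)
Lemma cvg_mx m n (A : T -> 'M[R]_(m, n)) (B : 'M[R]_(m, n)) :
  (forall i j, A x i j @[x --> F] --> B i j) -> A x @[x --> F] --> B.
Proof.
move=> h U [P nP sPU]; apply: (@filterS _ _ _ [set x | forall i j, P i j (A x i j)]).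
  by move=> x hx; apply: sPU.
by apply: filter_forall => i; apply: filter_forall => j; exact: (h i j _ (nP i j)).
Qed.

Lemma cvg_entry m n (A : T -> 'M[R]_(m, n)) (B : 'M[R]_(m, n)) i j :
  A x @[x --> F] --> B -> A x i j @[x --> F] --> B i j.
Proof. by move=> h; exact: (cvg_comp _ _ h (@coord_continuous _ _ _ i j B)). Qed.

Lemma cvg_sumr (I : Type) (r : seq I) (f : I -> T -> R) (a : I -> R) :
  (forall i, f i x @[x --> F] --> a i) ->
  \sum_(i <- r) f i x @[x --> F] --> \sum_(i <- r) a i.
Proof.
move=> h; elim: r => [|i r IH].
  rewrite big_nil (_ : (fun x => _) = fun=> 0); first exact: cvg_cst.
  by apply/funext => x; rewrite big_nil.
rewrite big_cons (_ : (fun x => _) = (fun x => f i x + \sum_(k <- r) f k x)).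
  exact: cvgD.
by apply/funext => x; rewrite big_cons.
Qed.

Lemma cvg_mulmx m n p (A : T -> 'M[R]_(m, n)) (B : T -> 'M[R]_(n, p))
    (a : 'M[R]_(m, n)) (b : 'M[R]_(n, p)) :
  A x @[x --> F] --> a -> B x @[x --> F] --> b ->
  A x *m B x @[x --> F] --> a *m b.
Proof.
move=> hA hB; apply: cvg_mx => i j; rewrite mxE.
rewrite (_ : (fun x => _) = (fun x => \sum_k A x i k * B x k j)); last first.
  by apply/funext => x; rewrite mxE.
by apply: cvg_sumr => k; apply: cvgM; exact: cvg_entry.
Qed.

Lemma cvg_trmx m n (A : T -> 'M[R]_(m, n)) (a : 'M[R]_(m, n)) :
  A x @[x --> F] --> a -> (A x)^T @[x --> F] --> a^T.
Proof.
move=> h; apply: cvg_mx => i j; rewrite mxE.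
rewrite (_ : (fun x => _) = (fun x => A x j i)); first exact: cvg_entry.
by apply/funext => x; rewrite mxE.
Qed.

Lemma cvg_scalemx m n (f : T -> R) (A : T -> 'M[R]_(m, n)) (c : R)
    (a : 'M[R]_(m, n)) :
  f x @[x --> F] --> c -> A x @[x --> F] --> a ->
  f x *: A x @[x --> F] --> c *: a.
Proof.
move=> hf h; apply: cvg_mx => i j; rewrite mxE.
rewrite (_ : (fun x => _) = (fun x => f x * A x i j)).
  by apply: cvgM => //; exact: cvg_entry.
by apply/funext => x; rewrite mxE.
Qed.

Lemma cvg_addmx m n (A B : T -> 'M[R]_(m, n)) (a b : 'M[R]_(m, n)) :
  A x @[x --> F] --> a -> B x @[x --> F] --> b ->
  A x + B x @[x --> F] --> a + b.
Proof.
move=> hA hB; apply: cvg_mx => i j; rewrite mxE.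
rewrite (_ : (fun x => _) = (fun x => A x i j + B x i j)).
  by apply: cvgD; exact: cvg_entry.
by apply/funext => x; rewrite mxE.
Qed.

Lemma cvg_dot l (A B : T -> 'cV[R]_l.+1) (a b : 'cV[R]_l.+1) :
  A x @[x --> F] --> a -> B x @[x --> F] --> b ->
  dot (A x) (B x) @[x --> F] --> dot a b.
Proof.
move=> hA hB; apply: cvg_entry; apply: cvg_mulmx => //.
by apply: cvg_mulmx; [exact: cvg_trmx | exact: cvg_cst].
Qed.

End MatrixLimits.

Lemma cvg_mx_unique (R : realType) T (F : set_system T) {FF : ProperFilter F}
    m n (A : T -> 'M[R]_(m, n)) (a b : 'M[R]_(m, n)) :
  A x @[x --> F] --> a -> A x @[x --> F] --> b -> a = b.
Proof. exact: (cvg_unique (@norm_hausdorff _ 'M[R]_(m, n))). Qed.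

Lemma sumr_subC (V : zmodType) (I : finType) (P : pred I) (F : I -> V) :
  \sum_i F i - \sum_(i | P i) F i = \sum_(i | ~~ P i) F i.
Proof. by rewrite (bigID P) /= addrAC subrr add0r. Qed.

(** * Products of truncated exponential series *)

Section ExpSum.
Variables (R : numFieldType) (A : algType R).
Implicit Types x y : A.

(** Stated in any algebra, so that the same identities serve for matrices and for the scalars [R^o]
    that dominate them. *)
Definition expsum x n : A := \sum_(0 <= k < n) (k`!%:R)^-1 *: x ^+ k.

Lemma expsum_prod x y n : expsum x n * expsum y n =
  \sum_(p < n) \sum_(q < n) ((p`!%:R)^-1 * (q`!%:R)^-1) *: (x ^+ p * y ^+ q).
Proof.
rewrite /expsum !big_mkord mulr_suml; apply: eq_bigr => p _.
rewrite mulr_sumr; apply: eq_bigr => q _.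
by rewrite -scalerAl -scalerAr scalerA.
Qed.

(** By the binomial formula, the truncation for x + y keeps the triangle p + q < n of the square of
    terms in [expsum_prod]. *)
Lemma expsumD x y n : GRing.comm x y -> expsum (x + y) n =
  \sum_(p < n) \sum_(q < n | (p + q < n)%N)
     ((p`!%:R)^-1 * (q`!%:R)^-1) *: (x ^+ p * y ^+ q).
Proof.
move=> xy; rewrite /expsum big_mkord.
pose G (p q : nat) : A := ((p`!%:R)^-1 * (q`!%:R)^-1) *: (x ^+ p * y ^+ q).
transitivity (\sum_(k < n) \sum_(i < n | (i <= k)%N) G (k - i)%N i).
  apply: eq_bigr => k _; rewrite exprDn_comm // scaler_sumr.
  rewrite (big_ord_widen n (fun i => k`!%:R^-1 *: (x ^+ (k - i) * y ^+ i *+ 'C(k, i)))) //.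
  apply: eq_bigr => i; rewrite ltnS => ik.
  rewrite /G -[_ *+ 'C(k, i)]scaler_nat scalerA; congr (_ *: _).
  rewrite -(bin_fact ik) !natrM.
  have h1 : (i`!%:R : R) != 0 by rewrite pnatr_eq0 -lt0n fact_gt0.
  have h2 : ((k - i)`!%:R : R) != 0 by rewrite pnatr_eq0 -lt0n fact_gt0.
  have h3 : ('C(k, i)%:R : R) != 0 by rewrite pnatr_eq0 -lt0n bin_gt0.
  by field; rewrite h1 h2 h3.
rewrite (exchange_big_dep predT) //= [RHS](exchange_big_dep predT) //=.
apply: eq_bigr => q _.
transitivity (\sum_(q <= k < n) G (k - q)%N q).
  rewrite (big_nat_widenl _ 0) // big_mkord; apply: eq_bigl => k.
  by [].
transitivity (\sum_(p < n - q) G p q).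
  rewrite -{1}[nat_of_ord q]add0n big_addn big_mkord.
  by apply: eq_bigr => p _; rewrite addnK.
rewrite (big_ord_widen n (fun k => G k q)) ?leq_subr //.
by apply: eq_bigl => p; rewrite ltn_subRL addnC.
Qed.

End ExpSum.

Section Expmx.
Variables (R : realType) (n : nat).
Local Notation M := 'M[R]_n.+1.
Local Notation V := 'cV[R]_n.+1.
Implicit Types (X Y B : M) (v : V).

(** A crude norm: it bounds every row sum, hence every entry of X^p by its p-th power. *)
Definition mxsum X : R := \sum_i \sum_j `|X i j|.

Lemma mxsum_ge0 X : 0 <= mxsum X.
Proof. by apply: sumr_ge0 => i _; apply: sumr_ge0. Qed.

Lemma mxsum_row X i : \sum_j `|X i j| <= mxsum X.
Proof.
rewrite /mxsum [leRHS](bigD1 i) //= lerDl.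
by apply: sumr_ge0 => k _; apply: sumr_ge0.
Qed.

Lemma mxsumZ (c : R) X : mxsum (c *: X) = `|c| * mxsum X.
Proof.
rewrite /mxsum mulr_sumr; apply: eq_bigr => i _.
by rewrite mulr_sumr; apply: eq_bigr => j _; rewrite mxE normrM.
Qed.

Lemma norm_mulX X B (c : R) p i j : 0 <= c -> (forall k, `|B k j| <= c) ->
  `|(X ^+ p * B) i j| <= mxsum X ^+ p * c.
Proof.
move=> c0 hB; elim: p i => [|p IH] i; first by rewrite expr0 !mul1r.
rewrite exprS -mulrA -mulmxE mxE; apply: (le_trans (ler_norm_sum _ _ _)).
rewrite exprS -mulrA.
apply: (@le_trans _ _ (\sum_k `|X i k| * (mxsum X ^+ p * c))).
  by apply: ler_sum => k _; rewrite normrM; apply: ler_wpM2l.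
rewrite -mulr_suml; apply: ler_wpM2r (mxsum_row X i).
by rewrite mulr_ge0 // exprn_ge0 // mxsum_ge0.
Qed.

Lemma norm_expX X p i j : `|(X ^+ p) i j| <= mxsum X ^+ p.
Proof.
rewrite -[X ^+ p]mulr1 -[leRHS]mulr1; apply: norm_mulX => // k.
by rewrite !mxE; case: eqP => _; rewrite ?normr1 ?normr0.
Qed.

Lemma norm_expXX X Y p q i j :
  `|(X ^+ p * Y ^+ q) i j| <= mxsum X ^+ p * mxsum Y ^+ q.
Proof.
apply: norm_mulX; first by rewrite exprn_ge0 // mxsum_ge0.
by move=> k; apply: norm_expX.
Qed.

Lemma expsum_entry X m i j :
  expsum X m i j = series (fun p => (p`!%:R)^-1 * (X ^+ p) i j) m.
Proof. by rewrite summxE; apply: eq_bigr => p _; rewrite mxE. Qed.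

Lemma expsum_scalar (x : R) m : expsum (x : R^o) m = series (exp_coeff x) m.
Proof. by apply: eq_bigr => p _; rewrite /exp_coeff /= mulrC. Qed.

(** [expmx] is a [limn], informative only once convergence is known; each entry of the series is
    dominated by the real exponential series of [mxsum X]. *)
Lemma cvg_expmx X : expsum X m @[m --> \oo] --> expmx X.
Proof.
have h i j : cvgn (series (fun p => (p`!%:R)^-1 * (X ^+ p) i j)).
  apply: normed_cvg; apply: (@series_le_cvg _ _ (exp_coeff (mxsum X))).
  - by move=> p; rewrite /= normr_ge0.
  - by move=> p; apply: exp_coeff_ge0; exact: mxsum_ge0.
  - move=> p; rewrite /= normrM ger0_norm ?invr_ge0 ?ler0n // /exp_coeff /= mulrC.
    by apply: ler_wpM2r; rewrite ?invr_ge0 ?ler0n ?norm_expX.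
  - exact: is_cvg_series_exp_coeff.
have hc : cvgn (fun m => expsum X m : M).
  apply/cvg_ex; exists (\matrix_(i, j) limn (series (fun p => (p`!%:R)^-1 * (X ^+ p) i j))).
  apply: cvg_mx => i j; rewrite mxE.
  rewrite (_ : (fun m => _) = series (fun p => (p`!%:R)^-1 * (X ^+ p) i j)); first exact: h.
  by apply/funext => m; rewrite expsum_entry.
exact: hc.
Qed.

(** The product of the truncations minus the truncation for X + Y consists of the terms with p + q
    >= n. Its entries are bounded by the same difference for the scalars [mxsum X] and [mxsum Y],
    which tends to 0 by [expRD]. *)
Lemma expmxD X Y : GRing.comm X Y -> expmx (X + Y) = expmx X *m expmx Y.
Proof.
move=> XY.
have h1 : expsum X m *m expsum Y m @[m --> \oo] --> expmx X *m expmx Y.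
  by apply: cvg_mulmx; exact: cvg_expmx.
have h2 := @cvg_expmx (X + Y).
apply: (cvg_mx_unique h2); apply: cvg_mx => i j.
have h1e := @cvg_entry _ _ _ _ _ _ _ i j h1.
have h2e := @cvg_entry _ _ _ _ _ _ _ i j h2.
pose x := mxsum X; pose y := mxsum Y.
have hs : series (exp_coeff x) m * series (exp_coeff y) m - series (exp_coeff (x + y)) m
    @[m --> \oo] --> (0 : R).
  have hp : series (exp_coeff x) m * series (exp_coeff y) m @[m --> \oo] --> expR x * expR y.
    by apply: cvgM; exact: is_cvg_series_exp_coeff.
  have hq : series (exp_coeff (x + y)) m @[m --> \oo] --> expR (x + y).
    exact: is_cvg_series_exp_coeff.
  rewrite -(subrr (expR (x + y))) [X in X - _]expRD; exact: cvgB hp hq.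
suff hd : (expsum X m *m expsum Y m) i j - expsum (X + Y) m i j @[m --> \oo] --> (0 : R).
  rewrite (_ : (fun m => _) = (fun m => (expsum X m *m expsum Y m) i j -
      ((expsum X m *m expsum Y m) i j - expsum (X + Y) m i j))); last first.
    by apply/funext => m; rewrite opprB addrCA subrr addr0.
  rewrite -[(expmx X *m expmx Y) i j]subr0; exact: cvgB h1e hd.
apply: norm_cvg0; apply: (squeeze_cvgr _ (cvg_cst 0) hs).
apply: nearW => m; rewrite normr_ge0 /=.
  rewrite -!expsum_scalar mulmxE.
  rewrite (expsum_prod (x : R^o)) (@expsumD _ (R^o : algType R)) ?expsum_prod ?expsumD //; last exact: mulrC.
  rewrite !summxE -!sumrB.
  apply: (le_trans (ler_norm_sum _ _ _)); apply: ler_sum => p _.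
  rewrite !summxE !sumr_subC.
  apply: (le_trans (ler_norm_sum _ _ _)); apply: ler_sum => q _.
  rewrite mxE normrM ger0_norm ?mulr_ge0 ?invr_ge0 ?ler0n //.
  by apply: ler_wpM2l; rewrite ?mulr_ge0 ?invr_ge0 ?ler0n ?norm_expXX.
Qed.

End Expmx.

(** * The exponential acting on vectors, one-parameter groups *)

Section ExpAction.
Variables (R : realType) (n : nat).
Local Notation M := 'M[R]_n.+1.
Local Notation V := 'cV[R]_n.+1.
Implicit Types (X Y B : M) (v : V).

Lemma expX_mulv X p v : X ^+ p *m v = iter p (mulmx X) v.
Proof.
elim: p => [|p IH]; first by rewrite expr0 mul1mx.
by rewrite exprS -mulmxE -mulmxA IH.
Qed.

Lemma expsum_mulv X m v :
  expsum X m *m v = \sum_(0 <= p < m) (p`!%:R)^-1 *: iter p (mulmx X) v.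
Proof.
rewrite /expsum mulmx_suml; apply: eq_bigr => p _.
by rewrite -scalemxAl expX_mulv.
Qed.

Lemma cvg_expmx_mulv X v :
  expsum X m *m v @[m --> \oo] --> expmx X *m v.
Proof. by apply: cvg_mulmx; [exact: cvg_expmx | exact: cvg_cst]. Qed.

Lemma expmx_eigen X v (a : R) : X *m v = a *: v -> expmx X *m v = expR a *: v.
Proof.
move=> Xv; apply: (cvg_mx_unique (@cvg_expmx_mulv X v)).
rewrite (_ : (fun m => _) = (fun m => series (exp_coeff a) m *: v)).
  by apply: cvg_scalemx; [exact: is_cvg_series_exp_coeff | exact: cvg_cst].
apply/funext => m; rewrite expsum_mulv scaler_suml; apply: eq_bigr => p _.
suff -> : iter p (mulmx X) v = a ^+ p *: v by rewrite scalerA /exp_coeff /= mulrC.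
elim: p => [|p /= ->]; first by rewrite expr0 scale1r.
by rewrite -scalemxAr Xv scalerA exprSr.
Qed.

(** X need not be nilpotent: the series stops on v alone. Null rotations and the generators of
    light-like geodesics are applied in this way. *)
Lemma expmx_nil3 X v : X *m (X *m (X *m v)) = 0 ->
  expmx X *m v = v + X *m v + 2^-1 *: (X *m (X *m v)).
Proof.
move=> X3; apply: (cvg_mx_unique (@cvg_expmx_mulv X v)).
have it0 p : iter p.+3 (mulmx X) v = 0.
  by elim: p => [|p IH]; [exact: X3 | rewrite iterS IH mulmx0].
rewrite -(cvg_shiftn 3).
rewrite (_ : (fun m => _) = fun=> v + X *m v + 2^-1 *: (X *m (X *m v))); first exact: cvg_cst.
apply/funext => m; rewrite expsum_mulv addnC !big_nat_recl // big1 ?addr0; last first.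
  by move=> p _; rewrite it0 scaler0.
by rewrite /= !factS fact0 !muln1 invr1 !scale1r addrA.
Qed.

Lemma expmx_fix X v : X *m v = 0 -> expmx X *m v = v.
Proof.
by move=> h; rewrite (@expmx_eigen _ _ 0) ?expR0 ?scale1r ?h ?scale0r.
Qed.

Lemma expmx0 : expmx (0 : M) = 1%:M.
Proof. by apply: eqmx_vec => v; rewrite mul1mx expmx_fix // mul0mx. Qed.

Lemma expmxN X : expmx X *m expmx (- X) = 1%:M.
Proof.
rewrite -expmxD ?subrr ?expmx0 //.
by rewrite /GRing.comm mulrN mulNr.
Qed.

Lemma expmxNK X : expmx (- X) *m expmx X = 1%:M.
Proof. by have := expmxN (- X); rewrite opprK. Qed.

Lemma expmx_comm X Y : X *m Y = Y *m X -> expmx X *m Y = Y *m expmx X.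
Proof.
move=> XY; have h1 : expsum X m *m Y @[m --> \oo] --> expmx X *m Y.
  by apply: cvg_mulmx; [exact: cvg_expmx | exact: cvg_cst].
apply: (cvg_mx_unique h1).
rewrite (_ : (fun m => _) = (fun m => Y *m expsum X m)).
  by apply: cvg_mulmx; [exact: cvg_cst | exact: cvg_expmx].
apply/funext => m; rewrite !mulmxE mulr_suml mulr_sumr; apply: eq_bigr => p _.
by rewrite -scalerAl -scalerAr; congr (_ *: _); apply/esym/commrX/esym.
Qed.

Lemma so_expX_dot X p u v : X \in so R n ->
  dot (X ^+ p *m u) v = dot u ((- X) ^+ p *m v).
Proof.
move=> hX; elim: p u v => [|p IH] u v; first by rewrite !expr0 !mul1mx.
rewrite exprS -mulmxE -mulmxA (so_dot _ _ hX) IH -dotNr exprSr -mulmxE -mulmxA.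
by rewrite mulNmx mulmxN.
Qed.

Lemma dot_sumr (I : Type) (r : seq I) (f : I -> V) u :
  dot u (\sum_(i <- r) f i) = \sum_(i <- r) dot u (f i).
Proof. by elim/big_rec2: _ => [|i y1 y2 _ <-]; rewrite ?dot0r ?dotDr. Qed.

Lemma dot_suml (I : Type) (r : seq I) (f : I -> V) u :
  dot (\sum_(i <- r) f i) u = \sum_(i <- r) dot (f i) u.
Proof. by rewrite dotC dot_sumr; apply: eq_bigr => i _; rewrite dotC. Qed.

Lemma so_expmx_dot X u v : X \in so R n ->
  dot (expmx X *m u) v = dot u (expmx (- X) *m v).
Proof.
move=> hX.
have h1 : dot (expsum X m *m u) v @[m --> \oo] --> dot (expmx X *m u) v.
  by apply: cvg_dot; [exact: cvg_expmx_mulv | exact: cvg_cst].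
have h2 : dot u (expsum (- X) m *m v) @[m --> \oo] --> dot u (expmx (- X) *m v).
  by apply: cvg_dot; [exact: cvg_cst | exact: cvg_expmx_mulv].
apply: (cvg_unique (@Rhausdorff R) h1).
rewrite (_ : (fun m => _) = (fun m => dot u (expsum (- X) m *m v))) //.
apply/funext => m; rewrite /expsum !mulmx_suml dot_suml dot_sumr.
by apply: eq_bigr => p _; rewrite -!scalemxAl dotZl dotZr so_expX_dot.
Qed.

Lemma expmx_isometry X : X \in so R n -> eta_isometry (expmx X).
Proof.
move=> hX; apply: dot_isometry => u v.
by rewrite so_expmx_dot // mulmxA expmxNK mul1mx.
Qed.

Lemma det_isometry (g : M) : eta_isometry g -> \det g ^+ 2 = 1.
Proof.
move=> h; have := congr1 determinant h; rewrite !det_mulmx det_tr => hd.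
have e1 : \det (Defs.eta R n) * \det (Defs.eta R n) = 1.
  by rewrite -det_mulmx eta_eta det1.
have e0 : \det (Defs.eta R n) != 0.
  by apply/eqP => e; move: e1; rewrite e mul0r => /esym/eqP; rewrite oner_eq0.
by apply: (mulIf e0); rewrite mul1r -[RHS]hd expr2 mulrAC.
Qed.

Lemma norm_expmx_sub1 X i j :
  `|(expmx X - 1%:M) i j| <= expR (mxsum X) - 1.
Proof.
(* Truncating at [m.+1] lets the constant term 1 be split off on both sides. *)
have h1 : `|(expsum X m.+1 - 1%:M) i j| @[m --> \oo] --> `|(expmx X - 1%:M) i j|.
  apply: cvg_norm.
  have h : expsum X m.+1 @[m --> \oo] --> expmx X.
    by have := @cvg_expmx R n X; rewrite -(cvg_shiftS (expsum X)).
  rewrite !mxE (_ : (fun m => _) = (fun m => expsum X m.+1 i j - (1%:M : M) i j)).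
    by rewrite mxE; apply: cvgB; [exact: cvg_entry | exact: cvg_cst].
  by apply/funext => m; rewrite !mxE.
have h2 : series (exp_coeff (mxsum X)) m.+1 - 1 @[m --> \oo] --> expR (mxsum X) - 1.
  apply: cvgB; last exact: cvg_cst.
  have := @is_cvg_series_exp_coeff R (mxsum X).
  by rewrite /expR -{1}(cvg_shiftS (series (exp_coeff (mxsum X)))).
apply: (ler_cvg_to h1 h2); apply: nearW => m.
rewrite /expsum /series /= !big_nat_recl //= /exp_coeff /= !fact0 !expr0 !mulr1n !invr1 scale1r mulr1.
rewrite addrAC subrr add0r [leRHS]addrAC subrr add0r.
rewrite summxE; apply: (le_trans (ler_norm_sum _ _ _)); apply: ler_sum => p _.
rewrite mxE normrM ger0_norm ?invr_ge0 ?ler0n // mulrC.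
by apply: ler_wpM2r; rewrite ?invr_ge0 ?ler0n ?norm_expX.
Qed.

(** Since e^(sX) = e^(tX) e^((s-t)X), only continuity at 0 has to be estimated. *)
Lemma expmx_path_continuous X : continuous (fun t : R => expmx (t *: X)).
Proof.
move=> t.
have h0 : expmx ((s - t) *: X) @[s --> t] --> (1%:M : M).
  apply: cvg_mx => i j; apply/subr_cvg0; apply: norm_cvg0.
  have hb : expR (mxsum ((s - t) *: X)) - 1 @[s --> t] --> (0 : R).
    rewrite -(subrr (1 : R)); apply: cvgB; last exact: cvg_cst.
    rewrite -[X in _ --> X]expR0; apply: continuous_cvg; first exact: continuous_expR.
    rewrite (_ : (fun s => _) = (fun s => `|s - t| * mxsum X)); last first.
      by apply/funext => s; rewrite mxsumZ.
    rewrite -[Y in _ --> Y](mul0r (mxsum X)); apply: cvgMr_tmp.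
    have h : s - t @[s --> t] --> (0 : R) by apply/subr_cvg0; exact: cvg_id.
    have : `|s - t| @[s --> t] --> `|0 : R| by exact: cvg_norm h.
    by rewrite normr0.
  apply: (squeeze_cvgr _ (cvg_cst 0) hb); apply: nearW => s.
  by have := norm_expmx_sub1 ((s - t) *: X) i j; rewrite !mxE normr_ge0.
rewrite /continuous_at -[X in _ --> X]mulmx1.
rewrite (_ : (fun s => _) = (fun s => expmx (t *: X) *m expmx ((s - t) *: X))).
  by apply: cvg_mulmx; [exact: cvg_cst | exact: h0].
apply/funext => s; rewrite -expmxD; last first.
  by rewrite /GRing.comm -!scalerAl -!scalerAr !scalerA mulrC.
by rewrite -scalerDl addrCA subrr addr0.
Qed.

End ExpAction.

(** * The identity component of the orthogonal group *)

Section DetLimit.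
Variables (R : realType) (T : Type) (F : set_system T).
Context {FF : Filter F}.

Lemma cvg_prodr (I : Type) (r : seq I) (f : I -> T -> R) (a : I -> R) :
  (forall i, f i x @[x --> F] --> a i) ->
  \prod_(i <- r) f i x @[x --> F] --> \prod_(i <- r) a i.
Proof.
move=> h; elim: r => [|i r IH].
  rewrite big_nil (_ : (fun x => _) = fun=> 1); first exact: cvg_cst.
  by apply/funext => x; rewrite big_nil.
rewrite big_cons (_ : (fun x => _) = (fun x => f i x * \prod_(k <- r) f k x)).
  exact: cvgM.
by apply/funext => x; rewrite big_cons.
Qed.

Lemma cvg_det n (A : T -> 'M[R]_n) (a : 'M[R]_n) :
  A x @[x --> F] --> a -> \det (A x) @[x --> F] --> \det a.
Proof.
move=> h; rewrite /determinant; apply: cvg_sumr => s; apply: cvgM.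
  exact: cvg_cst.
by apply: cvg_prodr => i; exact: cvg_entry.
Qed.

End DetLimit.

Section SO0Group.
Variables (R : realType) (l : nat).
Local Notation M := 'M[R]_l.+1.
Local Notation V := 'cV[R]_l.+1.
Local Notation eta := (Defs.eta R l).
Implicit Types (g r s : M) (u v w : V).

Lemma SO0_isometry g : SO0 R l g -> eta_isometry g.
Proof. by move=> /connected_component_sub[]. Qed.

Lemma SO0_dot g u v : SO0 R l g -> dot (g *m u) (g *m v) = dot u v.
Proof. by move=> /SO0_isometry; exact: isometry_dot. Qed.

Lemma eta_isometry1 : eta_isometry (1%:M : M).
Proof. by rewrite /eta_isometry trmx1 mul1mx mulmx1. Qed.

Lemma SO0_1 : SO0 R l 1%:M.
Proof.
apply: connected_component_refl; split; last exact: det1.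
exact: eta_isometry1.
Qed.

(** The determinant of an isometry squares to 1, and its image on a connected set is an interval
    that avoids 0. It is therefore constantly 1, and the set lies in the component of g. *)
Lemma connected_SO0 (C : set M) g :
  connected C -> (forall x, C x -> eta_isometry x) -> C g -> SO0 R l g ->
  C `<=` SO0 R l.
Proof.
move=> cC iC Cg Sg.
have detC x : C x -> \det x = 1.
  move=> Cx.
  have /connected_intervalP itv : connected (determinant @` C).
    apply: connected_continuous_connected cC _.
    apply: continuous_subspaceT => y; exact: (cvg_det (@cvg_id _ (nbhs y))).
  have detg : \det g = 1 by have [] := connected_component_sub Sg.
  have := det_isometry (iC _ Cx).
  have [h|h] := leP 0 (\det x); first by nra.
  move=> h2; have h1 : \det x = -1 by nra.
  have [|||y Cy dy] := itv (\det x) (\det g) _ _ 0.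
  - by exists x.
  - by exists g.
  - by rewrite detg h1; lra.
  by have := det_isometry (iC _ Cy); rewrite dy expr0n /= => /esym/eqP; rewrite oner_eq0.
move=> x Cx; apply: (connected_component_trans Sg).
by apply: (connected_component_max Cg _ cC) => // y Cy; split; [exact: iC | exact: detC].
Qed.

Lemma eta_isometryM g r : eta_isometry g -> eta_isometry r -> eta_isometry (g *m r).
Proof.
by move=> hg hr; apply: dot_isometry => u v; rewrite -!mulmxA !isometry_dot.
Qed.

Lemma SO0_connected : connected (SO0 R l).
Proof. exact: component_connected. Qed.

Lemma continuous_mulmx n (A : M) : continuous (fun B : 'M[R]_(l.+1, n) => A *m B).
Proof. by move=> B; exact: (cvg_mulmx (FF := nbhs_filter B) (cvg_cst A) cvg_id). Qed.

Lemma SO0M g r : SO0 R l g -> SO0 R l r -> SO0 R l (g *m r).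
Proof.
move=> Sg Sr; apply: (@connected_SO0 (mulmx g @` SO0 R l) g) => //.
- apply: connected_continuous_connected SO0_connected _.
  by apply: continuous_subspaceT; exact: continuous_mulmx.
- by move=> _ [x Sx <-]; apply: eta_isometryM; exact: SO0_isometry.
- by exists 1%:M; [exact: SO0_1 | rewrite mulmx1].
Qed.

(** The inverse of an isometry, written as a polynomial in its entries so that continuity is
    immediate. *)
Definition eta_adj g : M := eta *m g^T *m eta.

Lemma continuous_eta_adj : continuous eta_adj.
Proof.
move=> y; have FF := nbhs_filter y.
by apply: cvg_mulmx (cvg_cst _); apply: cvg_mulmx (cvg_cst _) (cvg_trmx cvg_id).
Qed.

Lemma eta_adjK g : eta_isometry g -> eta_adj g *m g = 1%:M.
Proof. by rewrite /eta_adj /eta_isometry -!mulmxA => ->; exact: eta_eta. Qed.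

Lemma eta_adjKV g : eta_isometry g -> g *m eta_adj g = 1%:M.
Proof. by move/eta_adjK/mulmx1C. Qed.

Lemma isometry_unit g : eta_isometry g -> g \in unitmx.
Proof. by move/eta_adjK/mulmx1_unit => []. Qed.

Lemma eta_adj_inv g : eta_isometry g -> eta_adj g = invmx g.
Proof.
move=> h; rewrite -[LHS]mulmx1 -(mulmxV (isometry_unit h)) mulmxA eta_adjK //.
by rewrite mul1mx.
Qed.

Lemma eta_isometry_adj g : eta_isometry g -> eta_isometry (eta_adj g).
Proof.
move=> h; apply: dot_isometry => u v.
by rewrite -(isometry_dot _ _ h) !(mulmxA g (eta_adj g)) !eta_adjKV // !mul1mx.
Qed.

Lemma SO0V g : SO0 R l g -> SO0 R l (invmx g).
Proof.
move=> Sg; rewrite -eta_adj_inv; last exact: SO0_isometry.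
apply: (@connected_SO0 (eta_adj @` SO0 R l) 1%:M) SO0_1 _ _ => //.
- apply: connected_continuous_connected SO0_connected _.
  by apply: continuous_subspaceT; exact: continuous_eta_adj.
- by move=> _ [x Sx <-]; apply: eta_isometry_adj; exact: SO0_isometry.
- by exists 1%:M; [exact: SO0_1 | rewrite /eta_adj trmx1 mulmx1 eta_eta].
Qed.

Lemma SO0_unit g : SO0 R l g -> g \in unitmx.
Proof. by move/SO0_isometry/isometry_unit. Qed.

Lemma SO0_path (f : R -> M) :
  (forall t : R, 0 <= t <= 1 -> f s @[s --> t] --> f t) ->
  (forall t : R, 0 <= t <= 1 -> eta_isometry (f t)) ->
  SO0 R l (f 0) -> SO0 R l (f 1).
Proof.
move=> cf If S0; apply: (@connected_SO0 (f @` `[0, 1]) (f 0)) => //.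
- apply: connected_continuous_connected.
    exact/connected_intervalP/interval_is_interval.
  apply: continuous_in_subspaceT => t; rewrite inE /= in_itv /= => h.
  exact: cf.
- by move=> _ [t + <-]; rewrite /= in_itv /= => /If.
- by exists 0 => //=; rewrite in_itv /= lexx ler01.
- by exists 1 => //=; rewrite in_itv /= lexx ler01.
Qed.

Lemma expmx_SO0 X : X \in so R l -> SO0 R l (expmx X).
Proof.
move=> hX; rewrite -[X]scale1r; apply: (@SO0_path (fun t => expmx (t *: X))).
- by move=> t _; exact: expmx_path_continuous.
- by move=> t _; apply: expmx_isometry; rewrite memvZ.
- by rewrite scale0r expmx0; exact: SO0_1.
Qed.

Definition reflection u : M := 1%:M - (2 / dot u u) *: (u *m (u^T *m eta)).

Lemma reflectionE u x : reflection u *m x = x - (2 * dot u x / dot u u) *: u.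
Proof.
rewrite /reflection mulmxBl mul1mx -scalemxAl -(mulmxA u) (mx11_scalar (u^T *m eta *m x)).
by rewrite mul_mx_scalar scalerA -/(dot u x) mulrAC.
Qed.

Lemma reflection_isometry u : dot u u != 0 -> eta_isometry (reflection u).
Proof.
move=> u0; apply: dot_isometry => x y.
by rewrite !reflectionE !dotE (dotC x u); field.
Qed.

(** For unit vectors, the first mirror sends u to -u and the second, orthogonal to u + v, sends -u
    to v. *)
Definition eta_rot u v : M := reflection (u + v) *m reflection u.

Lemma eta_rotE u v : dot u u = 1 -> dot v v = 1 -> -1 < dot u v -> eta_rot u v *m u = v.
Proof.
move=> uu vv uv; rewrite /eta_rot -mulmxA !reflectionE uu.
have h : dot u v != -1 by apply/eqP; lra.
have -> : u - (2 * 1 / 1) *: u = - u by apply/matrixP => i j; rewrite !mxE; field.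
rewrite !dotE uu vv (dotC v u).
rewrite (_ : 2 * _ / _ = -1); last by field; apply/eqP; lra.
by rewrite scaleN1r opprK addKr.
Qed.

Lemma cvg_reflection (T : Type) (F : set_system T) (FF : Filter F) (A : T -> V) u :
  dot u u != 0 -> A x @[x --> F] --> u -> reflection (A x) @[x --> F] --> reflection u.
Proof.
move=> u0 hA; rewrite /reflection.
have h : - ((2 / dot (A x) (A x)) *: (A x *m ((A x)^T *m eta))) @[x --> F]
    --> - ((2 / dot u u) *: (u *m (u^T *m eta))).
  rewrite -scaleNr (_ : (fun x => _) = (fun x => - (2 / dot (A x) (A x)) *: (A x *m ((A x)^T *m eta)))); last first.
    by apply/funext => x; rewrite scaleNr.
  apply: cvg_scalemx.
    apply: cvgN; apply: cvgM; first exact: cvg_cst.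
    by apply: cvgV => //; exact: cvg_dot.
  apply: cvg_mulmx => //; apply: cvg_mulmx; last exact: cvg_cst.
  exact: cvg_trmx.
by apply: cvg_addmx => //; exact: cvg_cst.
Qed.

(** Moving the second mirror along z = u + t v gives a path from [reflection u *m reflection u], the
    identity. The mirror never becomes null, because <z, z> = (1 - t)^2 + 2 t (1 + <u, v>). *)
Lemma eta_rot_SO0 u v : dot u u = 1 -> dot v v = 1 -> -1 < dot u v -> SO0 R l (eta_rot u v).
Proof.
move=> uu vv uv; pose z (t : R) := u + t *: v.
have zz t : 0 <= t <= 1 -> dot (z t) (z t) != 0.
  move=> /andP[t0 t1]; rewrite /z !dotE uu vv (dotC v u).
  have h1 : 0 < dot u v + 1 by lra.
  have h2 : 0 <= t * (dot u v + 1) by rewrite mulr_ge0 // ltW.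
  apply/eqP => e; have [t1'|t1'] := eqVneq t 1; first by move: e; rewrite t1'; lra.
  have : 0 < (1 - t) ^+ 2 by rewrite exprn_even_gt0 //= subr_eq0 eq_sym.
  by move: e; lra.
rewrite /eta_rot -[v in u + v]scale1r.
apply: (@SO0_path (fun t => reflection (z t) *m reflection u)).
- move=> t /zz h; apply: cvg_mulmx; last exact: cvg_cst.
  apply: cvg_reflection => //; apply: cvg_addmx; first exact: cvg_cst.
  by apply: cvg_scalemx; [exact: cvg_id | exact: cvg_cst].
- move=> t /zz h; apply: eta_isometryM; apply: reflection_isometry => //.
  by rewrite uu oner_eq0.
- rewrite /z scale0r addr0 (_ : _ *m _ = 1%:M); first exact: SO0_1.
  apply: eqmx_vec => x; rewrite mul1mx -mulmxA !reflectionE uu !dotE uu.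
  by apply/matrixP => i j; rewrite !mxE; field.
Qed.

Lemma eta_rot_id u : dot u u = 1 -> eta_rot u u = 1%:M.
Proof.
move=> uu; apply: eqmx_vec => x; rewrite mul1mx -mulmxA !reflectionE uu !dotE uu.
by apply/matrixP => i j; rewrite !mxE; field.
Qed.

(** So [eta_rot u] is a local section of the orbit map of u near u, continuous at u; it compares the
    quotient topology with that of the quadric. *)
Lemma cvg_eta_rot u : dot u u = 1 -> eta_rot u v @[v --> u] --> (1%:M : M).
Proof.
move=> uu; rewrite -(eta_rot_id uu); have FF := nbhs_filter u.
apply: cvg_mulmx (cvg_cst _); apply: cvg_reflection; first by rewrite !dotE uu; apply/eqP; lra.
by apply: cvg_addmx (cvg_cst _) cvg_id.
Qed.

End SO0Group.

(** * Points and topology of AdS *)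

Section Points.
Variables (R : realType) (l : nat) (D : ads_data R l).
Local Notation M := 'M[R]_l.+1.
Local Notation V := 'cV[R]_l.+1.
Local Notation v0 := (base_vec D).
Local Notation G := (SO0 R l).
Implicit Types (g r s : M) (u v w : V) (P : V -> Prop).

(** When g sends the base vector to v, this is the coset gH. *)
Definition fib v : set M := [set g | G g /\ g *m v0 = v].

Definition pts P : set (set M) := [set fib v | v in [set v | dot v v = 1 /\ P v]].

Lemma pt_fib r : G r -> pt D r = fib (r *m v0).
Proof.
move=> Sr; apply/seteqP; split=> [_ [k [Sk kv] <-]|g [Sg gv]].
  by split; [exact: SO0M | rewrite -mulmxA kv].
exists (invmx r *m g); last by rewrite mulKVmx // SO0_unit.
split; first by apply: SO0M => //; exact: SO0V.
by rewrite -mulmxA gv mulKmx // SO0_unit.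
Qed.

Lemma act_fib g v : G g -> act g (fib v) = fib (g *m v).
Proof.
move=> Sg; apply/seteqP; split=> [_ [k [Sk kv] <-]|h [Sh hv]].
  by split; [exact: SO0M | rewrite -mulmxA kv].
exists (invmx g *m h); last by rewrite mulKVmx // SO0_unit.
split; first by apply: SO0M => //; exact: SO0V.
by rewrite -mulmxA hv mulKmx // SO0_unit.
Qed.

Variable tau : V.
Hypotheses (v00 : dot v0 v0 = 1) (tautau : dot tau tau = 1) (tauv0 : dot v0 tau = 0).

(** A single [eta_rot] does not reach the v with <v0, v> <= -1. Passing through tau or -tau,
    whichever has nonnegative product with v, keeps both products above -1. *)
Lemma SO0_transitive v : dot v v = 1 -> exists2 r, G r & r *m v0 = v.
Proof.
move=> vv.
have H t : dot t t = 1 -> dot v0 t = 0 -> 0 <= dot t v -> exists2 r, G r & r *m v0 = v.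
  move=> tt t0 h; exists (eta_rot t v *m eta_rot v0 t).
    by apply: SO0M; apply: eta_rot_SO0 => //; rewrite ?t0; lra.
  by rewrite -mulmxA !eta_rotE //; rewrite ?t0; lra.
have [h|h] := leP 0 (dot tau v); first exact: (H tau).
by apply: (H (- tau)); rewrite !dotE ?opprK ?tauv0 ?oppr0 // oppr_ge0 ltW.
Qed.

Lemma fib_inj v w : dot v v = 1 -> fib v = fib w -> v = w.
Proof.
move=> /SO0_transitive[r Sr rv] e.
have : fib w r by rewrite -e.
by case=> _ <-.
Qed.

Lemma ptsE P v : dot v v = 1 -> pts P (fib v) <-> P v.
Proof.
move=> vv; split=> [[w [ww Pw] e]|Pv]; last by exists v.
by rewrite -(fib_inj ww e).
Qed.

Lemma AdS_pts : AdS D = pts (fun=> True).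
Proof.
apply/seteqP; split=> [_ [r Sr <-]|_ [v [vv _] <-]].
  by exists (r *m v0); [split=> //; rewrite (SO0_dot _ _ Sr) | rewrite pt_fib].
by have [r Sr rv] := SO0_transitive vv; exists r => //; rewrite pt_fib // rv.
Qed.

Lemma AdS_fib v : dot v v = 1 -> AdS D (fib v).
Proof. by move=> vv; rewrite AdS_pts; exists v. Qed.

Lemma pts_sub P : pts P `<=` AdS D.
Proof. by move=> _ [v [vv _] <-]; exact: AdS_fib. Qed.

Lemma pts_compl P : AdS D `\` pts P = pts (fun v => ~ P v).
Proof.
rewrite AdS_pts; apply/seteqP; split=> [_ [[v [vv _] <-]] h|_ [v [vv h] <-]].
  by exists v => //; split=> // Pv; apply: h; exists v.
split; first by exists v.
by move/(ptsE _ vv).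
Qed.

(** The section [eta_rot v w *m r] lies over w and tends to r as w tends to v, so it ends up in the
    open set of matrices over U. *)
Lemma ads_open_nbhs (U : set (set M)) v : ads_open D U -> dot v v = 1 -> U (fib v) ->
  \forall w \near v, dot w w = 1 -> U (fib w).
Proof.
move=> [_ /open_subspaceP[W oW WU]] vv Uv.
have [r Sr rv] := SO0_transitive vv.
have Wr : W r.
  have : (W `&` G) r by rewrite WU; split=> //; split=> //; rewrite pt_fib // rv.
  by case.
have FF := nbhs_filter v.
have h1 : eta_rot v w *m r @[w --> v] --> r.
  by rewrite -[X in _ --> X]mul1mx; apply: cvg_mulmx (cvg_cst _); exact: cvg_eta_rot.
have h2 : dot v w @[w --> v] --> dot v v by apply: cvg_dot (cvg_cst _) cvg_id.
have n1 : \forall w \near v, W (eta_rot v w *m r) by apply: h1; exact: open_nbhs_nbhs.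
have n2 : \forall w \near v, -1 < dot v w.
  by apply: (cvgr_gt _ h2); rewrite vv; lra.
apply: filterS2 n1 n2 => w Ww cw ww.
have Srw : G (eta_rot v w *m r) by apply: SO0M => //; exact: eta_rot_SO0.
have : (W `&` G) (eta_rot v w *m r) by split.
rewrite WU => -[[_ +] _]; rewrite pt_fib // -mulmxA rv eta_rotE //.
Qed.

Lemma nbhs_ads_open (U : set (set M)) : U `<=` AdS D ->
  (forall v, dot v v = 1 -> U (fib v) -> \forall w \near v, dot w w = 1 -> U (fib w)) ->
  ads_open D U.
Proof.
move=> UA h; split=> //.
apply/open_subspaceP.
exists [set s | G s -> U (pt D s)]°; first exact: open_interior.
apply/seteqP; split=> r [/= hr Sr]; split=> //.
  by split=> //; have := nbhs_singleton hr; apply.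
move: hr => [_ Ur].
have vv : dot (r *m v0) (r *m v0) = 1 by rewrite SO0_dot.
have hn := h _ vv; rewrite -pt_fib // in hn; have {hn} hn := hn Ur.
have FF := nbhs_filter r.
have hc : s *m v0 @[s --> r] --> r *m v0 by apply: cvg_mulmx cvg_id (cvg_cst _).
have n1 : \forall s \near r, dot (s *m v0) (s *m v0) = 1 -> U (fib (s *m v0)) by exact: (hc _ hn).
apply: filterS n1 => s hs Ss.
by rewrite pt_fib //; apply: hs; rewrite SO0_dot.
Qed.

Definition vboundary P v : Prop := forall N : set V, nbhs v N ->
  (exists w, [/\ N w, dot w w = 1 & P w]) /\ (exists w, [/\ N w, dot w w = 1 & ~ P w]).

Lemma ads_boundary_pts P : ads_boundary D (pts P) = pts (vboundary P).
Proof.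
apply/seteqP; split=> [x [+ hx]|_ [v [vv hv] <-]].
  rewrite {1}AdS_pts => -[v [vv _] xv]; subst x.
  exists v => //; split=> // N nN.
  (* The points over the interior of N form an open set, against which the boundary property is
     tested. *)
  have oU : ads_open D (pts (fun w => nbhs w N)).
    apply: nbhs_ads_open; first exact: pts_sub.
    move=> w ww /(ptsE _ ww) nw.
    have := nbhs_interior nw; apply: filterS => z nz zz.
    by apply/ptsE.
  have [|[x [[w [ww nw] <-] /(ptsE _ ww) Pw]] [y [[z [zz nz] <-]]]] := hx _ oU.
    by apply/ptsE.
  rewrite pts_compl => /(ptsE _ zz) Pz.
  by split; [exists w | exists z]; split=> //; exact: nbhs_singleton.
split=> [|U oU Uv]; first exact: AdS_fib.
have [[w [Nw ww Pw]] [z [Nz zz Pz]]] := hv _ (ads_open_nbhs oU vv Uv).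
split; first by exists (fib w); split; [exact: Nw | apply/ptsE].
by exists (fib z); split; [exact: Nz | rewrite pts_compl; apply/ptsE].
Qed.

End Points.

(** * The Killing form *)

Section Killing.
Variables (R : realType) (l : nat).
Local Notation M := 'M[R]_l.+1.
Local Notation eta := (Defs.eta R l).
Local Notation g := (so R l).
Implicit Types (X Y Z A B : M).

Lemma so_eta_tr X : X \in g -> eta *m X^T *m eta = - X.
Proof.
rewrite mem_so addr_eq0 => /eqP h.
by rewrite -mulmxA h mulmxN mulmxA eta_eta mul1mx.
Qed.

Lemma so_tr0 X : X \in g -> \tr X = 0.
Proof.
move=> /so_eta_tr h; have := congr1 (@mxtrace R l.+1) h.
rewrite mxtrace_mulC mulmxA eta_eta mul1mx mxtrace_tr raddfN /= => e; lra.
Qed.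

Lemma delta_sandwich A B i j p q : (A *m delta_mx i j *m B) p q = A p i * B j q.
Proof.
rewrite mxE (bigD1 j) //= big1 ?addr0 => [|k kj].
  rewrite mxE (bigD1 i) //= big1 ?addr0 => [|k ki]; rewrite !mxE ?eqxx ?mulr1 //.
  by rewrite (negPf ki) mulr0.
rewrite mxE big1 ?mul0r // => m _.
by rewrite !mxE (negPf kj) andbF mulr0.
Qed.

(** The left side is the trace of Z |-> A Z B; [sum_sandwichV] does the same for Z |-> A Z^T B. *)
Lemma sum_sandwich A B : \sum_i \sum_j (A *m delta_mx i j *m B) i j = \tr A * \tr B.
Proof.
rewrite /mxtrace mulr_suml; apply: eq_bigr => i _.
by rewrite mulr_sumr; apply: eq_bigr => j _; rewrite delta_sandwich.
Qed.

Lemma sum_sandwichV A B :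
  \sum_i \sum_j (A *m delta_mx j i *m B) i j = \tr (A *m B^T).
Proof.
rewrite /mxtrace; apply: eq_bigr => i _; rewrite mxE.
by apply: eq_bigr => j _; rewrite delta_sandwich mxE.
Qed.

Definition so_proj Z : M := 2^-1 *: (Z - eta *m Z^T *m eta).

Lemma so_projE X : X \in g -> so_proj X = X.
Proof.
move=> /so_eta_tr h; rewrite /so_proj h.
by apply/matrixP => i j; rewrite !mxE; field.
Qed.

Lemma so_proj_so Z : so_proj Z \in g.
Proof.
rewrite memvZ // mem_so linearB /= !trmx_mul trmxK trmx_eta mulmxBl mulmxBr.
rewrite -!mulmxA eta_eta mulmx1 !mulmxA eta_eta mul1mx.
by rewrite addrA subrK subrr.
Qed.

Lemma so_proj_linear : linear so_proj.
Proof.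
move=> a X Y; rewrite /so_proj linearP /= mulmxDr mulmxDl -scalemxAr -scalemxAl.
move: (eta *m X^T *m eta) (eta *m Y^T *m eta) => X' Y'.
by apply/matrixP => i j; rewrite !mxE; ring.
Qed.

HB.instance Definition _ :=
  GRing.isLinear.Build R M M *:%R so_proj so_proj_linear.

Lemma bracket_linear X : linear (bracket X).
Proof.
move=> a A B; rewrite -!adE; exact: linearP.
Qed.

HB.instance Definition _ X :=
  GRing.isLinear.Build R M M *:%R (bracket X) (bracket_linear X).

Lemma bracket_bracket X Y Z : bracket X (bracket Y Z) =
  X *m Y *m Z *m 1%:M - X *m Z *m Y - Y *m Z *m X + 1%:M *m Z *m (Y *m X).
Proof.
rewrite /bracket mulmx1 mul1mx mulmxBr mulmxBl !mulmxA opprB addrA.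
by rewrite [LHS]addrAC -!addrA; congr (_ + _); rewrite addrC -!addrA; congr (_ + _); rewrite addrC.
Qed.

(** A trace over g is the trace over all matrices after precomposing with a projection onto g. This
    replaces the unspecified [vbasis g] by the elementary matrices. *)
Lemma killing_trace X Y : X \in g -> Y \in g -> killing g X Y =
  \sum_i \sum_j bracket X (bracket Y (so_proj (delta_mx i j))) i j.
Proof.
move=> hX hY; pose b := vbasis g.
pose f := bracket X \o bracket Y.
transitivity (\sum_(k < \dim g) \sum_i \sum_j
    coord b k (so_proj (delta_mx i j)) * f b`_k i j); last first.
  rewrite exchange_big; apply: eq_bigr => i _.
  rewrite exchange_big; apply: eq_bigr => j _.
  rewrite [in RHS](coord_vbasis (so_proj_so (delta_mx i j))).
  rewrite !linear_sum summxE; apply: eq_bigr => k _.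
  by move: (coord _ _ _) => c; rewrite 2!linearZ [RHS]mxE.
apply: eq_bigr => k _; rewrite -/(f _) -/b.
have fb : f b`_k \in g by apply: bracket_so => //; apply: bracket_so => //; apply/vbasis_mem/mem_nth; rewrite size_tuple.
have e : f b`_k = so_proj (\sum_i \sum_j f b`_k i j *: delta_mx i j).
  by rewrite -matrix_sum_delta so_projE.
transitivity (coord b k (so_proj (\sum_i \sum_j f b`_k i j *: delta_mx i j))).
  by rewrite -e.
rewrite 2!linear_sum; apply: eq_bigr => i _; rewrite 2!linear_sum; apply: eq_bigr => j _.
by rewrite (linearZ_LR so_proj) linearZ mulrC.
Qed.

(** The factor is the n - 2 of so(n), for matrices of size n = l + 1. It comes from expanding [X,
    [Y, Z]] into four sandwiches, each with a direct and a transposed contribution. *)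
Lemma killingE X Y : X \in g -> Y \in g ->
  killing g X Y = (l%:R - 1) * \tr (X *m Y).
Proof.
move=> hX hY; rewrite killing_trace //.
have t A B : \sum_i \sum_j (A *m so_proj (delta_mx i j) *m B) i j =
    2^-1 * (\tr A * \tr B - \tr (A *m eta *m (eta *m B)^T)).
  rewrite -sum_sandwich -sum_sandwichV -sumrB mulr_sumr; apply: eq_bigr => i _.
  rewrite -sumrB mulr_sumr; apply: eq_bigr => j _.
  rewrite /so_proj -scalemxAr -scalemxAl mulmxBr mulmxBl trmx_delta !mulmxA.
  by rewrite [LHS]mxE [X in _ * X]mxE [X in _ * (_ + X)]mxE.
transitivity (\sum_i \sum_j (X *m Y *m so_proj (delta_mx i j) *m 1%:M) i j
  - \sum_i \sum_j (X *m so_proj (delta_mx i j) *m Y) i j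
  - \sum_i \sum_j (Y *m so_proj (delta_mx i j) *m X) i j
  + \sum_i \sum_j (1%:M *m so_proj (delta_mx i j) *m (Y *m X)) i j).
  rewrite -!sumrB -big_split; apply: eq_bigr => i _; rewrite -!sumrB -big_split.
  by apply: eq_bigr => j _; rewrite bracket_bracket !mxE.
rewrite !t mulmx1 trmx_eta mxtrace1 !trmx_mul trmx_eta -!mulmxA !mulmxA.
have e A B : B \in g -> \tr (A *m eta *m B^T *m eta) = - \tr (A *m B).
  by move=> hB; rewrite -!mulmxA (mulmxA eta) so_eta_tr // mulmxN raddfN.
have -> : X *m Y *m eta *m eta = X *m Y by rewrite -mulmxA eta_eta mulmx1.
have -> : 1%:M *m eta *m X^T *m Y^T *m eta = X *m Y.
  rewrite mul1mx -[Y^T]mul1mx -eta_eta -!mulmxA (mulmxA eta Y^T) so_eta_tr //.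
  by rewrite !mulmxA so_eta_tr // mulNmx mulmxN opprK.
rewrite (e X Y hY) (e Y X hX) (so_tr0 hX) (so_tr0 hY) (mxtrace_mulC Y X).
by rewrite -[l.+1%:R]natr1; field.
Qed.

End Killing.

(** * Signature and root vectors *)

Section Signature.
Variables (R : realType) (l : nat).
Local Notation M := 'M[R]_l.+1.
Local Notation V := 'cV[R]_l.+1.
Local Notation g := (so R l).
Implicit Types (u v w x y a b c d e f : V) (X Y : M).

Lemma dot_neg x : (forall i : 'I_l.+1, (i < 2)%N -> x i 0 = 0) ->
  0 <= dot x x -> x = 0.
Proof.
move=> h hx; apply/matrixP => i j; rewrite ord1 mxE.
have s0 : \sum_i x i 0 ^+ 2 <= 0.
  suff -> : \sum_i x i 0 ^+ 2 = - dot x x by rewrite oppr_le0.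
  rewrite dot_sum -sumrN; apply: eq_bigr => k _; case: ifP => [/h->|_]; ring.
have s1 : \sum_i x i 0 ^+ 2 = 0.
  by apply/eqP; rewrite eq_le s0 sumr_ge0 // => k _; exact: sqr_ge0.
have /(_ (fun k _ => sqr_ge0 _) i isT)/eqP := psumr_eq0P _ s1.
by rewrite sqrf_eq0 => /eqP.
Qed.

(** Three vectors have only two positive coordinates each, so a nontrivial combination p u + q v + r
    w has none. If <w, w> >= 0, its square norm p^2 + q^2 + r^2 <w, w> is nonnegative, which forces
    the combination to vanish. *)
Lemma neg_definite u v w : (0 < l)%N -> dot u u = 1 -> dot v v = 1 -> dot u v = 0 ->
  dot w u = 0 -> dot w v = 0 -> w != 0 -> dot w w < 0.
Proof.
move=> l0 uu vv uv wu wv w0; rewrite ltNge; apply/negP => ww.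
pose A : 'M[R]_(3, 2) := \matrix_(i, j)
  (if i == 0 then u (inord j) 0 else if i == 1 then v (inord j) 0 else w (inord j) 0).
have : kermx A != 0.
  by rewrite -mxrank_eq0 mxrank_ker subn_eq0 -ltnNge (leq_ltn_trans (rank_leq_col A)).
case/rowV0Pn => z /sub_kermxP zA z0.
pose p := z 0 0; pose q := z 0 1; pose r := z 0 2%:R.
pose x := p *: u + q *: v + r *: w.
have zz : [\/ p != 0, q != 0 | r != 0].
  apply/or3P; apply: contra_neqT z0; rewrite !negb_or !negbK => /and3P[/eqP e0 /eqP e1 /eqP e2].
  apply/matrixP => i j; rewrite ord1 mxE.
  case: j => -[|[|[|//]]] hj.
  - by rewrite -[RHS]e0; congr (z _ _); apply: val_inj.
  - by rewrite -[RHS]e1; congr (z _ _); apply: val_inj.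
  - by rewrite -[RHS]e2; congr (z _ _); apply: val_inj.
have xx : dot x x = p ^+ 2 + q ^+ 2 + r ^+ 2 * dot w w.
  by rewrite /x !dotE uu vv uv wu wv (dotC v u) (dotC u w) (dotC v w) uv wu wv; ring.
have x0 : x = 0.
  apply: dot_neg; last by rewrite xx !addr_ge0 ?sqr_ge0 // mulr_ge0 ?sqr_ge0.
  move=> i i2; have /matrixP/(_ 0 (Ordinal i2)) := zA.
  rewrite !mxE !big_ord_recl big_ord0 !mxE /= => e.
  have ii : inord i = i by apply: val_inj; rewrite /= inordK.
  move: e; rewrite !ii addr0 /p /q /r => <-.
  rewrite addrA; congr (_ * _ + _ * _ + _ * _); congr (z _ _); exact: val_inj.
have := xx; rewrite x0 dot0l => e.
have rw : 0 <= r ^+ 2 * dot w w by rewrite mulr_ge0 ?sqr_ge0.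
have p0 : p = 0 by apply/eqP; rewrite -sqrf_eq0; apply/eqP; nra.
have q0 : q = 0 by apply/eqP; rewrite -sqrf_eq0; apply/eqP; nra.
have r0 : r != 0 by case: zz => //; rewrite ?p0 ?q0 eqxx.
move: x0; rewrite /x p0 q0 !scale0r !add0r => /eqP.
by rewrite scaler_eq0 (negPf r0) (negPf w0).
Qed.

Lemma wedgeC a b : wedge a b = - wedge b a.
Proof. by rewrite /wedge !unlock opprB. Qed.

Lemma wedgeDl a b c : wedge (a + b) c = wedge a c + wedge b c.
Proof.
apply: eqmx_vec => x; rewrite [RHS]mulmxDl !wedgeE !dotE.
by apply/matrixP => i j; rewrite !mxE; ring.
Qed.

Lemma wedgeZl k a c : wedge (k *: a) c = k *: wedge a c.
Proof.
apply: eqmx_vec => x; rewrite -scalemxAl !wedgeE !dotE.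
by apply/matrixP => i j; rewrite !mxE; ring.
Qed.

Lemma wedgeZr k a c : wedge c (k *: a) = k *: wedge c a.
Proof. by rewrite wedgeC wedgeZl -scalerN -wedgeC. Qed.

Lemma wedge_tr a b c d : \tr (wedge a b *m wedge c d) =
  2 * (dot b c * dot a d - dot a c * dot b d).
Proof.
have t (p q : V) : \tr (p *m (q^T *m Defs.eta R l)) = dot q p.
  by rewrite mxtrace_mulC /dot; rewrite [X in \tr X]mx11_scalar mxtrace_scalar.
rewrite {2}/wedge unlock mulmxBr [wedge a b *m _]mulmxA [X in _ - X]mulmxA raddfB /= !t.
by rewrite !wedgeE !dotE (dotC c a) (dotC c b) (dotC d a) (dotC d b); ring.
Qed.

(** X raises the weight of J by one, and J has weight 1 on f, -1 on f' and 0 on their complement.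
    Hence X kills f, sends f' into the complement and the complement into the line of f; skewness
    gives the coefficients. *)
Lemma root_vector f f' X : dot f f = 0 -> dot f' f' = 0 -> dot f f' = 2 ->
  X \in g -> bracket (2^-1 *: wedge f f') X = X ->
  [/\ X = wedge f (- 2^-1 *: (X *m f')), dot (X *m f') f = 0 & dot (X *m f') f' = 0].
Proof.
move=> ff ff'' ff' hX hJ.
pose J := 2^-1 *: wedge f f'.
have JE x : J *m x = 2^-1 *: (dot f' x *: f - dot f x *: f').
  by rewrite /J -scalemxAl wedgeE.
have Jf x : dot f (J *m x) = - dot f x.
  by rewrite JE !dotE ff ff'; field.
have Jf' x : dot f' (J *m x) = dot f' x.
  by rewrite JE !dotE ff'' (dotC f' f) ff'; field.
have JX x : J *m (X *m x) = X *m (J *m x) + X *m x.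
  by rewrite -{3}hJ bracketE addrC subrK.
have Jff : J *m f = f.
  by rewrite JE ff (dotC f' f) ff'; apply/matrixP => i j; rewrite !mxE; field.
have Jff' : J *m f' = - f'.
  by rewrite JE ff'' ff'; apply/matrixP => i j; rewrite !mxE; field.
set y := X *m f'.
have Jy : J *m y = 0 by rewrite JX Jff' mulmxN addNr.
have fy : dot f y = 0 by have := Jf y; rewrite Jy dot0r => /esym/eqP; rewrite oppr_eq0 => /eqP.
have fy' : dot f' y = 0 by have := Jf' y; rewrite Jy dot0r.
have Xf : X *m f = 0.
  have Jz : J *m (X *m f) = 2 *: (X *m f) by rewrite JX Jff scaler_nat mulr2n.
  have h1 : dot f (X *m f) = 0 by have := Jf (X *m f); rewrite Jz dotZr; lra.
  have h2 : dot f' (X *m f) = 0 by have := Jf' (X *m f); rewrite Jz dotZr; lra.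
  have /eqP := Jz; rewrite JE h1 h2 !scale0r subr0 scaler0 eq_sym scaler_eq0.
  by rewrite pnatr_eq0 => /eqP.
rewrite ![dot y _]dotC; split=> //.
apply: eqmx_vec => x.
pose w := x - (2^-1 * dot f' x) *: f - (2^-1 * dot f x) *: f'.
have ex : x = (2^-1 * dot f' x) *: f + (2^-1 * dot f x) *: f' + w.
  by rewrite /w; apply/matrixP => i j; rewrite !mxE; ring.
have fw : dot f w = 0 by rewrite /w !dotE ff ff'; field.
have fw' : dot f' w = 0 by rewrite /w !dotE ff'' (dotC f' f) ff'; field.
clearbody w.
have Jw : J *m w = 0 by rewrite JE fw fw' !scale0r subr0 scaler0.
have JXw : J *m (X *m w) = X *m w by rewrite JX Jw mulmx0 add0r.
have h1 : dot f (X *m w) = 0 by have := Jf (X *m w); rewrite JXw; lra.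
have h2 : dot f' (X *m w) = - dot y x.
  have -> : dot y x = dot y w by rewrite {1}ex !dotE (dotC y f) (dotC y f') fy fy'; ring.
  by rewrite /y (so_dot _ _ hX) opprK.
rewrite {1}ex !mulmxDr -!scalemxAr Xf -/y -JXw JE h1 h2 wedgeE !dotE.
by apply/matrixP => i j; rewrite !mxE; ring.
Qed.

End Signature.

(** * The frame of R^(2,l-1) adapted to J1 and J2 *)

Section Frame.
Variables (R : realType) (l : nat) (D : ads_data R l).
Hypotheses (hl : (3 <= l)%N) (hD : ads_axioms D).
Local Notation M := 'M[R]_l.+1.
Local Notation V := 'cV[R]_l.+1.
Local Notation g := (so R l).
Local Notation v0 := (base_vec D).
Local Notation sg := (sigma D).
Local Notation th := (theta D).
Implicit Types (u v w x y a b c d e f : V) (X Y Z : M).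

Lemma mem_leigenspace (s : 'End(M)) (k : R) X :
  (X \in passmx.leigenspace s k) = (s X == k *: X).
Proof.
rewrite /passmx.leigenspace memv_ker add_lfunE opp_lfunE scale_lfunE id_lfunE.
by rewrite subr_eq0.
Qed.

Lemma mem_eigen_in (s : 'End(M)) (k : R) X :
  (X \in eigen_in g s k) = (X \in g) && (s X == k *: X).
Proof. by rewrite /eigen_in memv_cap (mem_leigenspace s k X). Qed.

Lemma mem_root_space (p q : R) X : (X \in root_space D p q) =
  [&& X \in g, bracket (J1 D) X == p *: X & bracket (J2 D) X == q *: X].
Proof.
rewrite /root_space memv_cap (mem_leigenspace (ad (J2 D)) q X).
by rewrite memv_cap (mem_leigenspace (ad (J1 D)) p X) !adE andbA.
Qed.

Lemma dot_v0 : dot v0 v0 = 1.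
Proof. exact: (base_vec_norm hD). Qed.

Lemma sigma_so X : X \in g -> sg X \in g.
Proof. by have [h _ _] := sigma_invol hD; exact: h. Qed.

Lemma sigmaK X : X \in g -> sg (sg X) = X.
Proof. by have [_ _ h] := sigma_invol hD; exact: h. Qed.

Lemma sigma_bracket X Y : X \in g -> Y \in g -> sg (bracket X Y) = bracket (sg X) (sg Y).
Proof. by have [_ h _] := sigma_invol hD; exact: h. Qed.

Lemma theta_so X : X \in g -> th X \in g.
Proof. by have [[h _ _] _] := theta_cartan hD; exact: h. Qed.

Lemma thetaK X : X \in g -> th (th X) = X.
Proof. by have [[_ _ h] _] := theta_cartan hD; exact: h. Qed.

Lemma theta_bracket X Y : X \in g -> Y \in g -> th (bracket X Y) = bracket (th X) (th Y).
Proof. by have [[_ h _] _] := theta_cartan hD; exact: h. Qed.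

Lemma sigma_fixE X : X \in g -> (sg X == X) = (X *m v0 == 0).
Proof.
move=> hX; have := congr1 (fun U : {vspace M} => X \in U) (sigma_fix hD).
by rewrite mem_eigen_in mem_so_stab hX scale1r.
Qed.

Lemma q_spaceE X : (X \in q_space D) = (X \in g) && (sg X == - X).
Proof. by rewrite mem_eigen_in scaleN1r. Qed.

(** Take the [sigma]-odd part of [wedge u v0]: the even part is in h and kills v0. *)
Lemma q_lift u : dot u v0 = 0 -> exists2 X, X \in q_space D & X *m v0 = u.
Proof.
move=> uv; pose Z := wedge u v0.
have hZ : Z \in g by exact: wedge_so.
have Zv : Z *m v0 = u by rewrite wedgeE dot_v0 uv scale1r scale0r subr0.
exists (2^-1 *: (Z - sg Z)).
  rewrite q_spaceE; apply/andP; split; first by rewrite memvZ // memvB // sigma_so.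
  by apply/eqP; rewrite linearZ_LR /= linearB /= sigmaK // -scalerN opprB.
have /eqP : (Z + sg Z) *m v0 == 0.
  rewrite -sigma_fixE; last by rewrite memvD // sigma_so.
  by apply/eqP; rewrite linearD /= sigmaK // addrC.
rewrite mulmxDl => /eqP; rewrite addr_eq0 Zv => /eqP e.
rewrite -scalemxAl mulmxBl Zv; apply/matrixP => i j; move/matrixP/(_ i j): e.
by rewrite !mxE => ->; field.
Qed.

Lemma q_comm X Y : X \in q_space D -> Y \in q_space D ->
  X *m (Y *m v0) = Y *m (X *m v0).
Proof.
rewrite !q_spaceE => /andP[hX /eqP sX] /andP[hY /eqP sY].
have : bracket X Y *m v0 == 0.
  rewrite -sigma_fixE ?bracket_so // sigma_bracket // sX sY.
  by rewrite /bracket !mulNmx !mulmxN !opprK.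
by rewrite bracketE subr_eq0 => /eqP.
Qed.

(* The trilinear form <X Y v0, Z v0> on q is symmetric in X, Y because [q, q]
   kills v0, and antisymmetric in Y, Z; such a form vanishes. *)
Lemma q_braid X Y Z : X \in q_space D -> Y \in q_space D -> Z \in q_space D ->
  dot (X *m (Y *m v0)) (Z *m v0) = 0.
Proof.
move=> qX qY qZ; pose T (A B C : M) := dot (A *m (B *m v0)) (C *m v0).
have sym (A B C : M) : A \in q_space D -> B \in q_space D -> T A B C = T B A C.
  by move=> qA qB; rewrite /T q_comm.
have anti (A B C : M) : A \in q_space D -> T A B C = - T A C B.
  rewrite q_spaceE => /andP[hA _].
  by rewrite /T (so_dot _ _ hA) dotC.
have h : T X Y Z = - T X Y Z.
  rewrite {1}(sym X Y Z) // {1}(anti Y X Z) // {1}(sym Y Z X) // {1}(anti Z Y X) //.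
  by rewrite {1}(sym Z X Y) // {1}(anti X Z Y) // !opprK.
by rewrite -/(T X Y Z); lra.
Qed.

(** By [q_braid], X sends the complement of v0 into the line of v0, and skewness fixes the
    multiples. This determines [sigma], so far known only through h. *)
Lemma q_wedge X : X \in q_space D -> X = wedge (X *m v0) v0.
Proof.
move=> qX; have hX : X \in g by move: qX; rewrite q_spaceE => /andP[].
apply: eqmx_vec => w; apply/eqP; rewrite -subr_eq0; apply/eqP; apply: dot_eq0 => x.
have dec y : exists2 y', y = dot y v0 *: v0 + y' & exists2 Y, Y \in q_space D & Y *m v0 = y'.
  exists (y - dot y v0 *: v0); first by rewrite addrC subrK.
  by apply: q_lift; rewrite !dotE dot_v0; ring.
have [w' ew [Y qY Yw]] := dec w; have [x' ex [Z qZ Zx]] := dec x.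
have hY : Y \in g by move: qY; rewrite q_spaceE => /andP[].
have hZ : Z \in g by move: qZ; rewrite q_spaceE => /andP[].
have xv : dot x' v0 = 0 by rewrite -Zx dotC so_dot_self.
have wv : dot w' v0 = 0 by rewrite -Yw dotC so_dot_self.
have T0 : dot x' (X *m w') = 0 by rewrite -Yw -Zx dotC q_braid.
have Xvv : dot v0 (X *m v0) = 0 by exact: so_dot_self.
move: (dot w v0) (dot x v0) ew ex => p r -> ->.
rewrite wedgeE !mulmxDr -!scalemxAr !dotE dot_v0 (dotC v0 w') wv xv T0 Xvv.
have -> : dot v0 (X *m w') = - dot (X *m v0) w' by rewrite (so_dot _ _ hX) opprK.
by rewrite (dotC (X *m v0) v0) Xvv; ring.
Qed.

Lemma wedge_q u : dot u v0 = 0 -> wedge u v0 \in q_space D.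
Proof. by move/q_lift => [X qX <-]; rewrite -q_wedge. Qed.

Lemma sigma_wedge_q u : dot u v0 = 0 -> sg (wedge u v0) = - wedge u v0.
Proof. by move/wedge_q; rewrite q_spaceE => /andP[_ /eqP]. Qed.

Lemma sigma_wedge_h a b : dot a v0 = 0 -> dot b v0 = 0 -> sg (wedge a b) = wedge a b.
Proof.
move=> ha hb; apply/eqP; rewrite sigma_fixE ?wedge_so // wedgeE ha hb.
by rewrite !scale0r subr0.
Qed.

Lemma theta_J X : X \in a_space D -> X \in g /\ th X = - X.
Proof.
have [ap _ _] := a_maximal hD.
by move=> /(subvP ap); rewrite mem_eigen_in scaleN1r => /andP[-> /eqP ->].
Qed.

Lemma J1_a : J1 D \in a_space D.
Proof. by apply: memv_span; rewrite mem_head. Qed.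

Lemma J2_a : J2 D \in a_space D.
Proof. by apply: memv_span; rewrite !inE eqxx orbT. Qed.

Lemma J1_so : J1 D \in g. Proof. by case: (theta_J J1_a). Qed.
Lemma J2_so : J2 D \in g. Proof. by case: (theta_J J2_a). Qed.
Lemma theta_J1 : th (J1 D) = - J1 D. Proof. by case: (theta_J J1_a). Qed.
Lemma theta_J2 : th (J2 D) = - J2 D. Proof. by case: (theta_J J2_a). Qed.

Lemma J1_J2 : J1 D *m J2 D = J2 D *m J1 D.
Proof.
have [_ ab _] := a_maximal hD.
by have /eqP := ab _ _ J1_a J2_a; rewrite subr_eq0 => /eqP.
Qed.

Lemma J1_v0 : J1 D *m v0 = 0.
Proof. by have := J1_h hD; rewrite mem_so_stab => /andP[_ /eqP]. Qed.

Lemma J2_neq0 : J2 D != 0.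
Proof. by have := free_not0 (v := J2 D) (a_free hD); apply; rewrite !inE eqxx orbT. Qed.

Lemma theta_root p r X : X \in root_space D p r -> th X \in root_space D (- p) (- r).
Proof.
rewrite !mem_root_space => /and3P[hX /eqP h1 /eqP h2].
rewrite theta_so //=; apply/andP; split; apply/eqP.
  rewrite -[J1 D]opprK -theta_J1 /bracket mulNmx mulmxN -opprD -/(bracket _ _).
  by rewrite -theta_bracket ?J1_so // h1 linearZ scaleNr.
rewrite -[J2 D]opprK -theta_J2 /bracket mulNmx mulmxN -opprD -/(bracket _ _).
by rewrite -theta_bracket ?J2_so // h2 linearZ scaleNr.
Qed.

Let b := J2 D *m v0.

Lemma b_v0 : dot b v0 = 0.
Proof. by rewrite dotC so_dot_self ?J2_so. Qed.

Lemma J2_wedge : J2 D = wedge b v0.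
Proof. exact: q_wedge (J2_q hD). Qed.

(** Positivity of the Cartan form at J2, where the trace of J2^2 is -2 <b, b>. *)
Lemma dot_b_lt0 : dot b b < 0.
Proof.
have [_ pos] := theta_cartan hD; have := pos _ J2_so J2_neq0.
rewrite theta_J2 killingE ?memvN ?J2_so // mulmxN raddfN mulrN opprK.
rewrite /= J2_wedge wedge_tr (dotC v0 b) b_v0 dot_v0.
have l1 : 0 < l%:R - 1 :> R by rewrite subr_gt0 ltr1n; lia.
by rewrite mulr0 sub0r mulr1 pmulr_rgt0 //; lra.
Qed.

Lemma Xpp_neq0 : Xpp D != 0.
Proof.
apply/eqP => X0; have := Xpp_norm hD; rewrite X0 linear0.
move=> /esym/eqP; rewrite scaler_eq0 pnatr_eq0 /= addr_eq0 => /eqP e.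
have := a_free hD; rewrite free_cons span_seq1 e => /andP[+ _].
by rewrite memvN memv_line.
Qed.

Lemma Xpp_brackets : [/\ Xpp D \in g, bracket (J1 D) (Xpp D) = Xpp D & bracket (J2 D) (Xpp D) = Xpp D].
Proof.
have := Xpp_root hD; rewrite mem_root_space !scale1r.
by case/and3P => h1 /eqP h2 /eqP h3.
Qed.

Lemma J2E x : J2 D *m x = dot v0 x *: b - dot b x *: v0.
Proof. by rewrite {1}J2_wedge wedgeE. Qed.

(* Otherwise the equation [J2, X] = X would force X = 0. *)
Lemma dot_b : dot b b = -1.
Proof.
have [hX _ h2] := Xpp_brackets; set X := Xpp D in hX h2.
have b0 : dot b b != 0 by rewrite lt_eqF // dot_b_lt0.
have bv := b_v0.
apply/eqP; apply: contraT => /eqP b1.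
have J2X x : J2 D *m (X *m x) = X *m (J2 D *m x) + X *m x.
  by rewrite -{3}h2 bracketE addrC subrK.
have J2v : J2 D *m v0 = b by [].
clearbody b.
have Xw w : dot w v0 = 0 -> dot w b = 0 -> X *m w = 0.
  move=> wv wb.
  have e : J2 D *m (X *m w) = X *m w.
    by rewrite J2X J2E (dotC v0) (dotC b) wv wb !scale0r subr0 mulmx0 add0r.
  have e1 : dot v0 (X *m w) = - dot b (X *m w).
    by rewrite -{1}e J2E !dotE dot_v0 (dotC v0 b) bv; ring.
  have e2 : dot b (X *m w) = dot v0 (X *m w) * dot b b.
    by rewrite -{1}e J2E !dotE bv; ring.
  (* The equations [e1] and [e2] combine to <b, X w> (1 + <b, b>) = 0; here <b, b> <> -1 enters. *)
  have e3 : dot b (X *m w) = 0.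
    have : dot b (X *m w) * (1 + dot b b) = 0 by rewrite mulrDr mulr1 {1}e2 e1; ring.
    by move/eqP; rewrite mulf_eq0 => /orP[/eqP //|/eqP h]; exfalso; apply: b1; lra.
  by rewrite -e J2E e1 e3 oppr0 !scale0r subr0.
have dec x : exists2 w, x = dot v0 x *: v0 + (dot b x / dot b b) *: b + w &
    dot w v0 = 0 /\ dot w b = 0.
  exists (x - dot v0 x *: v0 - (dot b x / dot b b) *: b).
    by apply/matrixP => i j; rewrite !mxE; ring.
  rewrite !dotE dot_v0 bv (dotC v0 b) bv (dotC x v0) (dotC x b).
  by split; field.
have ev : J2 D *m (X *m v0) = - dot b (X *m v0) *: v0.
  by rewrite J2E so_dot_self // scale0r sub0r scaleNr.
have eb : X *m b = - dot b (X *m v0) *: v0 - X *m v0 by rewrite -ev J2X J2v addrK.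
have bX : dot b (X *m v0) = 0.
  by have := so_dot_self b hX; rewrite eb !dotE (dotC b v0) (dotC v0 b) bv; lra.
have Xv : X *m v0 = 0.
  apply: dot_eq0 => x; have [w ex [wv wb]] := dec x.
  rewrite ex !dotE bX so_dot_self // -[dot w _]opprK -(so_dot _ _ hX) Xw // dot0l.
  by ring.
have Xb : X *m b = 0 by rewrite eb bX Xv oppr0 scale0r subr0.
have X0 : X = 0.
  apply: eqmx_vec => x; have [w ex [wv wb]] := dec x.
  by rewrite mul0mx ex !mulmxDr -!scalemxAr Xv Xb Xw // !scaler0 !addr0.
by have := Xpp_neq0; rewrite -/X X0 eqxx.
Qed.

Let fp := v0 + b.
Let fm := v0 - b.

Lemma fpfp : dot fp fp = 0.
Proof. by rewrite !dotE dot_v0 dot_b b_v0 (dotC v0 b) b_v0; ring. Qed.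

Lemma fmfm : dot fm fm = 0.
Proof. by rewrite !dotE dot_v0 dot_b b_v0 (dotC v0 b) b_v0; ring. Qed.

Lemma fpfm : dot fp fm = 2.
Proof. by rewrite !dotE dot_v0 dot_b b_v0 (dotC v0 b) b_v0; ring. Qed.

Lemma J2_fpfm : J2 D = 2^-1 *: wedge fp fm.
Proof.
rewrite J2_wedge; apply: eqmx_vec => x; rewrite -scalemxAl !wedgeE !dotE.
by apply/matrixP => i j; rewrite !mxE; field.
Qed.

Lemma J2_root p X : X \in root_space D p 1 ->
  [/\ X = wedge fp (- 2^-1 *: (X *m fm)), dot (X *m fm) fp = 0 & dot (X *m fm) fm = 0].
Proof.
rewrite mem_root_space scale1r => /and3P[hX _ /eqP h].
by apply: root_vector fpfp fmfm fpfm hX _; rewrite -J2_fpfm.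
Qed.

Lemma J2_rootN p X : X \in root_space D p (-1) ->
  [/\ X = wedge fm (- 2^-1 *: (X *m fp)), dot (X *m fp) fp = 0 & dot (X *m fp) fm = 0].
Proof.
rewrite mem_root_space scaleN1r => /and3P[hX _ /eqP h].
have [||e1 e2 e3] := root_vector fmfm fpfp _ hX.
- by rewrite dotC fpfm.
- rewrite wedgeC scalerN -J2_fpfm /bracket mulNmx mulmxN -opprD -/(bracket _ _) h.
  by rewrite opprK.
by split.
Qed.

Lemma perp_v0 x : dot x fp = 0 -> dot x fm = 0 -> dot x v0 = 0 /\ dot x b = 0.
Proof. by rewrite !dotE => h1 h2; split; lra. Qed.

Lemma J1_b : J1 D *m b = 0.
Proof. by rewrite /b mulmxA J1_J2 -mulmxA J1_v0 mulmx0. Qed.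

Lemma J1_root p X f : X \in g -> bracket (J1 D) X = p *: X -> J1 D *m f = 0 ->
  J1 D *m (X *m f) = p *: (X *m f).
Proof.
move=> hX h hf; have := bracketE (J1 D) X f.
by rewrite h hf mulmx0 subr0 -scalemxAl.
Qed.

End Frame.

(** * The null eigenvectors of J1 and the vectors attached to X0p *)

Section Frame2.
Variables (R : realType) (l : nat) (D : ads_data R l).
Hypotheses (hl : (3 <= l)%N) (hD : ads_axioms D).
Local Notation M := 'M[R]_l.+1.
Local Notation V := 'cV[R]_l.+1.
Local Notation g := (so R l).
Local Notation v0 := (base_vec D).
Local Notation sg := (sigma D).
Local Notation th := (theta D).
Local Notation b := (J2 D *m v0).
Local Notation fp := (v0 + b).
Local Notation fm := (v0 - b).
Implicit Types (u v w x y a c d f : V) (X Y Z : M).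

(** By [root_vector], [Xpp D] is [wedge fp e_plus] and its image under [theta] is
    [wedge fm e_minus]. *)
Definition e_plus : V := locked_with ads_key (- 2^-1 *: (Xpp D *m fm)).
Definition e_minus : V := locked_with ads_key (- 2^-1 *: (th (Xpp D) *m fp)).
Lemma e_plusE : e_plus = - 2^-1 *: (Xpp D *m fm).
Proof. exact: locked_withE. Qed.

Lemma e_minusE : e_minus = - 2^-1 *: (th (Xpp D) *m fp).
Proof. exact: locked_withE. Qed.

Local Notation e := e_plus.
Local Notation e' := e_minus.

Let v00 := dot_v0 hD.
Let bb := dot_b hl hD.
Let bv0 := b_v0 hD.

Lemma J1_fp : J1 D *m fp = 0.
Proof. by rewrite mulmxDr (J1_v0 hD) (J1_b hD) addr0. Qed.

Lemma J1_fm : J1 D *m fm = 0.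
Proof. by rewrite mulmxBr (J1_v0 hD) (J1_b hD) subr0. Qed.

Lemma Xpp_wedge : [/\ Xpp D = wedge fp e, dot e v0 = 0, dot e b = 0 & J1 D *m e = e].
Proof.
have [hX h1 h2] := Xpp_brackets hD.
have [h3 h4 h5] := J2_root hl hD (Xpp_root hD).
have [h6 h7] := perp_v0 h4 h5.
rewrite e_plusE; split=> //; rewrite ?dotZl ?h6 ?h7 ?mulr0 //.
rewrite -scalemxAr (@J1_root _ _ D 1) ?J1_fm // ?scale1r //.
Qed.

Lemma thXpp_wedge : [/\ th (Xpp D) = wedge fm e', dot e' v0 = 0, dot e' b = 0 & J1 D *m e' = - e'].
Proof.
have hr := theta_root hD (Xpp_root hD).
have [h3 h4 h5] := J2_rootN hl hD hr.
have [h6 h7] := perp_v0 h4 h5.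
rewrite e_minusE; split=> //; rewrite ?dotZl ?h6 ?h7 ?mulr0 //.
move: hr; rewrite mem_root_space => /and3P[hX /eqP hJ _].
rewrite -scalemxAr (J1_root hX hJ J1_fp).
by rewrite scaleN1r scalerN.
Qed.

Lemma dot_e_plus : dot e e = 0.
Proof.
have [_ _ _ h] := Xpp_wedge.
by rewrite -{1}h dotC so_dot_self // (J1_so hD).
Qed.

Lemma dot_e_minus : dot e' e' = 0.
Proof.
have [_ _ _ h] := thXpp_wedge.
by rewrite -{1}[e']opprK -h dotNl dotC so_dot_self ?oppr0 // (J1_so hD).
Qed.

Lemma bracket_wedge_f y z : dot y v0 = 0 -> dot y b = 0 -> dot z v0 = 0 -> dot z b = 0 ->
  bracket (wedge fm z) (wedge fp y) = - 2 *: wedge z y + (2 * dot z y) *: J2 D.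
Proof.
move=> y0 y1 z0 z1; rewrite bracket_wedge ?wedge_so // !wedgeE.
have -> : dot z fp = 0 by rewrite dotDr z0 z1 addr0.
have -> : dot fm fp = 2 by rewrite dotC (fpfm hl hD).
have -> : dot fm y = 0 by rewrite dotC dotDr dotNr y0 y1 subr0.
rewrite [X in _ = _ + _ *: X](J2_fpfm hD) !scale0r sub0r subr0 -scaleNr wedgeZl wedgeZr.
move: (wedge z y) (wedge fp fm) (dot z y) => P Q r.
by apply/matrixP => i j; rewrite !mxE; field.
Qed.

(** The bracket of theta Xpp and Xpp is -2 ([wedge e' e]) + 2 <e', e> J2, and the normalization
    makes it 4 (J1 + J2). J1 kills v0, so evaluation at v0 gives <e, e'> = 2; what remains of the
    equation is J1. *)
Lemma J1_wedge : J1 D = 2^-1 *: wedge e e' /\ dot e e' = 2.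
Proof.
have [hX e0 e1 _] := Xpp_wedge; have [hY e0' e1' _] := thXpp_wedge.
have := Xpp_norm hD; rewrite {1}hY {1}hX bracket_wedge_f // => h.
have ee : dot e e' = 2.
  have /(congr1 (fun Z : M => dot (Z *m v0) b)) := h.
  rewrite !mulmxDl -!scalemxAl mulmxDl (J1_v0 hD) wedgeE e0 e0' !dotE bb.
  by move=> k; rewrite dotC; lra.
split=> //; move: h; rewrite (dotC e' e) ee => /matrixP h.
by apply/matrixP => i j; have := h i j; rewrite (wedgeC e' e) !mxE; lra.
Qed.

(** [sigma] fixes [wedge b y] and negates [wedge v0 y], so the factor v0 + b becomes b - v0. *)
Lemma sigma_f y : dot y v0 = 0 -> dot y b = 0 -> sg (wedge fp y) = - wedge fm y.
Proof.
move=> y0 y1; rewrite wedgeDl linearD /= (sigma_wedge_h hD bv0 y0).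
rewrite (wedgeC v0 y) linearN /= (sigma_wedge_q hD) // wedgeDl.
rewrite (wedgeC v0 y) -[- b]scaleN1r wedgeZl.
by apply/matrixP => i j; rewrite !mxE; ring.
Qed.

Lemma sigma_f' y : dot y v0 = 0 -> dot y b = 0 -> sg (wedge fm y) = - wedge fp y.
Proof.
move=> y0 y1; rewrite -[wedge fm y]opprK -sigma_f // linearN /= sigmaK //.
exact: wedge_so.
Qed.

(** The formula for q0 evaluates to half of [wedge v0 (e + e')]; the factor -1/2 makes this
    [wedge tau v0]. *)
Definition tau : V := locked_with ads_key (- 2^-1 *: (e + e')).

Lemma tauE : tau = - 2^-1 *: (e + e').
Proof. exact: locked_withE. Qed.

Lemma q0_wedge : q D 0 = wedge tau v0.
Proof.
have [hX e0 e1 _] := Xpp_wedge; have [hY e0' e1' _] := thXpp_wedge.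
rewrite /q /q0 hY hX !(sigma_f, sigma_f') //.
rewrite tauE wedgeZl !wedgeDl.
rewrite (wedgeC e) (wedgeC e') -[- b]scaleN1r !wedgeZl.
by apply/matrixP => i j; rewrite !mxE; field.
Qed.

Lemma tau_v0 : dot tau v0 = 0.
Proof.
have [_ e0 e1 _] := Xpp_wedge; have [_ e0' e1' _] := thXpp_wedge.
by rewrite tauE !dotE e0 e0'; ring.
Qed.

Lemma tau_b : dot tau b = 0.
Proof.
have [_ e0 e1 _] := Xpp_wedge; have [_ e0' e1' _] := thXpp_wedge.
by rewrite tauE !dotE e1 e1'; ring.
Qed.

Lemma dot_tau : dot tau tau = 1.
Proof.
have [_ ee] := J1_wedge.
by rewrite tauE !dotE (dotC e' e) ee dot_e_plus dot_e_minus; field.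
Qed.

Lemma wedge_v0 u : dot u v0 = 0 -> wedge u v0 *m v0 = u.
Proof. by move=> h; rewrite wedgeE v00 h scale1r scale0r subr0. Qed.

Lemma q0_v0 : q D 0 *m v0 = tau.
Proof. by rewrite q0_wedge wedge_v0 // tau_v0. Qed.

Definition xi : V := J1 D *m tau.

Lemma xiE : xi = - 2^-1 *: (e - e').
Proof.
have [_ _ _ h] := Xpp_wedge; have [_ _ _ h'] := thXpp_wedge.
by rewrite /xi tauE -scalemxAr mulmxDr h h'.
Qed.

Lemma q2_v0 : q D 2 *m v0 = - xi.
Proof. by rewrite /= mulNmx bracketE -/(q D 0) q0_v0 (J1_v0 hD) mulmx0 subr0. Qed.

Lemma q2_q : q D 2 \in q_space D.
Proof.
have hq0 : q0 D \in q_space D by rewrite -/(q D 0) q0_wedge wedge_q // tau_v0.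
move: hq0; rewrite !q_spaceE => /andP[h0 /eqP s0].
have hJ := J1_so hD; have hb := bracket_so hJ h0.
rewrite /= memvN hb; apply/eqP; rewrite linearN /= sigma_bracket //.
have /eqP -> : sg (J1 D) == J1 D by rewrite (sigma_fixE hD) // (J1_v0 hD) eqxx.
by rewrite s0 /bracket mulmxN mulNmx !opprD.
Qed.

Definition X0p_vec k : V := locked_with ads_key (- 2^-1 *: (X0p D k *m fm)).

Lemma X0p_vecE k : X0p_vec k = - 2^-1 *: (X0p D k *m fm).
Proof. exact: locked_withE. Qed.

(** Root considerations give X = [wedge fp y] and theta X = [wedge fm z]. The normalization yields
    <z, y> = 1 and z parallel to y, so z = c y with c = 1/<y, y> < 0. As [theta] is an involution
    commuting with [sigma], c = 1/c, hence c = -1. *)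
Lemma X0p_wedge k : (3 <= k < l)%N -> [/\ X0p D k = wedge fp (X0p_vec k),
  th (X0p D k) = - wedge fm (X0p_vec k), dot (X0p_vec k) v0 = 0 & dot (X0p_vec k) b = 0] /\
  [/\ dot (X0p_vec k) e = 0, dot (X0p_vec k) e' = 0 & dot (X0p_vec k) (X0p_vec k) = -1].
Proof.
move=> hk; set y := X0p_vec k.
have hX : X0p D k \in root_space D 0 1.
  rewrite -(span_basis (X0p_basis hD)); apply: memv_span.
  by apply/mapP; exists k => //; rewrite mem_index_iota.
have [hy y0 y1] := J2_root hl hD hX;
have hy' : y = - 2^-1 *: (X0p D k *m fm) by exact: X0p_vecE.
rewrite -hy' in hy.
have [{}y0 {}y1] : dot y v0 = 0 /\ dot y b = 0.
  by have [h6 h7] := perp_v0 y0 y1; rewrite hy' !dotZl h6 h7 mulr0.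
have hY := theta_root hD hX.
have [hz z0 z1] := J2_rootN hl hD hY; set z := - 2^-1 *: _ in hz.
have [{}z0 {}z1] : dot z v0 = 0 /\ dot z b = 0.
  by have [h6 h7] := perp_v0 z0 z1; rewrite /z !dotZl h6 h7 mulr0.
clearbody z.
have Jy : J1 D *m y = 0.
  move: hX; rewrite mem_root_space => /and3P[h1 /eqP h2 _].
  by rewrite hy' -scalemxAr (J1_root h1 h2 J1_fm) scale0r scaler0.
have [J1w ee] := J1_wedge.
have eJ : dot e' y *: e - dot e y *: e' = 0.
  have := Jy; rewrite {1}J1w -scalemxAl wedgeE => /eqP; rewrite scaler_eq0 invr_eq0.
  by rewrite pnatr_eq0 /= => /eqP.
have ye' : dot y e' = 0.
  have := congr1 (dot e') eJ; rewrite !dotE dot_e_minus (dotC e' e) ee (dotC y e'); lra.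
have ye : dot y e = 0.
  have := congr1 (dot e) eJ; rewrite !dotE dot_e_plus ee (dotC y e); lra.
have hn := X0p_norm hD hk; rewrite {1}hz {1}hy bracket_wedge_f // in hn.
have zy : dot z y = 1.
  have := congr1 (fun Z : M => dot (Z *m v0) b) hn.
  rewrite mulmxDl -!scalemxAl wedgeE y0 z0 !dotE bb; lra.
have wzy : wedge z y = 0.
  move: hn; rewrite zy mulr1 => /eqP; rewrite -[X in _ == X]add0r (inj_eq (addIr _)) scaler_eq0 oppr_eq0.
  by rewrite pnatr_eq0 /= => /eqP.
have ny : y != 0 by apply/eqP => y00; move: zy; rewrite y00 dot0r; lra.
have yneg : dot y y < 0.
  apply: (neg_definite (u := v0) (v := tau)) => //; first by lia.
  - exact: dot_tau.
  - by rewrite dotC tau_v0.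
  - by rewrite tauE dotZr dotDr ye ye' addr0 mulr0.
have ez : dot y y *: z = y.
  by have := congr1 (fun Z : M => Z *m y) wzy; rewrite mul0mx wedgeE zy scale1r => /eqP; rewrite subr_eq0 => /eqP.
pose c := (dot y y)^-1.
have c0 : c != 0 by rewrite invr_eq0 lt_eqF.
have zc : z = c *: y by rewrite -ez scalerA mulVf ?lt_eqF // scale1r.
have thX : th (X0p D k) = c *: wedge fm y by rewrite hz zc wedgeZr.
have hXg : X0p D k \in g by move: hX; rewrite mem_root_space => /and3P[].
have cc : c ^+ 2 = 1.
  have h1 : th (sg (X0p D k)) = - (c^-1 *: X0p D k).
    rewrite hy sigma_f // linearN /= -hy; congr (- _).
    rewrite -[in RHS](thetaK hD hXg) thX linearZ_LR /= scalerA mulVf // scale1r //.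
  have h2 : sg (th (X0p D k)) = - (c *: X0p D k).
    by rewrite thX linearZ_LR /= sigma_f' // hy scalerN.
  have := theta_sigma hD hXg; rewrite h1 h2 => /eqP; rewrite eqr_opp -subr_eq0 -scalerBl.
  rewrite scaler_eq0 => /orP[/eqP h|/eqP h]; last first.
    by move: ny; rewrite hy' h mul0mx scaler0 eqxx.
  have : c * (c^-1 - c) = 0 by rewrite h mulr0.
  by rewrite mulrBr divff // expr2; lra.
have c1 : c = -1.
  have : c < 0 by rewrite invr_lt0.
  by nra.
have yy : dot y y = -1 by rewrite -[LHS]invrK -/c c1 invrN1.
split; split=> //.
by rewrite thX c1 scaleN1r.
Qed.

End Frame2.

(** * The orthonormal frame and the light-like directions *)

Section Directions.
Variables (R : realType) (l : nat) (D : ads_data R l).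
Hypotheses (hl : (3 <= l)%N) (hD : ads_axioms D).
Local Notation M := 'M[R]_l.+1.
Local Notation V := 'cV[R]_l.+1.
Local Notation g := (so R l).
Local Notation v0 := (base_vec D).
Local Notation b := (J2 D *m v0).
Local Notation tau := (tau D).
Local Notation xi := (xi D).
Local Notation X0p_vec := (X0p_vec D).
Implicit Types (u v w x y z a c d f : V) (X Y Z : M).

Let v00 := dot_v0 hD.
Let bb := dot_b hl hD.
Let bv0 := b_v0 hD.

(** The Killing form of [wedge fp y_j] and [- wedge fm y_k] is 4 (l - 1) <y_j, y_k>. *)
Lemma X0p_vec_orth j k : (3 <= j < l)%N -> (3 <= k < l)%N -> j <> k -> dot (X0p_vec j) (X0p_vec k) = 0.
Proof.
move=> hj hk jk; have := X0p_orth hD hj hk jk.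
have [[Xj _ j0 j1] _] := X0p_wedge hl hD hj; have [[_ Yk k0 k1] _] := X0p_wedge hl hD hk.
rewrite Yk Xj killingE ?memvN ?wedge_so // mulmxN raddfN /= wedge_tr (fpfm hl hD).
rewrite [dot _ (_ - _)]dotDr dotNr j0 j1 [dot (_ + _) _]dotC dotDr k0 k1.
have l1 : l%:R - 1 != 0 :> R.
  by rewrite subr_eq0 -[1](mulr1n 1) eqr_nat; apply/eqP; lia.
move/eqP; rewrite mulf_eq0 (negPf l1) /= => /eqP; lra.
Qed.

Lemma xi_dots : [/\ dot xi xi = -1, dot xi tau = 0, dot xi v0 = 0 & dot xi b = 0].
Proof.
have [_ e0 e1 _] := Xpp_wedge hl hD; have [_ e0' e1' _] := thXpp_wedge hl hD.
have [_ ee] := J1_wedge hl hD; have hee := dot_e_plus hl hD; have hee' := dot_e_minus hl hD.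
rewrite (xiE hl hD) tauE !dotE (dotC (e_minus D) (e_plus D)) ee hee hee' e0 e1 e0' e1'.
by split; field.
Qed.

Lemma q_wedge_lt k : (k < l)%N -> q D k = wedge (q D k *m v0) v0.
Proof.
case: k => [|[|[|k]]] hk.
- by rewrite (q0_v0 hl hD) (q0_wedge hl hD).
- exact: J2_wedge.
- exact: (q_wedge hD (q2_q hl hD)).
have [|[hX hY y0 y1] _] := X0p_wedge hl hD (k := k.+3); first exact: hk.
apply: (q_wedge hD).
suff -> : q D k.+3 = wedge (- X0p_vec k.+3) v0.
  by apply: (wedge_q hD); rewrite dotNl y0 oppr0.
rewrite /q hY hX -[- X0p_vec _]scaleN1r wedgeZl (wedgeC (X0p_vec _)).
rewrite -[- b]scaleN1r !wedgeDl wedgeZl.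
by apply/matrixP => i j; rewrite !mxE; field.
Qed.

Lemma qS_v0 k : (3 <= k < l)%N -> q D k *m v0 = - X0p_vec k.
Proof.
move=> hk; have [[hX hY y0 y1] _] := X0p_wedge hl hD hk.
case: k hk hX hY y0 y1 => [|[|[|k]]] // hk hX hY y0 y1.
rewrite /q -scalemxAl mulmxBl hY hX mulNmx !wedgeE y0 !scale0r !sub0r.
rewrite !dotDl dotNl v00 bv0.
by apply/matrixP => i j; rewrite !mxE; field.
Qed.

Lemma qv_dot i j : (i < l)%N -> (j < l)%N -> dot (q D i *m v0) (q D j *m v0) =
  if i == j then (if i == 0%N then 1 else -1) else 0.
Proof.
have [xx xt xv xb] := xi_dots.
have tb := tau_b hl hD.
have yy k : (3 <= k < l)%N -> [/\ dot (X0p_vec k) b = 0, dot (X0p_vec k) tau = 0, dot (X0p_vec k) xi = 0 &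
    dot (X0p_vec k) (X0p_vec k) = -1].
  move=> hk; have [[_ _ y0 y1] [y2 y3 y4]] := X0p_wedge hl hD hk.
  by rewrite (xiE hl hD) tauE !dotE y2 y3 y1 y4; split=> //; ring.
wlog ij : i j / (i <= j)%N.
  move=> H; have [|/ltnW] := leqP i j; first exact: H.
  move=> ji hi hj; rewrite dotC (H _ _ ji) // [j == i]eq_sym.
  by case: eqP => // ->.
move=> hi hj.
have [j3|j3] := ltnP 2 j.
  have hj3 : (3 <= j < l)%N by rewrite j3.
  have [y1 y2 y3 y4] := yy j hj3.
  rewrite (qS_v0 hj3) dotNr.
  have [i3|i3] := ltnP 2 i.
    have hi3 : (3 <= i < l)%N by rewrite i3.
    rewrite (qS_v0 hi3) dotNl opprK.
    case: eqP => [->|ne]; last exact: X0p_vec_orth.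
    by rewrite y4; case: (j) j3.
  have -> : (i == j) = false by apply/eqP; lia.
  case: i hi i3 {ij} => [|[|[|//]]] _ _.
  - by rewrite (q0_v0 hl hD) dotC y2 oppr0.
  - by rewrite dotC y1 oppr0.
  - by rewrite (q2_v0 hl hD) dotNl dotC y3 opprK.
case: j hj j3 ij => [|[|[|//]]] _ _; case: i hi => [|[|[|//]]] // _ _.
- by rewrite (q0_v0 hl hD) dot_tau.
- by rewrite (q0_v0 hl hD) tb.
- by rewrite (q0_v0 hl hD) (q2_v0 hl hD) dotNr dotC xt oppr0.
- by rewrite (q2_v0 hl hD) dotNr dotC xb oppr0.
- by rewrite (q2_v0 hl hD) dotNr dotNl opprK xx.
Qed.

(** Putting v0 in front of tau = q_0 v0 places the two positive vectors first, as in [eta]; the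
    frame matrix is then an isometry, hence invertible. *)
Definition frame_col (i : nat) : V := if i is k.+1 then q D k *m v0 else v0.

Lemma frame_col_dot i j : (i < l.+1)%N -> (j < l.+1)%N -> dot (frame_col i) (frame_col j) =
  if i == j then (if (i < 2)%N then 1 else -1) else 0.
Proof.
have qv k : (k < l)%N -> dot (q D k *m v0) v0 = 0.
  move=> hk; rewrite dotC; apply: so_dot_self.
  by rewrite (q_wedge_lt hk) wedge_so.
case: i j => [|i] [|j] //= hi hj.
- by rewrite dotC qv.
- exact: qv.
- rewrite qv_dot // eqSS; case: eqP => // _.
  by case: i {hi}.
Qed.

Definition frame_mx : M := \matrix_(i, j) frame_col j i 0.

Lemma frame_mx_dot x j : (frame_mx^T *m (Defs.eta R l *m x)) j 0 = dot (frame_col j) x.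
Proof.
rewrite /dot -mulmxA !mxE; apply: eq_bigr => i _.
by congr (_ * _); rewrite !mxE.
Qed.

Lemma frame_mx_isometry : eta_isometry frame_mx.
Proof.
rewrite /eta_isometry -mulmxA; apply/matrixP => i j.
have -> : (frame_mx^T *m (Defs.eta R l *m frame_mx)) i j = dot (frame_col i) (frame_col j).
  rewrite -frame_mx_dot !mxE; apply: eq_bigr => k _; congr (_ * _).
  by rewrite !mxE; apply: eq_bigr => m _; congr (_ * _); rewrite !mxE.
rewrite frame_col_dot // /Defs.eta !mxE (inj_eq val_inj).
by case: eqP => [->|_]; rewrite ?mulr1n ?mulr0n.
Qed.

Lemma frame_complete x : (forall j, (j < l.+1)%N -> dot (frame_col j) x = 0) -> x = 0.
Proof.
move=> h; have e0 : frame_mx^T *m (Defs.eta R l *m x) = 0.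
  by apply/matrixP => i j; rewrite ord1 frame_mx_dot h // mxE.
have u := isometry_unit frame_mx_isometry.
have : Defs.eta R l *m x = 0.
  have ut : frame_mx^T \in unitmx by rewrite unitmx_tr.
  by rewrite -[LHS](mulKmx ut) e0 mulmx0.
move=> h2; by rewrite -[x]mul1mx -eta_eta -mulmxA h2 mulmx0.
Qed.

Lemma direction_v0 (w : 'rV[R]_l.-1) :
  direction D w *m v0 = tau + \sum_(i < l.-1) w 0 i *: (q D i.+1 *m v0).
Proof.
rewrite /direction mulmxDl (q0_v0 hl hD) mulmx_suml; congr (_ + _).
by apply: eq_bigr => i _; rewrite scalemxAl.
Qed.

Let ltS (i : 'I_l.-1) : (i.+1 < l)%N.
Proof. by have := ltn_ord i; lia. Qed.

Lemma direction_wedge (w : 'rV[R]_l.-1) :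
  direction D w = wedge (direction D w *m v0) v0.
Proof.
have wsum (F : 'I_l.-1 -> V) : wedge (\sum_i F i) v0 = \sum_i wedge (F i) v0.
  elim/big_rec2: _ => [|i X y _ <-]; last by rewrite wedgeDl.
  by rewrite -(scale0r (0 : V)) wedgeZl scale0r.
rewrite direction_v0 wedgeDl wsum -(q0_wedge hl hD); congr (_ + _).
by apply: eq_bigr => i _; rewrite wedgeZl -q_wedge_lt.
Qed.

Lemma dot_qsum (w : 'rV[R]_l.-1) j : (j < l)%N ->
  dot (q D j *m v0) (\sum_(i < l.-1) w 0 i *: (q D i.+1 *m v0)) =
  - \sum_(i < l.-1) (if i.+1 == j then w 0 i else 0).
Proof.
move=> hj; rewrite dot_sumr -sumrN; apply: eq_bigr => i _.
rewrite dotZr qv_dot // [j == _]eq_sym; case: eqP => [<-|_] /=; ring.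
Qed.

Lemma dot_qsumS (w : 'rV[R]_l.-1) (k : 'I_l.-1) :
  dot (q D k.+1 *m v0) (\sum_(i < l.-1) w 0 i *: (q D i.+1 *m v0)) = - w 0 k.
Proof.
rewrite dot_qsum // (bigD1 k) //= eqxx big1 ?addr0 // => i ik.
by rewrite eqSS (inj_eq val_inj) (negPf ik).
Qed.

Lemma dot_qsum_v0 (w : 'rV[R]_l.-1) :
  dot (\sum_(i < l.-1) w 0 i *: (q D i.+1 *m v0)) v0 = 0.
Proof.
rewrite dot_suml big1 // => i _.
by rewrite dotZl (@frame_col_dot i.+2 0) ?mulr0 // ltnS.
Qed.

Lemma dot_qsum_tau (w : 'rV[R]_l.-1) :
  dot (\sum_(i < l.-1) w 0 i *: (q D i.+1 *m v0)) tau = 0.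
Proof.
rewrite dotC -(q0_v0 hl hD) dot_qsum; last by lia.
by rewrite big1 ?oppr0.
Qed.

Lemma dot_qsum_self (w : 'rV[R]_l.-1) :
  let y := \sum_(i < l.-1) w 0 i *: (q D i.+1 *m v0) in
  dot y y = - \sum_i w 0 i ^+ 2.
Proof.
move=> y; rewrite {1}/y dot_suml -sumrN; apply: eq_bigr => i _.
by rewrite dotZl dot_qsumS expr2 mulrN.
Qed.

Lemma directionP u : (exists2 w, unit_sphere w & direction D w *m v0 = u) <->
  exists2 y, u = tau + y & [/\ dot y v0 = 0, dot y tau = 0 & dot y y = -1].
Proof.
split=> [[w hw <-]|[y -> [yv0 yt yy]]].
  exists (\sum_(i < l.-1) w 0 i *: (q D i.+1 *m v0)); first exact: direction_v0.
  by split; rewrite ?dot_qsum_v0 ?dot_qsum_tau // dot_qsum_self hw.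
(* The sign is that of the square norm -1 of the frame vectors. *)
pose w : 'rV[R]_l.-1 := \row_i - dot y (q D i.+1 *m v0).
have ey : y = \sum_(i < l.-1) w 0 i *: (q D i.+1 *m v0).
  apply/eqP; rewrite -subr_eq0; apply/eqP; apply: frame_complete => -[|[|j]] hj.
  - by rewrite dotDr dotNr /= dotC yv0 dotC dot_qsum_v0 subr0.
  - by rewrite dotDr dotNr /= -/(q D 0) (q0_v0 hl hD) dotC yt dotC dot_qsum_tau subr0.
  - have hj' : (j < l.-1)%N by lia.
    have := dot_qsumS w (Ordinal hj') => /= h.
    by rewrite dotDr dotNr /frame_col h mxE opprK dotC /= subrr.
exists w; last by rewrite direction_v0 -ey.
by have := dot_qsum_self w; rewrite /= -ey yy /unit_sphere /= => /oppr_inj.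
Qed.

End Directions.

(** * Closed orbits of AN *)

Section ConnectedSubgroup.
Variables (R : realType) (n : nat) (a : {vspace 'M[R]_n.+1}).

Lemma connected_subgroup_sub (K : set 'M[R]_n.+1) : subgroup K ->
  (forall X, X \in a -> K (expmx X)) -> connected_subgroup a `<=` K.
Proof. by move=> sK h x; apply; split=> // _ [X /= hX <-]; exact: h. Qed.

Lemma connected_subgroup_exp X : X \in a -> connected_subgroup a (expmx X).
Proof. by move=> hX K [_]; apply; exists X. Qed.

Lemma connected_subgroup1 : connected_subgroup a 1%:M.
Proof. by move=> K [[_ h _ _] _]. Qed.

Lemma connected_subgroupM g h : connected_subgroup a g -> connected_subgroup a h ->
  connected_subgroup a (g *m h).
Proof. by move=> hg hh K hK; have [[_ _ M _] _] := hK; apply: M; [exact: hg|exact: hh]. Qed.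

End ConnectedSubgroup.

(** * Orbits of AN for two abstract hyperbolic planes (e, e') and (f, f') *)

Section Orbits.
Variables (R : realType) (l : nat) (D : ads_data R l).
Local Notation M := 'M[R]_l.+1.
Local Notation V := 'cV[R]_l.+1.
Local Notation v0 := (base_vec D).
Implicit Types (u v w x y z k : V) (X Y Z g h : M).

Variables (e e' f f' : V) (a n : {vspace M}).
Hypotheses (l0 : (0 < l)%N).
Hypotheses (ee : dot e e = 0) (e'e' : dot e' e' = 0) (ff : dot f f = 0) (f'f' : dot f' f' = 0).
Hypotheses (ee' : dot e e' = 2) (ff' : dot f f' = 2).
Hypotheses (ef : dot e f = 0) (ef' : dot e f' = 0) (e'f : dot e' f = 0) (e'f' : dot e' f' = 0).
Hypotheses (v0E : v0 = 2^-1 *: (f + f')).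
Hypotheses (aP : forall X, X \in a -> [/\ X \in so R l,
  exists s, X *m e = s *: e & exists s, X *m f = s *: f]).
Hypotheses (nP : forall X, X \in n -> [/\ X \in so R l, X *m e = 0 &
  exists s, X *m f = s *: e]).
Hypotheses (a_e : wedge e e' \in a) (a_f : wedge f f' \in a).
Hypotheses (n_f : wedge f e \in n) (n_f' : wedge f' e \in n).
Hypotheses (n_y : forall y, dot y e = 0 -> dot y e' = 0 -> dot y f = 0 -> dot y f' = 0 ->
  wedge f y \in n).

Local Notation KA := (connected_subgroup a).
Local Notation KN := (connected_subgroup n).
Local Notation K := (setprod KA KN).

Let t : V := 2^-1 *: (e + e').

Let dots := (ee, e'e', ff, f'f', ee', ff', ef, ef', e'f, e'f', dotC e' e, dotC f' f,
  dotC f e, dotC f' e, dotC f e', dotC f' e').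

Lemma orb_v00 : dot v0 v0 = 1.
Proof. by rewrite v0E !dotE !dots; field. Qed.

Lemma orb_tt : dot t t = 1.
Proof. by rewrite /t !dotE !dots; field. Qed.

Lemma orb_v0t : dot v0 t = 0.
Proof. by rewrite v0E /t !dotE !dots; field. Qed.

(** Stabilizer of the flag spanned by e and then e, f, with positive diagonal. It contains A and N;
    it preserves the sign of <x, e> and, where this product vanishes, that of <x, f>. *)
Definition flag_group : set M := [set g | [/\ SO0 R l g,
  exists2 s, 0 < s & g *m e = s *: e &
  exists s r, 0 < s /\ g *m f = s *: f + r *: e]].

Lemma flag_subgroup : subgroup flag_group.
Proof.
split.
- by move=> g [Sg _ _]; exact: SO0_unit.
- split; first exact: SO0_1.
    by exists 1; rewrite ?mul1mx ?scale1r.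
  by exists 1, 0; rewrite mul1mx scale1r scale0r addr0.
- move=> g h [Sg [s s0 ge] [s1 [r1 [s10 gf]]]] [Sh [p p0 he] [p1 [r2 [p10 hf]]]].
  split; first exact: SO0M.
    by exists (p * s); [exact: mulr_gt0 | rewrite -mulmxA he -scalemxAr ge scalerA].
  exists (p1 * s1), (p1 * r1 + r2 * s); split; first exact: mulr_gt0.
  rewrite -mulmxA hf mulmxDr -!scalemxAr gf ge scalerDr !scalerA.
  by rewrite -addrA -scalerDl.
- move=> g [Sg [s s0 ge] [s1 [r1 [s10 gf]]]]; have u := SO0_unit Sg.
  have ie : invmx g *m e = s^-1 *: e.
    have := congr1 (mulmx (invmx g)) ge; rewrite mulKmx // -scalemxAr => {2}->.
    by rewrite scalerA mulVf ?scale1r // gt_eqF.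
  split; first exact: SO0V.
    by exists s^-1; rewrite ?invr_gt0.
  exists s1^-1, (- (s1^-1 * r1 * s^-1)); split; first by rewrite invr_gt0.
  have := congr1 (mulmx (invmx g)) gf; rewrite mulKmx // mulmxDr -!scalemxAr ie.
  move: (invmx g *m f) => F /matrixP hF; apply/matrixP => i j; have := hF i j.
  rewrite !mxE => ->; field.
  by rewrite gt_eqF // gt_eqF.
Qed.

Lemma KA_flag : KA `<=` flag_group.
Proof.
apply: connected_subgroup_sub flag_subgroup _ => X /aP[hX [s Xe] [r Xf]].
split; first exact: expmx_SO0.
  by exists (expR s); rewrite ?expR_gt0 // (expmx_eigen Xe).
by exists (expR r), 0; rewrite expR_gt0 (expmx_eigen Xf) scale0r addr0.
Qed.

Lemma KN_flag : KN `<=` flag_group.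
Proof.
apply: connected_subgroup_sub flag_subgroup _ => X /nP[hX Xe [r Xf]].
split; first exact: expmx_SO0.
  by exists 1; rewrite // expmx_fix // scale1r.
exists 1, r; split=> //.
have XXf : X *m (r *: e) = 0 by rewrite -scalemxAr Xe scaler0.
by rewrite expmx_nil3 Xf XXf ?mulmx0 // scaler0 addr0 scale1r.
Qed.

Lemma K_flag : K `<=` flag_group.
Proof.
move=> _ [p /KA_flag hp [q /KN_flag hq <-]].
by have [_ _ h _] := flag_subgroup; exact: h.
Qed.

Lemma flag_dot_e g x : flag_group g -> exists2 s, 0 < s & dot (g *m x) e = s * dot x e.
Proof.
move=> [Sg [s s0 ge] _]; exists s^-1; first by rewrite invr_gt0.
by rewrite -(SO0_dot x e Sg) ge dotZr mulKf // gt_eqF.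
Qed.

Lemma flag_dot_f g x : flag_group g -> dot x e = 0 ->
  exists2 s, 0 < s & dot (g *m x) f = s * dot x f.
Proof.
move=> gg xe; have [s2 _ he] := flag_dot_e x gg; rewrite xe mulr0 in he.
have [Sg _ [s [r [s0 gf]]]] := gg.
exists s^-1; first by rewrite invr_gt0.
by rewrite -(SO0_dot x f Sg) gf dotDr !dotZr he mulr0 addr0 mulKf // gt_eqF.
Qed.

Lemma expmx_null_wedge (s : R) k u : dot k k = 0 -> dot e k = 0 ->
  expmx (s *: wedge k e) *m u = u + s *: (dot e u *: k - dot k u *: e).
Proof.
move=> kk ek; have h0 : (s *: wedge k e) *m ((s *: wedge k e) *m u) = 0.
  rewrite -!scalemxAl !wedgeE !dotE kk ek ee (dotC k e) ek.
  by rewrite !(mulr0, subr0, scale0r, scaler0).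
by rewrite expmx_nil3 h0 ?mulmx0 // scaler0 addr0 -scalemxAl wedgeE.
Qed.

Lemma KN_null (s : R) : KN (expmx (s *: wedge f e)) /\ KN (expmx (s *: wedge f' e)).
Proof. by split; apply: connected_subgroup_exp; rewrite memvZ. Qed.

Lemma orb_neg y : dot y e = 0 -> dot y e' = 0 -> dot y f = 0 -> dot y f' = 0 ->
  dot y y <= 0.
Proof.
move=> h1 h2 h3 h4; have [->|y0] := eqVneq y 0; first by rewrite dot0l.
apply/ltW/(neg_definite l0 orb_v00 orb_tt orb_v0t) => //.
  by rewrite v0E !dotE h3 h4; ring.
by rewrite /t !dotE h1 h2; ring.
Qed.

(** Otherwise, subtracting from z its components along the isotropic plane of e and f leaves a
    vector of norm 1 orthogonal to both hyperbolic planes, where the form is nonpositive. *)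
Lemma flag_f_neq0 z : dot z z = 1 -> dot z e = 0 -> dot z f != 0.
Proof.
move=> zz ze; apply/eqP => zf.
pose y := z - (2^-1 * dot z e') *: e - (2^-1 * dot z f') *: f.
have h1 : dot y e = 0 by rewrite /y !dotE !dots ze; ring.
have h2 : dot y e' = 0 by rewrite /y !dotE !dots; field.
have h3 : dot y f = 0 by rewrite /y !dotE !dots zf; ring.
have h4 : dot y f' = 0 by rewrite /y !dotE !dots; field.
have := orb_neg h1 h2 h3 h4.
suff -> : dot y y = 1 by lra.
by rewrite /y !dotE !dots (dotC e z) (dotC f z) ze zf zz; ring.
Qed.

(** Three moves build z from v0: [wedge f (- y)] creates the component y, [wedge f e] the component
    along e, and the boost of (f, f') adjusts the coefficient of f'. That of f is then forced by the
    norm. *)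
Lemma orbit_base z : dot z z = 1 -> dot z e = 0 -> 0 < dot z f ->
  exists2 g, K g & g *m v0 = z.
Proof.
move=> zz ze zf.
pose c := 2^-1 * dot z f; pose al := 2^-1 * dot z e'; pose ga := 2^-1 * dot z f'.
have [y ez] : exists y, z = al *: e + ga *: f + c *: f' + y.
  by exists (z - (al *: e + ga *: f + c *: f')); rewrite addrC subrK.
have yE : y = z - (al *: e + ga *: f + c *: f') by rewrite ez [RHS]addrAC subrr add0r.
have h1 : dot y e = 0 by rewrite yE !dotE !dots ze; ring.
have h2 : dot y e' = 0 by rewrite yE !dotE !dots /al; field.
have h3 : dot y f = 0 by rewrite yE !dotE !dots /c; field.
have h4 : dot y f' = 0 by rewrite yE !dotE !dots /ga; field.
have c0 : 0 < c by rewrite /c; lra.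
have nz : 4 * ga * c + dot y y = 1.
  have <- : dot z z = 4 * ga * c + dot y y; last exact: zz.
  rewrite [in LHS]ez !dotE !dots h1 h3 h4 (dotC e y) (dotC f y) (dotC f' y) h1 h3 h4; ring.
(* The boost multiplies the coefficient 1/2 of f' in v0 by e^(-s), and the result has to be c. *)
pose s := - ln (2 * c).
have es : expR (- s) = 2 * c by rewrite opprK lnK // posrE; lra.
exists (expmx ((2^-1 * s) *: wedge f f') *m
    (expmx (- al *: wedge f e) *m expmx (wedge f (- y)))).
  exists (expmx ((2^-1 * s) *: wedge f f')).
    by apply: connected_subgroup_exp; rewrite memvZ.
  exists (expmx (- al *: wedge f e) *m expmx (wedge f (- y))) => //.
  apply: connected_subgroupM; apply: connected_subgroup_exp; rewrite ?memvZ //.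
  by apply: n_y; rewrite dotNl ?h1 ?h2 ?h3 ?h4 oppr0.
have fv : dot f v0 = 1 by rewrite v0E !dotE !dots; field.
have ev : dot e v0 = 0 by rewrite v0E !dotE !dots; field.
have X0p_vec : dot y v0 = 0 by rewrite v0E !dotE h3 h4; field.
have Y1 : wedge f (- y) *m v0 = y.
  by rewrite wedgeE dotNl X0p_vec fv oppr0 scale0r scale1r sub0r opprK.
have Y2 : wedge f (- y) *m y = - dot y y *: f.
  by rewrite wedgeE dotNl (dotC f) h3 scale0r subr0.
have Y3 : wedge f (- y) *m f = 0.
  by rewrite wedgeE dotNl h3 ff oppr0 !scale0r subrr.
have E1 : expmx (wedge f (- y)) *m v0 = v0 + y + 2^-1 *: (- dot y y *: f).
  by rewrite expmx_nil3 Y1 Y2 // -scalemxAr Y3 scaler0.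
have E2 : expmx (- al *: wedge f e) *m (v0 + y + 2^-1 *: (- dot y y *: f)) =
    v0 + y + 2^-1 *: (- dot y y *: f) + al *: e.
  rewrite expmx_null_wedge // !dotE !dots ev fv (dotC e y) (dotC f y) h1 h3.
  by apply/matrixP => i j; rewrite !mxE; ring.
rewrite -!mulmxA E1 E2 {E1 E2} [in LHS]v0E !(mulmxDr, scalerDr, =^~ scalemxAr).
have Ff : ((2^-1 * s) *: wedge f f') *m f = s *: f.
  by rewrite -scalemxAl wedgeE !dots scale0r subr0 scalerA; congr (_ *: _); field.
have Ff' : ((2^-1 * s) *: wedge f f') *m f' = - s *: f'.
  by rewrite -scalemxAl wedgeE !dots scale0r sub0r -scaleNr scalerA; congr (_ *: _); field.
rewrite (expmx_eigen Ff) (expmx_eigen Ff') es.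
rewrite !expmx_fix; first last.
- by rewrite -scalemxAl wedgeE (dotC f') (dotC f) h3 h4 !scale0r subrr scaler0.
- by rewrite -scalemxAl wedgeE !dots !scale0r subrr scaler0.
have ess : expR s * (2 * c) = 1 by rewrite -es expRxMexpNx_1.
have ga' : ga = expR s * 2^-1 * (1 - dot y y).
  rewrite (_ : 1 - dot y y = 4 * ga * c); last by lra.
  by transitivity (expR s * (2 * c) * ga); [rewrite ess mul1r | field].
by rewrite [RHS]ez ga'; apply/matrixP => i j; rewrite !mxE; field.
Qed.

Lemma orbit_of_fib u : dot u u = 1 ->
  orbit_of K (fib D u) = pts D (fun z => exists2 g, K g & g *m u = z).
Proof.
move=> uu; apply/seteqP; split=> [_ [g Kg <-]|_ [z [zz [g Kg <-]] <-]].
  have [Sg _ _] := K_flag Kg.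
  exists (g *m u); last by rewrite act_fib.
  by split; [rewrite SO0_dot | exists g].
have [Sg _ _] := K_flag Kg.
by exists g => //; rewrite act_fib.
Qed.

Let ptsE' := @ptsE _ _ D t orb_v00 orb_tt orb_v0t.

(** Otherwise N moves u to a vector c e' + w with w orthogonal to e and e', and the boosts of (e,
    e') contract it to w. This limit lies on the quadric with <w, e> = 0, a value that <x, e> never
    takes on the orbit. *)
Lemma closed_orbit_e u : dot u u = 1 -> ads_closed D (orbit_of K (fib D u)) -> dot u e = 0.
Proof.
move=> uu; rewrite orbit_of_fib // => -[_ op]; apply/eqP; apply: contraT => ue.
(* [wedge f e] changes the product with e' in proportion to <u, f>; if that is 0, [wedge f' e] first
   makes it nonzero. *)
have [n1 Kn1 u1f] : exists2 n1, KN n1 & dot (n1 *m u) f != 0.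
  have [uf|uf] := eqVneq (dot u f) 0; last first.
    by exists 1%:M; [exact: connected_subgroup1 | rewrite mul1mx].
  exists (expmx (1 *: wedge f' e)); first exact: (proj2 (KN_null 1)).
  rewrite expmx_null_wedge // !dotE !dots uf (dotC e u).
  by apply/eqP => h; case/eqP: ue; lra.
have hn1 := KN_flag Kn1; have [s1 s10 he1] := flag_dot_e u hn1.
have u1e : dot (n1 *m u) e != 0 by rewrite he1 mulf_neq0 // gt_eqF.
have Sn1 : SO0 R l n1 by case: hn1.
pose s := dot (n1 *m u) e' / (2 * dot (n1 *m u) f).
pose n2 := expmx (s *: wedge f e).
have Kn2 : KN n2 := proj1 (KN_null s).
have Kn : KN (n2 *m n1) by exact: connected_subgroupM.
pose u2 := n2 *m n1 *m u.
have u2e' : dot u2 e' = 0.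
  rewrite /u2 -mulmxA expmx_null_wedge // !dotE !dots (dotC f) /s.
  by move: u1f => /eqP u1f; field; exact/eqP.
have hn := KN_flag Kn; have [s2 s20 he2] := flag_dot_e u hn.
have u2e : dot u2 e != 0 by rewrite /u2 he2 mulf_neq0 // gt_eqF.
have u2u2 : dot u2 u2 = 1 by have [Sn _ _] := hn; rewrite /u2 SO0_dot.
pose c := 2^-1 * dot u2 e.
have [w ew] : exists w, u2 = c *: e' + w by exists (u2 - c *: e'); rewrite addrC subrK.
have we : dot w e = 0.
  have : dot u2 e = dot (c *: e' + w) e by rewrite -ew.
  by rewrite !dotE !dots /c; lra.
have we' : dot w e' = 0.
  by have := u2e'; rewrite ew !dotE !dots; lra.
have ww : dot w w = 1.
  by have := u2u2; rewrite ew !dotE !dots (dotC e' w) we'; lra.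
have Ow : (AdS D `\` pts D (fun z => exists2 g, K g & g *m u = z)) (fib D w).
  split; first exact: (AdS_fib orb_v00 orb_tt orb_v0t).
  move/(ptsE' _ ww) => [g Kg gu]; have [r r0 hr] := flag_dot_e u (K_flag Kg).
  by move: we; rewrite -gu hr => /eqP; rewrite mulf_eq0 (negPf ue) orbF gt_eqF.
have nw := ads_open_nbhs orb_v00 orb_tt orb_v0t op ww Ow.
pose h (m : nat) := expmx ((2^-1 * m%:R) *: wedge e e').
have hE m : h m *m u2 = expR (- m%:R) *: (c *: e') + w.
  have E1 : ((2^-1 * m%:R) *: wedge e e') *m e' = - m%:R *: e'.
    by rewrite -scalemxAl wedgeE !dots scale0r sub0r -scaleNr scalerA; congr (_ *: _); field.
  rewrite /h ew mulmxDr -scalemxAr (expmx_eigen E1) expmx_fix.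
    by rewrite !scalerA mulrC.
  by rewrite -scalemxAl wedgeE (dotC e') (dotC e) we we' !scale0r subrr scaler0.
have cv : h m *m u2 @[m --> \oo] --> w.
  rewrite (_ : (fun m => _) = (fun m => expR (- m%:R) *: (c *: e') + w)); last exact/funext.
  rewrite -[X in _ --> X]add0r -(scale0r (c *: e')).
  apply: cvg_addmx (cvg_cst _); apply: cvg_scalemx (cvg_cst _).
  exact: cvgn_expR.
have [m _ /(_ m (leqnn m))] := cv _ nw.
have Kh : K (h m *m (n2 *m n1)).
  exists (h m); first by apply: connected_subgroup_exp; rewrite memvZ.
  by exists (n2 *m n1).
have zz : dot (h m *m u2) (h m *m u2) = 1.
  have [Sh _ _] := K_flag Kh.
  by rewrite /u2 mulmxA SO0_dot.
case=> [//|_]; case; apply/(ptsE' _ zz); exists (h m *m (n2 *m n1)) => //.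
exact: esym (mulmxA (h m) (n2 *m n1) u).
Qed.

Lemma orbit_flag (s : R) : s ^+ 2 = 1 -> orbit_of K (fib D (s *: v0)) =
  pts D (fun z => dot z e = 0 /\ 0 < s * dot z f).
Proof.
move=> ss; have sv : dot (s *: v0) (s *: v0) = 1 by rewrite !dotE orb_v00 mulr1 -expr2.
have fv : dot v0 f = 1 by rewrite v0E !dotE !dots; field.
have ev : dot v0 e = 0 by rewrite v0E !dotE !dots; field.
rewrite orbit_of_fib //; apply/seteqP; split=> [_ [z [zz [g Kg gz]] <-]|_ [z [zz [ze zf]] <-]].
  have hg := K_flag Kg.
  have [r r0 he] := flag_dot_e (s *: v0) hg.
  have se : dot (s *: v0) e = 0 by rewrite dotZl ev mulr0.
  have [p p0 hf] := flag_dot_f hg se.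
  exists z => //; split=> //; rewrite -gz he hf !dotZl ev fv !mulr0; split=> //.
  by rewrite mulr1 mulrCA -expr2 ss mulr1.
have [|||g Kg gz] := @orbit_base (s *: z).
- by rewrite !dotE zz mulr1 -expr2.
- by rewrite dotZl ze mulr0.
- by rewrite dotZl.
exists z => //; split=> //; exists g => //.
by rewrite -scalemxAr gz scalerA -expr2 ss scale1r.
Qed.

(** On the section <z, e> = 0 of the quadric <z, f> never vanishes, so its sign is locally constant
    there. *)
Lemma flag_orbit_closed (s : R) : s ^+ 2 = 1 ->
  ads_closed D (pts D (fun z => dot z e = 0 /\ 0 < s * dot z f)).
Proof.
move=> ss; split; first exact: (pts_sub orb_v00 orb_tt orb_v0t).
rewrite (pts_compl orb_v00 orb_tt orb_v0t).
apply: (nbhs_ads_open orb_v00).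
  exact: (pts_sub orb_v00 orb_tt orb_v0t).
move=> v vv /(ptsE' _ vv) hv; have FF := nbhs_filter v.
have ce : dot z e @[z --> v] --> dot v e by apply: cvg_dot cvg_id (cvg_cst _).
have cf : s * dot z f @[z --> v] --> s * dot v f.
  by apply: cvgM (cvg_cst _) _; apply: cvg_dot cvg_id (cvg_cst _).
have nh : \forall z \near v, ~ (dot z e = 0 /\ 0 < s * dot z f).
  have [ve|ve] := eqVneq (dot v e) 0.
    have vf := flag_f_neq0 vv ve.
    have s0 : s != 0 by apply/eqP => s0; move: ss; rewrite s0; lra.
    have sv : s * dot v f < 0.
      by rewrite lt_neqAle mulf_neq0 //= leNgt; apply/negP => h; apply: hv.
    have n1 : \forall z \near v, s * dot z f < 0 by exact: (cvgr_lt _ cf).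
    by apply: filterS n1 => z h [_]; rewrite ltNge ltW.
  have n1 : \forall z \near v, dot z e != 0 by exact: (cvgr_neq0 _ ce).
  by apply: filterS n1 => z /eqP h [].
by apply: filterS nh => z hz zz; apply/(ptsE' _ zz).
Qed.

Lemma closed_orbitsE : \bigcup_(O in closed_orbits D K) O = pts D (fun z => dot z e = 0).
Proof.
apply/seteqP; split=> [x [U [cU [y Ay Uy]] Ux]|_ [z [zz ze] <-]].
  move: Ay; rewrite (AdS_pts orb_v00 orb_tt orb_v0t) => -[u [uu _] uy]; subst y U.
  have ue := closed_orbit_e uu cU.
  move: Ux; rewrite orbit_of_fib // => -[z [zz [g Kg gu]] <-]; exists z => //; split=> //.
  by have [r _ hr] := flag_dot_e u (K_flag Kg); rewrite -gu hr ue mulr0.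
have zf := flag_f_neq0 zz ze.
pose s := Num.sg (dot z f).
have ss : s ^+ 2 = 1 by rewrite /s sqr_sg zf.
exists (pts D (fun z => dot z e = 0 /\ 0 < s * dot z f)).
  split; first exact: flag_orbit_closed.
  exists (fib D (s *: v0)); last by rewrite orbit_flag.
  by apply: (AdS_fib orb_v00 orb_tt orb_v0t); rewrite !dotE orb_v00 mulr1 -expr2.
exists z => //; split=> //; split=> //.
by rewrite /s -normrEsg normr_gt0.
Qed.

End Orbits.

(** * The singularity *)

Section Weights.
Variables (R : realType) (l : nat).
Local Notation M := 'M[R]_l.+1.
Local Notation V := 'cV[R]_l.+1.
Implicit Types (u v w x y z k : V) (X Y Z g h : M).

Lemma weight_shift J X u (p s : R) : bracket J X = p *: X -> J *m u = s *: u ->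
  J *m (X *m u) = (s + p) *: (X *m u).
Proof.
move=> h hu; have := bracketE J X u; rewrite h hu -scalemxAl -scalemxAr => e.
by rewrite scalerDl e addrC subrK.
Qed.

Variables (e e' f f' : V).
Hypotheses (ee : dot e e = 0) (e'e' : dot e' e' = 0) (ff : dot f f = 0) (f'f' : dot f' f' = 0).
Hypotheses (ee' : dot e e' = 2) (ff' : dot f f' = 2).
Hypotheses (ef : dot e f = 0) (ef' : dot e f' = 0) (e'f : dot e' f = 0) (e'f' : dot e' f' = 0).

Local Notation J := (2^-1 *: wedge e e').
Local Notation J' := (2^-1 *: wedge f f').

Let dots := (ee, e'e', ff, f'f', ee', ff', ef, ef', e'f, e'f', dotC e' e, dotC f' f,
  dotC f e, dotC f' e, dotC f e', dotC f' e').

Let JE x : J *m x = 2^-1 *: (dot e' x *: e - dot e x *: e').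
Proof. by rewrite -scalemxAl wedgeE. Qed.

Let J'E x : J' *m x = 2^-1 *: (dot f' x *: f - dot f x *: f').
Proof. by rewrite -scalemxAl wedgeE. Qed.

Lemma weight_ef : [/\ J *m e = 1 *: e, J' *m e = 0 *: e, J *m f = 0 *: f & J' *m f = 1 *: f].
Proof.
by split; rewrite ?JE ?J'E !dots; apply/matrixP => i j; rewrite !mxE; field.
Qed.

Lemma weight1 x : J *m x = 1 *: x -> x = (2^-1 * dot e' x) *: e.
Proof.
rewrite scale1r JE => h.
have := congr1 (dot e) h; rewrite !dotE !dots => h1.
have h2 : dot e x = 0 by lra.
by rewrite -{1}h h2 scale0r subr0 scalerA.
Qed.

Lemma weight2 x : J *m x = (1 + 1) *: x -> x = 0.
Proof.
rewrite JE => h.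
have := congr1 (dot e) h; rewrite !dotE !dots => h1.
have h2 : dot e x = 0 by lra.
have := congr1 (dot e') h; rewrite !dotE !dots => h3.
have h4 : dot e' x = 0 by lra.
have /eqP := h; rewrite h2 h4 !scale0r subrr scaler0 eq_sym scaler_eq0.
by rewrite (_ : 1 + 1 = 2%:R) // pnatr_eq0 => /eqP.
Qed.

Lemma weight2' x : J' *m x = (1 + 1) *: x -> x = 0.
Proof.
rewrite J'E => h.
have := congr1 (dot f) h; rewrite !dotE !dots => h1.
have h2 : dot f x = 0 by lra.
have := congr1 (dot f') h; rewrite !dotE !dots => h3.
have h4 : dot f' x = 0 by lra.
have /eqP := h; rewrite h2 h4 !scale0r subrr scaler0 eq_sym scaler_eq0.
by rewrite (_ : 1 + 1 = 2%:R) // pnatr_eq0 => /eqP.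
Qed.

(** Infinitesimal form of preserving the flag e, f with diagonal entries 1. *)
Definition lowers X : Prop := X *m e = 0 /\ exists s, X *m f = s *: e.

Lemma lowersD X Y : lowers X -> lowers Y -> lowers (X + Y).
Proof.
move=> [Xe [s Xf]] [Ye [r Yf]]; split; first by rewrite mulmxDl Xe Ye addr0.
by exists (s + r); rewrite mulmxDl Xf Yf scalerDl.
Qed.

(** X e would have weight 2 for J, which does not occur, and X f has weight 1, hence lies on the
    line of e. *)
Lemma weight_lowers1 q X : bracket J X = 1 *: X -> bracket J' X = q *: X ->
  [\/ q = 1, q = -1 | q = 0] -> lowers X.
Proof.
have [Je J'e Jf J'f] := weight_ef => h h' hq.
split; first exact: weight2 (weight_shift h Je).
case: hq h' => -> h'.
- by exists 0; rewrite (weight2' (weight_shift h' J'f)) scale0r.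
- by exists (2^-1 * dot e' (X *m f)); apply: weight1; rewrite (weight_shift h Jf) add0r.
- by exists (2^-1 * dot e' (X *m f)); apply: weight1; rewrite (weight_shift h Jf) add0r.
Qed.

(** X e would have weights (1, 1) and X f weight 2 for J'; only the zero vector does. *)
Lemma weight_lowers0 X : bracket J X = 0 *: X -> bracket J' X = 1 *: X -> lowers X.
Proof.
have [Je J'e Jf J'f] := weight_ef => h h'.
split; last by exists 0; rewrite (weight2' (weight_shift h' J'f)) scale0r.
have h1 := weight1 (etrans (weight_shift h Je) (congr1 (fun s => s *: _) (addr0 1))).
have := weight_shift h' J'e; rewrite h1 add0r scale1r -scalemxAr J'e scale0r scaler0.
by move=> <-.
Qed.

Lemma bracket_weight a b x y (p q : R) : a *m x = p *: x -> a *m y = q *: y ->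
  a \in so R l -> b = p + q -> bracket a (wedge x y) = b *: wedge x y.
Proof.
by move=> hx hy ha ->; rewrite bracket_wedge // hx hy wedgeZl wedgeZr scalerDl.
Qed.

Lemma J_so : J \in so R l. Proof. by rewrite memvZ // wedge_so. Qed.
Lemma J'_so : J' \in so R l. Proof. by rewrite memvZ // wedge_so. Qed.

Lemma weight_f' : J *m f' = 0 *: f' /\ J' *m f' = -1 *: f'.
Proof.
by split; rewrite ?JE ?J'E !dots; apply/matrixP => i j; rewrite !mxE; field.
Qed.

Lemma weight_y y : dot y e = 0 -> dot y e' = 0 -> dot y f = 0 -> dot y f' = 0 ->
  J *m y = 0 *: y /\ J' *m y = 0 *: y.
Proof.
move=> h1 h2 h3 h4; rewrite JE J'E (dotC e') (dotC e) (dotC f') (dotC f) h1 h2 h3 h4.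
by rewrite !scale0r subrr scaler0.
Qed.

Lemma bracket_fe : bracket J (wedge f e) = 1 *: wedge f e /\
  bracket J' (wedge f e) = 1 *: wedge f e.
Proof.
have [Je J'e Jf J'f] := weight_ef.
split; [apply: bracket_weight Jf Je J_so _ | apply: bracket_weight J'f J'e J'_so _].
  by rewrite add0r.
by rewrite addr0.
Qed.

Lemma bracket_f'e : bracket J (wedge f' e) = 1 *: wedge f' e /\
  bracket J' (wedge f' e) = -1 *: wedge f' e.
Proof.
have [Je J'e Jf J'f] := weight_ef; have [Jf' J'f'] := weight_f'.
split; [apply: bracket_weight Jf' Je J_so _ | apply: bracket_weight J'f' J'e J'_so _].
  by rewrite add0r.
by rewrite addr0.
Qed.

Lemma bracket_fy y : dot y e = 0 -> dot y e' = 0 -> dot y f = 0 -> dot y f' = 0 ->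
  bracket J (wedge f y) = 0 *: wedge f y /\ bracket J' (wedge f y) = 1 *: wedge f y.
Proof.
move=> h1 h2 h3 h4; have [Jy J'y] := weight_y h1 h2 h3 h4.
have [Je J'e Jf J'f] := weight_ef.
split; [apply: bracket_weight Jf Jy J_so _ | apply: bracket_weight J'f J'y J'_so _].
  by rewrite add0r.
by rewrite addr0.
Qed.

Definition weight_space (p r : R) X : Prop :=
  [/\ X \in so R l, bracket J X = p *: X & bracket J' X = r *: X].

(** The conditions on a and n speak of weights alone. Exchanging e with e' and f with f' reverses J
    and J', so the same statement covers A with N and A with N-bar. *)
Lemma weight_orbits (D : ads_data R l) (a n : {vspace M}) : (0 < l)%N ->
  base_vec D = 2^-1 *: (f + f') ->
  (forall X, X \in a -> [/\ X \in so R l,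
    exists s, X *m e = s *: e & exists s, X *m f = s *: f]) ->
  J \in a -> J' \in a ->
  (forall X, X \in n -> exists X1 X2 X3 X4, [/\ weight_space 1 1 X1,
    weight_space 1 (-1) X2, weight_space 1 0 X3, weight_space 0 1 X4 & X = X1 + X2 + X3 + X4]) ->
  (forall X p r, weight_space p r X ->
    (p, r) \in [:: (1, 1); (1, -1); (1, 0); (0, 1)] -> X \in n) ->
  \bigcup_(U in closed_orbits D (setprod (connected_subgroup a) (connected_subgroup n))) U =
  pts D (fun z => dot z e = 0).
Proof.
move=> l0 v0E aP aJ aJ' nP nQ.
have aw (w : M) : 2^-1 *: w \in a -> w \in a.
  by move=> h; rewrite -[w]scale1r -(mulfV (_ : (2 : R) != 0)) ?pnatr_eq0 // -scalerA memvZ.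
apply: (closed_orbitsE l0 ee e'e' ff f'f' ee' ff' ef ef' e'f e'f' v0E) => //.
- move=> X /nP[X1 [X2 [X3 [X4 [[g1 p1 r1] [g2 p2 r2] [g3 p3 r3] [g4 p4 r4] ->]]]]].
  have L : lowers (X1 + X2 + X3 + X4).
    apply: lowersD (weight_lowers0 p4 r4); apply: lowersD; first apply: lowersD.
    + by apply: weight_lowers1 p1 r1 _; constructor 1.
    + by apply: weight_lowers1 p2 r2 _; constructor 2.
    + by apply: weight_lowers1 p3 r3 _; constructor 3.
  by case: L => L1 L2; split=> //; rewrite !memvD.
- exact: aw.
- exact: aw.
- have [h1 h2] := bracket_fe.
  by apply: (nQ _ 1 1); [split=> //; exact: wedge_so | rewrite !inE eqxx].
- have [h1 h2] := bracket_f'e.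
  by apply: (nQ _ 1 (-1)); [split=> //; exact: wedge_so | rewrite !inE eqxx orbT].
- move=> y y1 y2 y3 y4; have [h1 h2] := bracket_fy y1 y2 y3 y4.
  by apply: (nQ _ 0 1); [split=> //; exact: wedge_so | rewrite !inE eqxx !orbT].
Qed.

End Weights.

(** * Root spaces as weight spaces, and the union of the closed orbits *)

Section Singularity.
Variables (R : realType) (l : nat) (D : ads_data R l).
Hypotheses (hl : (3 <= l)%N) (hD : ads_axioms D).
Local Notation M := 'M[R]_l.+1.
Local Notation V := 'cV[R]_l.+1.
Local Notation g := (so R l).
Local Notation v0 := (base_vec D).
Local Notation b := (J2 D *m v0).
Local Notation th := (theta D).
Local Notation e := (e_plus D).
Local Notation e' := (e_minus D).
Local Notation f := (v0 + b).
Local Notation f' := (v0 - b).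

Lemma frame_dots : [/\ [/\ dot e e = 0, dot e' e' = 0, dot f f = 0 & dot f' f' = 0],
  dot e e' = 2, dot f f' = 2 & [/\ dot e f = 0, dot e f' = 0, dot e' f = 0 & dot e' f' = 0]].
Proof.
have [_ e0 e1 _] := Xpp_wedge hl hD; have [_ e0' e1' _] := thXpp_wedge hl hD.
have [_ ee] := J1_wedge hl hD.
split=> //; first by split; [exact: dot_e_plus | exact: dot_e_minus | exact: fpfp | exact: fmfm].
  exact: fpfm.
by split; rewrite !dotDr ?dotNr ?e0 ?e1 ?e0' ?e1' ?oppr0 addr0.
Qed.

Lemma a_spaceP X : X \in a_space D -> exists s r, X = s *: J1 D + r *: J2 D.
Proof.
rewrite /a_space span_cons span_seq1 => /memv_addP[_ /vlineP[s ->] [_ /vlineP[r ->] ->]].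
by exists s, r.
Qed.

Lemma a_space_eigen X : X \in a_space D -> [/\ X \in g,
  (exists s, X *m e = s *: e) /\ (exists s, X *m e' = s *: e') &
  (exists s, X *m f = s *: f) /\ (exists s, X *m f' = s *: f')].
Proof.
move=> hX; have [Xg _] := theta_J hD hX; have [s [r eX]] := a_spaceP hX.
rewrite eX in Xg *.
have [_ e0 e1 Je] := Xpp_wedge hl hD; have [_ e0' e1' Je'] := thXpp_wedge hl hD.
have v00 := dot_v0 hD; have bb := dot_b hl hD; have bv := b_v0 hD.
have J2e : J2 D *m e = 0 by rewrite (J2E hD) (dotC _ e) e0 (dotC _ e) e1 !scale0r subrr.
have J2e' : J2 D *m e' = 0 by rewrite (J2E hD) (dotC _ e') e0' (dotC _ e') e1' !scale0r subrr.
have J2b : J2 D *m b = v0.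
  by rewrite (J2E hD) bb dotC bv scale0r sub0r scaleN1r opprK.
have J1v := J1_v0 hD; have J1b := J1_b hD.
split=> //; split; rewrite mulmxDl -!scalemxAl.
- by exists s; rewrite Je J2e scaler0 addr0.
- by exists (- s); rewrite Je' J2e' scaler0 addr0 scalerN scaleNr.
- by exists r; rewrite !mulmxDr J1v J1b J2b !addr0 scaler0 add0r (addrC b).
- exists (- r); rewrite !mulmxBr J1v J1b J2b subr0 scaler0 add0r.
  by rewrite scaleNr -scalerN opprB.
Qed.

Lemma n_spaceP X : X \in n_space D -> exists X1 X2 X3 X4,
  [/\ X1 \in root_space D 1 1, X2 \in root_space D 1 (-1), X3 \in root_space D 1 0,
      X4 \in root_space D 0 1 & X = X1 + X2 + X3 + X4].
Proof.
move=> /memv_addP[Y /memv_addP[Z /memv_addP[X1 h1 [X2 h2 ->]] [X3 h3 ->]] [X4 h4 ->]].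
by exists X1, X2, X3, X4.
Qed.

Lemma n_space_root X p r : X \in root_space D p r ->
  (p, r) \in [:: (1, 1); (1, -1); (1, 0); (0, 1)] -> X \in n_space D.
Proof.
move=> hX; rewrite !inE => /or4P[] /eqP[pe re]; subst p r; rewrite /n_space.
- by rewrite -[X]addr0 memv_add ?mem0v // -[X]addr0 memv_add ?mem0v // -[X]addr0 memv_add ?mem0v.
- by rewrite -[X]addr0 memv_add ?mem0v // -[X]addr0 memv_add ?mem0v // -[X]add0r memv_add ?mem0v.
- by rewrite -[X]addr0 memv_add ?mem0v // -[X]add0r memv_add ?mem0v.
- by rewrite -[X]add0r memv_add ?mem0v.
Qed.

Lemma nbar_space_root X p r : X \in root_space D (- p) (- r) ->
  (p, r) \in [:: (1, 1); (1, -1); (1, 0); (0, 1)] -> X \in nbar_space D.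
Proof.
move=> hX pr; have hg : X \in g by move: hX; rewrite mem_root_space => /and3P[].
rewrite -(thetaK hD hg); apply: memv_img.
have := theta_root hD hX; rewrite !opprK => h.
exact: n_space_root h pr.
Qed.

Lemma nbar_spaceP X : X \in nbar_space D -> exists X1 X2 X3 X4,
  [/\ X1 \in root_space D (-1) (-1), X2 \in root_space D (-1) 1, X3 \in root_space D (-1) 0,
      X4 \in root_space D 0 (-1) & X = X1 + X2 + X3 + X4].
Proof.
move=> /memv_imgP[Y /n_spaceP[X1 [X2 [X3 [X4 [h1 h2 h3 h4 ->]]]]] ->].
exists (th X1), (th X2), (th X3), (th X4); split.
- exact: (theta_root hD h1).
- by have := theta_root hD h2; rewrite opprK.
- by have := theta_root hD h3; rewrite oppr0.
- by have := theta_root hD h4; rewrite oppr0.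
- by rewrite 3!linearD.
Qed.

Let v0E : v0 = 2^-1 *: (f + f').
Proof. by apply/matrixP => i j; rewrite !mxE; field. Qed.

Let l0 : (0 < l)%N. Proof. by lia. Qed.

Lemma closed_orbits_AN :
  \bigcup_(U in closed_orbits D (setprod (gA D) (gN D))) U = pts D (fun z => dot z e = 0).
Proof.
have [[ee e'e' ff f'f'] ee' ff' [ef ef' e'f e'f']] := frame_dots.
have [J1e _] := J1_wedge hl hD; have J2e := J2_fpfm hD.
have wsP X p r : weight_space e e' f f' p r X <-> X \in root_space D p r.
  rewrite /weight_space -J1e -J2e mem_root_space; split=> [[-> -> ->]|].
    by rewrite !eqxx.
  by case/and3P => ? /eqP ? /eqP ?.
apply: (weight_orbits ee e'e' ff f'f' ee' ff' ef ef' e'f e'f' l0 v0E).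
- by move=> X /a_space_eigen[? [? _] [? _]].
- by rewrite -J1e J1_a.
- by rewrite -J2e J2_a.
- move=> X /n_spaceP[X1 [X2 [X3 [X4 [h1 h2 h3 h4 ->]]]]].
  exists X1, X2, X3, X4; split; last exact: erefl.
  - exact: (wsP _ _ _).2 h1.
  - exact: (wsP _ _ _).2 h2.
  - exact: (wsP _ _ _).2 h3.
  - exact: (wsP _ _ _).2 h4.
- by move=> X p r /wsP h pr; exact: n_space_root h pr.
Qed.

Lemma closed_orbits_ANbar :
  \bigcup_(U in closed_orbits D (setprod (gA D) (gNbar D))) U = pts D (fun z => dot z e' = 0).
Proof.
have [[ee e'e' ff f'f'] ee' ff' [ef ef' e'f e'f']] := frame_dots.
have [J1e _] := J1_wedge hl hD; have J2e := J2_fpfm hD.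
have e'e : dot e' e = 2 by rewrite dotC.
have f'f : dot f' f = 2 by rewrite dotC.
have J1e' : 2^-1 *: wedge e' e = - J1 D by rewrite wedgeC scalerN -J1e.
have J2e' : 2^-1 *: wedge f' f = - J2 D by rewrite wedgeC scalerN -J2e.
have bN (X Y : M) : bracket (- X) Y = - bracket X Y.
  by rewrite /bracket mulNmx mulmxN opprD.
have wsP X p r : weight_space e' e f' f p r X <-> X \in root_space D (- p) (- r).
  rewrite /weight_space J1e' J2e' mem_root_space !bN !scaleNr; split=> [[-> <- <-]|].
    by rewrite !opprK !eqxx.
  by case/and3P => ? /eqP -> /eqP ->; rewrite !opprK.
apply: (weight_orbits e'e' ee f'f' ff e'e f'f e'f' e'f ef' ef l0).
- by rewrite addrC.
- by move=> X /a_space_eigen[? [_ ?] [_ ?]].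
- by rewrite J1e' memvN J1_a.
- by rewrite J2e' memvN J2_a.
- move=> X /nbar_spaceP[X1 [X2 [X3 [X4 [h1 h2 h3 h4 ->]]]]].
  exists X1, X2, X3, X4; split; last exact: erefl.
  - exact: (wsP _ _ _).2 h1.
  - by apply: (wsP _ _ _).2; rewrite opprK; exact: h2.
  - by apply: (wsP _ _ _).2; rewrite oppr0; exact: h3.
  - by apply: (wsP _ _ _).2; rewrite oppr0; exact: h4.
- by move=> X p r /wsP h pr; exact: nbar_space_root h pr.
Qed.

Lemma singularityE : singularity D = pts D (fun z => dot z e * dot z e' = 0).
Proof.
rewrite /singularity bigcup_setU closed_orbits_AN closed_orbits_ANbar.
apply/seteqP; split=> [_ [[z [zz h] <-]|[z [zz h] <-]]|_ [z [zz /eqP h] <-]].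
- by exists z => //; split=> //; rewrite h mul0r.
- by exists z => //; split=> //; rewrite h mulr0.
- by move: h; rewrite mulf_eq0 => /orP[/eqP h|/eqP h]; [left|right]; exists z.
Qed.

End Singularity.

(** * Escape from the singularity in coordinates *)

Section Reals.
Variable R : realFieldType.
Implicit Types c t x u y nu rho al be a s eps om ka : R.

(* Coordinates: v = (t1, x, t2, rho) and u = (u1, y, u2, nu) with squared norms
   t1^2 - x^2 + t2^2 - rho^2 = 1 and u1^2 - y^2 + u2^2 - nu^2 = 0. *)
Definition good_direction t1 x t2 rho u1 y u2 nu : Prop :=
  [/\ u1 ^+ 2 - y ^+ 2 + u2 ^+ 2 = nu ^+ 2, t1 * u1 - x * y + t2 * u2 = rho * nu,
      0 < t2 * u1 - t1 * u2 &
      forall s, 0 < s -> (t1 + s * u1) ^+ 2 != (x + s * y) ^+ 2].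

Lemma scaled_ge0 c x y : 0 < c -> c * x = y -> 0 <= y -> 0 <= x.
Proof. by move=> c0 <-; rewrite pmulr_rge0. Qed.

Lemma scaled_gt0 c x y : 0 < c -> c * x = y -> 0 < y -> 0 < x.
Proof. by move=> c0 <-; rewrite pmulr_rgt0. Qed.

Lemma no_root al a s : (al != 0 /\ 0 <= al * a) \/ (al = 0 /\ a != 0) ->
  0 < s -> al + s * a != 0.
Proof.
move=> [[al0 h] s0|[-> a0] s0]; last by rewrite add0r mulf_neq0 // gt_eqF.
apply/eqP => e; have : al * (al + s * a) = 0 by rewrite e mulr0.
have : 0 < al * al by rewrite lt_neqAle eq_sym mulf_neq0 // -expr2 sqr_ge0.
have : 0 <= s * (al * a) by rewrite mulr_ge0 // ltW.
lra.
Qed.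

Lemma sqr_neq t x : t + x != 0 -> t - x != 0 -> t ^+ 2 != x ^+ 2.
Proof. by move=> h h'; rewrite eqf_sqr negb_or -subr_eq0 h' -subr_eq0 opprK. Qed.

(** With u1 = y the factor t1 - x stays constant along the line, and only t1 + x + 2 s (t2 + eps
    rho) could vanish. *)
Lemma good_family t1 x t2 rho eps : eps ^+ 2 = 1 -> t1 - x != 0 ->
  (t1 + x != 0 /\ 0 <= (t1 + x) * (t2 + eps * rho)) \/ (t1 + x = 0 /\ t2 + eps * rho != 0) ->
  0 < t2 * (t2 + eps * rho) + t1 * (t1 - x) ->
  good_direction t1 x t2 rho (t2 + eps * rho) (t2 + eps * rho) (- (t1 - x)) (eps * (t1 - x)).
Proof.
move=> e1 be0 nr fut; split.
- by rewrite exprMn e1; ring.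
- by ring.
- by move: fut; lra.
- move=> s s0; apply: sqr_neq.
    have -> : t1 + s * (t2 + eps * rho) + (x + s * (t2 + eps * rho)) =
      (t1 + x) + s * (2 * (t2 + eps * rho)) by ring.
    apply: no_root => //; case: nr => [[h1 h2]|[h1 h2]]; [left|right]; split=> //.
      by rewrite mulrCA mulr_ge0.
    by rewrite mulf_neq0 // pnatr_eq0.
  by have -> : t1 + s * (t2 + eps * rho) - (x + s * (t2 + eps * rho)) = t1 - x by ring.
Qed.

Lemma good_direction_opp t1 x t2 rho u1 y u2 nu :
  good_direction t1 (- x) t2 rho u1 y u2 nu -> good_direction t1 x t2 rho u1 (- y) u2 nu.
Proof.
move=> [h1 h2 h3 h4]; split=> //.
- by rewrite sqrrN.
- by move: h2; rewrite mulrN mulNr.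
- move=> s /h4; rewrite (_ : x + s * - y = - (- x + s * y)) ?sqrrN //; ring.
Qed.

(** As t2^2 = 1 - m + rho^2, comparing m with 1 compares rho with |t2|, and this decides which signs
    t2 + eps rho can take. *)
Lemma good_direction_exists t1 x t2 rho : 0 <= rho ->
  t1 ^+ 2 - x ^+ 2 + t2 ^+ 2 = 1 + rho ^+ 2 ->
  ~ (0 < t1 ^+ 2 - x ^+ 2 < 1 /\ t1 * t2 < 0) ->
  exists u1 y u2 nu, good_direction t1 x t2 rho u1 y u2 nu.
Proof.
move=> rho0 nv nbh; pose m := (t1 + x) * (t1 - x).
have em : m = t1 ^+ 2 - x ^+ 2 by rewrite /m; ring.
have nv' : t2 ^+ 2 = 1 - m + rho ^+ 2 by rewrite em; lra.
have [m1|m1|m1] := ltrgtP m 1; last first.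
(* For m = 1, t2 is rho or -rho, and a direction with u1 = y = 0 leaves t1 and x unchanged. *)
- have t10 : t1 != 0.
    by apply/eqP => t10; move: em; rewrite m1 t10 expr0n /= => h; have := sqr_ge0 x; lra.
  have ap : t1 + x != 0 by apply/eqP => h; move: m1; rewrite /m h mul0r; lra.
  have be : t1 - x != 0 by apply/eqP => h; move: m1; rewrite /m h mulr0; lra.
  have tt : 0 < t1 * t1 by rewrite lt_neqAle eq_sym mulf_neq0 // -expr2 sqr_ge0.
  have [nu hnu] : exists nu, nu ^+ 2 = t1 ^+ 2 /\ - (t2 * t1) = rho * nu.
    have : t2 ^+ 2 == rho ^+ 2 by apply/eqP; lra.
    rewrite eqf_sqr => /orP[] /eqP ->; [exists (- t1)|exists t1]; rewrite ?sqrrN; split=> //; ring.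
  exists 0, 0, (- t1), nu; case: hnu => h1 h2; split.
  + by rewrite h1; ring.
  + by rewrite -h2; ring.
  + by lra.
  + by move=> s _; rewrite !mulr0 !addr0; exact: sqr_neq.
(* For m > 1, rho exceeds |t2|, so eps can be chosen to give t2 + eps rho the sign of t1 + x. *)
- have ap : t1 + x != 0 by apply/eqP => h; move: m1; rewrite /m h mul0r; lra.
  have be : t1 - x != 0 by apply/eqP => h; move: m1; rewrite /m h mulr0; lra.
  have rt : t2 ^+ 2 < rho ^+ 2 by lra.
  have r1 : 0 < rho + t2 by nra.
  have r2 : 0 < rho - t2 by nra.
  have b2 : 0 <= (t1 - x) ^+ 2 by exact: sqr_ge0.
  have tb : t1 * (t1 - x) = 2^-1 * (m + (t1 - x) ^+ 2) by rewrite /m; field.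
  have [a0|a0] := ltP 0 (t1 + x).
    exists (t2 + 1 * rho), (t2 + 1 * rho), (- (t1 - x)), (1 * (t1 - x)).
    apply: good_family => //; first by rewrite expr1n.
      by left; split=> //; apply: mulr_ge0; lra.
    by rewrite tb; nra.
  exists (t2 + -1 * rho), (t2 + -1 * rho), (- (t1 - x)), (-1 * (t1 - x)).
  apply: good_family => //; first by rewrite sqrrN expr1n.
    by left; split=> //; rewrite -mulrNN; apply: mulr_ge0; lra.
  by rewrite tb; nra.
(* For m < 1, eps is the sign of t2, and t2 + eps rho has that sign too. [case1] asks that t1 + x
   vanish or have the sign of t2; [case2] is its mirror image under x |-> -x. *)
- have rt : rho ^+ 2 < t2 ^+ 2 by lra.
  have t20 : t2 != 0 by apply/eqP => h; move: rt; rewrite h expr0n /=; have := sqr_ge0 rho; lra.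
  have [eps [e1 et e0]] : exists eps, [/\ eps ^+ 2 = 1, 0 < t2 * eps & t2 * eps = `|t2|].
    exists (Num.sg t2); split; rewrite ?sqr_sg ?t20 // mulrC -normrEsg // normr_gt0 //.
  have hr : 0 <= t2 * (eps * rho) by rewrite mulrA mulr_ge0 // ltW.
  have sgn : 0 < t2 * (t2 + eps * rho) by nra.
  have ne0 : t2 + eps * rho != 0.
    by apply/eqP => h; move: sgn; rewrite h mulr0 ltxx.
  have key be : 0 <= be ^+ 2 -> 0 < t2 * (t2 + eps * rho) + 2^-1 * (m + be ^+ 2) by nra.
  have nrt al : 0 < al * t2 -> 0 <= al * (t2 + eps * rho).
    move=> h; have t2t2 : 0 < t2 ^+ 2 by rewrite lt_neqAle eq_sym expf_neq0 //= sqr_ge0.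
    apply: (@scaled_ge0 _ _ ((al * t2) * (t2 * (t2 + eps * rho))) t2t2); first by ring.
    by rewrite mulr_ge0 // ltW.
  have case1 x' : (t1 + x') * (t1 - x') = m -> t1 - x' != 0 -> t1 + x' = 0 \/ 0 < (t1 + x') * t2 ->
      exists u1 y u2 nu, good_direction t1 x' t2 rho u1 y u2 nu.
    move=> em' be0 hal.
    exists (t2 + eps * rho), (t2 + eps * rho), (- (t1 - x')), (eps * (t1 - x')).
    apply: good_family => //.
      case: hal => h; [by right | left; split; last exact: nrt].
      by apply/eqP => h0; move: h; rewrite h0 mul0r ltxx.
    have -> : t1 * (t1 - x') = 2^-1 * (m + (t1 - x') ^+ 2) by rewrite -em'; field.
    by apply: key; exact: sqr_ge0.
  have case2 : t1 + x != 0 -> t1 - x = 0 \/ 0 < (t1 - x) * t2 ->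
      exists u1 y u2 nu, good_direction t1 x t2 rho u1 y u2 nu.
    move=> h1 h2; have [|||u1 [y [u2 [nu h]]]] := case1 (- x).
    - by rewrite opprK mulrC.
    - by rewrite opprK.
    - by [].
    by exists u1, (- y), u2, nu; exact: good_direction_opp.
  have [a0|a0] := eqVneq (t1 + x) 0; have [b0|b0] := eqVneq (t1 - x) 0.
  + have t10 : t1 = 0 by lra.
    have x0 : x = 0 by lra.
    exists eps, 0, rho, t2; rewrite t10 x0; split.
    * by rewrite e1 nv' /m a0 mul0r; ring.
    * by ring.
    * by rewrite mul0r subr0.
    * move=> s s0; rewrite !mulr0 !add0r expr0n /= expf_neq0 //.
      apply: mulf_neq0; first by rewrite gt_eqF.
      by apply/eqP => h; move: et; rewrite h mulr0 ltxx.
  + by apply: case1 => //; left.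
  + by apply: case2 => //; left.
  + have [h|h] := ltP 0 ((t1 + x) * t2); first by apply: case1 => //; right.
    have [h'|h'] := ltP 0 ((t1 - x) * t2); first by apply: case2 => //; right.
    (* Both t1 + x and t1 - x now have the sign opposite to t2, which is the excluded region. *)
    exfalso; apply: nbh; rewrite -em m1 andbT.
    have h1 : (t1 + x) * t2 != 0 by rewrite mulf_neq0.
    have h2 : (t1 - x) * t2 != 0 by rewrite mulf_neq0.
    have h3 : (t1 + x) * t2 < 0 by rewrite lt_neqAle h1.
    have h4 : (t1 - x) * t2 < 0 by rewrite lt_neqAle h2.
    split; last by lra.
    have t2t2 : 0 < t2 ^+ 2 by rewrite lt_neqAle eq_sym expf_neq0 //= sqr_ge0.
    apply: (@scaled_gt0 _ _ (((t1 + x) * t2) * ((t1 - x) * t2)) t2t2); first by rewrite /m; ring.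
    by rewrite nmulr_rgt0.
Qed.

(** If neither al + s a nor be + s b has a positive root, then al, be, a, b share one weak sign.
    Multiplying the future condition by t1 t2 < 0 then gives t2 u2 > 0 and t2^2 a b <= 2 t2 u2 K,
    with K = t1 u1 - x y. This contradicts the Cauchy-Schwarz bound on ka. *)
Lemma future_hits t1 x t2 u1 y u2 rho om ka :
  0 < t1 ^+ 2 - x ^+ 2 -> t1 ^+ 2 - x ^+ 2 < 1 -> t1 * t2 < 0 ->
  t1 ^+ 2 - x ^+ 2 + t2 ^+ 2 = 1 + rho -> u1 ^+ 2 - y ^+ 2 + u2 ^+ 2 = om ->
  t1 * u1 - x * y + t2 * u2 = ka -> ka ^+ 2 <= rho * om ->
  0 < t2 * u1 - t1 * u2 ->
  exists2 s, 0 < s & (t1 + s * u1) ^+ 2 = (x + s * y) ^+ 2.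
Proof.
move=> m0 m1 tt nv nu nuv cs fut.
pose al := t1 + x; pose be := t1 - x; pose a := u1 + y; pose b := u1 - y.
have mE : al * be = t1 ^+ 2 - x ^+ 2 by rewrite /al /be; ring.
have hit s : (al + s * a) * (be + s * b) = 0 -> (t1 + s * u1) ^+ 2 = (x + s * y) ^+ 2.
  move=> h; apply/eqP; rewrite -subr_eq0; apply/eqP; rewrite -h /al /be /a /b; ring.
have root al' a' : al' * a' < 0 -> 0 < - al' / a' /\ al' + (- al' / a') * a' = 0.
  move=> h; have a0 : a' != 0 by apply/eqP => h0; move: h; rewrite h0 mulr0 ltxx.
  split; last by field.
  have aa : 0 < a' ^+ 2 by rewrite lt_neqAle eq_sym expf_neq0 //= sqr_ge0.
  rewrite (_ : - al' / a' = - (al' * a') / a' ^+ 2); last by field.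
  by rewrite divr_gt0 // oppr_gt0.
have [h|aa] := ltP (al * a) 0.
  by have [s0 e] := root _ _ h; exists (- al / a) => //; apply: hit; rewrite e mul0r.
have [h|bb] := ltP (be * b) 0.
  by have [s0 e] := root _ _ h; exists (- be / b) => //; apply: hit; rewrite e mulr0.
exfalso.
have m0' : 0 < al * be by rewrite mE.
have ab : 0 <= al * b.
  apply: (@scaled_ge0 _ _ (al ^+ 2 * (be * b)) m0'); first by ring.
  by rewrite mulr_ge0 // sqr_ge0.
have ba : 0 <= be * a.
  apply: (@scaled_ge0 _ _ (be ^+ 2 * (al * a)) m0'); first by ring.
  by rewrite mulr_ge0 // sqr_ge0.
have hab : 0 <= a * b.
  apply: (@scaled_ge0 _ _ ((al * a) * (be * b)) m0'); first by ring.
  by rewrite mulr_ge0.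
pose K := 2^-1 * (al * b + be * a).
have K0 : 0 <= K by rewrite /K; lra.
have KE : t1 * u1 - x * y = K by rewrite /K /al /be /a /b; field.
have abE : u1 ^+ 2 - y ^+ 2 = a * b by rewrite /a /b; ring.
have tu : 0 <= t1 * u1.
  have -> : t1 * u1 = 4^-1 * (al * a + al * b + be * a + be * b).
    by rewrite /al /be /a /b; field.
  by lra.
have h1 : t2 ^+ 2 * (t1 * u1) < t1 ^+ 2 * (t2 * u2).
  have : t1 * t2 * (t2 * u1 - t1 * u2) < 0 by rewrite nmulr_rlt0.
  have -> : t1 * t2 * (t2 * u1 - t1 * u2) = t2 ^+ 2 * (t1 * u1) - t1 ^+ 2 * (t2 * u2) by ring.
  by rewrite subr_lt0.
have t10 : t1 != 0 by apply/eqP => h; move: tt; rewrite h mul0r ltxx.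
have t1t1 : 0 < t1 ^+ 2 by rewrite lt_neqAle eq_sym expf_neq0 //= sqr_ge0.
have tu2 : 0 < t2 * u2.
  rewrite -(pmulr_rgt0 _ t1t1); apply: le_lt_trans h1; by rewrite mulr_ge0 // sqr_ge0.
have key : t1 ^+ 2 * (t2 ^+ 2 * (a * b)) <= t1 ^+ 2 * (2 * (t2 * u2) * K).
  apply: (@le_trans _ _ (2 * (t2 ^+ 2 * (t1 * u1)) * K)).
    rewrite -subr_ge0.
    have -> : 2 * (t2 ^+ 2 * (t1 * u1)) * K - t1 ^+ 2 * (t2 ^+ 2 * (a * b)) =
      t2 ^+ 2 * (4^-1 * ((al * b) ^+ 2 + (be * a) ^+ 2 + al * be * a ^+ 2 + al * be * b ^+ 2)).
      by rewrite /K /al /be /a /b; field.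
    have [h2 h3] : 0 <= al * be * a ^+ 2 /\ 0 <= al * be * b ^+ 2.
      by split; apply: mulr_ge0; rewrite ?sqr_ge0 // ltW.
    apply: mulr_ge0; first exact: sqr_ge0.
    have := sqr_ge0 (al * b); have := sqr_ge0 (be * a); lra.
  have -> : t1 ^+ 2 * (2 * (t2 * u2) * K) = 2 * (t1 ^+ 2 * (t2 * u2)) * K by ring.
  apply: ler_wpM2r; first exact: K0.
  by apply: ler_wpM2l; [exact: ler0n | exact: ltW h1].
rewrite ler_pM2l // in key.
have u20 : u2 != 0 by apply/eqP => h; move: tu2; rewrite h mulr0 ltxx.
have u2u2 : 0 < u2 ^+ 2 by rewrite lt_neqAle eq_sym expf_neq0 //= sqr_ge0.
have rhoE : rho = t2 ^+ 2 - (1 - al * be) by rewrite mE; lra.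
have omE : om = u2 ^+ 2 + a * b by rewrite -abE; lra.
have kaE : ka = t2 * u2 + K by rewrite -KE; lra.
(* The bound reads (t2 u2 + K)^2 <= (t2^2 - (1 - m)) (u2^2 + a b) with m = al be; after [key] only
   this positive product remains to be contradicted. *)
have pos : 0 < (1 - al * be) * (u2 ^+ 2 + a * b).
  by rewrite mulr_gt0 // ?subr_gt0 ?mE //; lra.
have KK : 0 <= K ^+ 2 by exact: sqr_ge0.
move: cs; rewrite rhoE omE kaE.
nra.
Qed.

End Reals.

(** * The black hole *)

Section BlackHole.
Variables (R : realType) (l : nat) (D : ads_data R l).
Hypotheses (hl : (3 <= l)%N) (hD : ads_axioms D).
Local Notation M := 'M[R]_l.+1.
Local Notation V := 'cV[R]_l.+1.
Local Notation G := (SO0 R l).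
Local Notation v0 := (base_vec D).
Local Notation b := (J2 D *m v0).
Local Notation tau := (tau D).
Local Notation xi := (xi D).
Implicit Types (u v w x y z : V) (g r : M).

Let v00 := dot_v0 hD.
Let tt := dot_tau hl hD.
Let v0t : dot v0 tau = 0. Proof. by rewrite dotC (tau_v0 hl hD). Qed.
Let xx : dot xi xi = -1. Proof. by case: (xi_dots hl hD). Qed.
Let xt : dot xi tau = 0. Proof. by case: (xi_dots hl hD). Qed.
Let xv : dot xi v0 = 0. Proof. by case: (xi_dots hl hD). Qed.
Let l0 : (0 < l)%N. Proof. by lia. Qed.

Definition sing_vec v : Prop := dot v tau ^+ 2 = dot v xi ^+ 2.

Definition bh_vec v : Prop :=
  0 < dot v tau ^+ 2 - dot v xi ^+ 2 < 1 /\ dot v tau * dot v v0 < 0.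

Lemma singularity_vec : singularity D = pts D sing_vec.
Proof.
rewrite singularityE //; apply/seteqP.
have e z : dot z (e_plus D) * dot z (e_minus D) = dot z tau ^+ 2 - dot z xi ^+ 2.
  by rewrite (xiE hl hD) tauE !dotE; field.
split=> _ [z [zz h] <-]; exists z => //; split=> //; move: h; rewrite /sing_vec e.
  by move/eqP; rewrite subr_eq0 => /eqP.
by move=> ->; rewrite subrr.
Qed.

Lemma space_neg y : dot y v0 = 0 -> dot y tau = 0 -> y != 0 -> dot y y < 0.
Proof. by move=> h1 h2; apply: (neg_definite l0 v00 tt v0t). Qed.

Lemma space_le0 y : dot y v0 = 0 -> dot y tau = 0 -> dot y y <= 0.
Proof.
move=> h1 h2; have [->|y0] := eqVneq y 0; first by rewrite dot0l.
exact/ltW/space_neg.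
Qed.

(** Semidefiniteness applied to <z, z> y - <y, z> z. *)
Lemma space_cauchy y z : dot y v0 = 0 -> dot y tau = 0 -> dot z v0 = 0 -> dot z tau = 0 ->
  dot y z ^+ 2 <= dot y y * dot z z.
Proof.
move=> h1 h2 h3 h4; have [->|z0] := eqVneq z 0; first by rewrite !dot0r expr0n mulr0.
have zz := space_neg h3 h4 z0.
have := @space_le0 (dot z z *: y - dot y z *: z).
rewrite !dotE h1 h2 h3 h4 !mulr0 subrr (dotC z y) => /(_ erefl erefl) h.
rewrite -subr_ge0 -(nmulr_rle0 _ zz); move: h.
by rewrite (_ : _ + _ = dot z z * (dot y y * dot z z - dot y z ^+ 2)) //; ring.
Qed.

Lemma frame_split v : exists y, [/\ v = dot v tau *: tau - dot v xi *: xi + dot v v0 *: v0 + y,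
  dot y tau = 0, dot y xi = 0 & dot y v0 = 0].
Proof.
exists (v - dot v tau *: tau + dot v xi *: xi - dot v v0 *: v0).
rewrite !dotE tt v00 xx xt xv v0t (dotC tau v0) v0t (dotC tau xi) xt (dotC v0 xi) xv.
by split; [apply/matrixP => i j; rewrite !mxE; ring | ring..].
Qed.

Lemma frame_dot (p q r p' q' r' : R) y y' :
  dot y tau = 0 -> dot y xi = 0 -> dot y v0 = 0 ->
  dot y' tau = 0 -> dot y' xi = 0 -> dot y' v0 = 0 ->
  dot (p *: tau - q *: xi + r *: v0 + y) (p' *: tau - q' *: xi + r' *: v0 + y') =
  p * p' - q * q' + r * r' + dot y y'.
Proof.
move=> h1 h2 h3 h4 h5 h6.
rewrite !dotE tt v00 xx xt xv v0t (dotC tau v0) v0t (dotC tau xi) xt (dotC v0 xi) xv.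
by rewrite (dotC tau y') (dotC xi y') (dotC v0 y') h1 h2 h3 h4 h5 h6; ring.
Qed.

Lemma frame_coord (p q r : R) y : dot y tau = 0 -> dot y xi = 0 -> dot y v0 = 0 ->
  let v := p *: tau - q *: xi + r *: v0 + y in
  [/\ dot v tau = p, dot v xi = q & dot v v0 = r].
Proof.
move=> h1 h2 h3 v; rewrite /v !dotE tt v00 xx xt xv v0t (dotC tau v0) v0t.
by rewrite (dotC tau xi) xt (dotC v0 xi) xv h1 h2 h3; split; ring.
Qed.

(** S tau - T v0 is the value at v of the rotation field of the plane (v0, tau); pairing u with it
    orients time at v without choosing a representative of the coset. *)
Definition future v u : Prop :=
  [/\ dot u u = 0, dot u v = 0 & 0 < dot v v0 * dot u tau - dot v tau * dot u v0].

(* Future light-like directions stay future along SO0: the pairing with the rotation field of the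
   plane (v0, tau) cannot vanish on a nonzero light-like vector orthogonal to v. *)
Lemma future_SO0 r y : G r -> dot y v0 = 0 -> dot y tau = 0 -> dot y y = -1 ->
  future (r *m v0) (r *m (tau + y)).
Proof.
move=> Sr X0p_vec yt yy; pose u := tau + y.
have uu : dot u u = 0 by rewrite /u !dotE tt yt yy (dotC tau y) yt; ring.
have uv : dot u v0 = 0 by rewrite /u !dotE X0p_vec (dotC tau v0) v0t; ring.
have u0 : u != 0.
  by apply/eqP => h; have : dot u tau = 0 by [rewrite h dot0l]; rewrite /u !dotE tt yt; lra.
split; rewrite ?SO0_dot //.
pose F (s : M) := dot (s *m v0) v0 * dot (s *m u) tau - dot (s *m v0) tau * dot (s *m u) v0.
rewrite -/(F r).
have Fnz s : G s -> F s != 0.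
  move=> Ss; apply/eqP => Fs.
  pose p1 := dot (s *m v0) tau; pose p2 := dot (s *m v0) v0.
  pose u1 := dot (s *m u) tau; pose u2 := dot (s *m u) v0.
  have pp : 0 < p1 ^+ 2 + p2 ^+ 2.
    have [w [ew wt wx wv]] := frame_split (s *m v0).
    have : dot (s *m v0) (s *m v0) = 1 by rewrite SO0_dot.
    rewrite {1 2}ew frame_dot // -/p1 -/p2.
    have := space_le0 wv wt; have := sqr_ge0 (dot (s *m v0) xi); have := sqr_ge0 p1.
    have := sqr_ge0 p2; rewrite !expr2; lra.
  (* If F vanishes, the coordinates of s u along tau and v0 are la times those of s v0. The
     difference s u - la (s v0) is then in the negative definite complement, yet its square norm is
     la^2. *)
  pose la := (u1 * p1 + u2 * p2) / (p1 ^+ 2 + p2 ^+ 2).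
  have pn : p1 ^+ 2 + p2 ^+ 2 != 0 by rewrite gt_eqF.
  have cr : p2 * u1 = p1 * u2 by move: Fs; rewrite /F -/p1 -/p2 -/u1 -/u2; lra.
  have e1 : u1 = la * p1.
    apply: (mulIf pn); rewrite /la mulrAC divfK //.
    rewrite (_ : u1 * (p1 ^+ 2 + p2 ^+ 2) = u1 * p1 ^+ 2 + (p2 * u1) * p2); last by ring.
    by rewrite cr; ring.
  have e2 : u2 = la * p2.
    apply: (mulIf pn); rewrite /la mulrAC divfK //.
    rewrite (_ : u2 * (p1 ^+ 2 + p2 ^+ 2) = (p1 * u2) * p1 + u2 * p2 ^+ 2); last by ring.
    by rewrite -cr; ring.
  pose w := s *m u - la *: (s *m v0).
  have wt : dot w tau = 0 by rewrite /w !dotE -/u1 -/p1 e1; ring.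
  have wv : dot w v0 = 0 by rewrite /w !dotE -/u2 -/p2 e2; ring.
  have ww : dot w w = la ^+ 2.
    by rewrite /w !dotE !SO0_dot // uu v00 (dotC v0 u) uv; ring.
  have w0 : w = 0.
    apply/eqP; apply: contraT => w0; have := space_neg wv wt w0.
    by rewrite ww ltNge sqr_ge0.
  have la0 : la = 0.
    by apply/eqP; rewrite -sqrf_eq0 -ww w0 dot0l.
  have : s *m u = 0 by move: w0; rewrite /w la0 scale0r subr0.
  move=> /(congr1 (mulmx (invmx s))); rewrite mulKmx ?SO0_unit // mulmx0 => h.
  by rewrite h eqxx in u0.
have F1 : F 1%:M = 1.
  by rewrite /F !mul1mx v00 v0t uv /u !dotE tt yt; ring.
have cF : continuous F.
  move=> s; have FF := nbhs_filter s.
  have c1 z a : dot (t *m z) a @[t --> s] --> dot (s *m z) a.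
    by apply: cvg_dot (cvg_cst _); apply: cvg_mulmx cvg_id (cvg_cst _).
  by apply: cvgB; apply: cvgM; exact: c1.
(* The values of F form an interval containing F(1) = 1 and avoiding 0. *)
have itv : is_interval (F @` G).
  apply/connected_intervalP; apply: connected_continuous_connected; first exact: SO0_connected.
  exact: continuous_subspaceT.
rewrite ltNge; apply/negP => Fr.
have [|||s Ss Fs] := itv (F r) (F 1%:M) _ _ 0.
- by exists r.
- by exists 1%:M => //; exact: SO0_1.
- by rewrite Fr F1 ler01.
by have := Fnz s Ss; rewrite Fs eqxx.
Qed.

(** The factor k is the product of r^(-1) u with tau. It is nonzero because a null vector of the
    negative definite complement is 0, and positive because u and r (tau + y) are both future. *)
Lemma futureP r u : G r -> future (r *m v0) u ->
  exists2 k, 0 < k & exists2 y, u = k *: (r *m (tau + y)) &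
    [/\ dot y v0 = 0, dot y tau = 0 & dot y y = -1].
Proof.
move=> Sr [uu uv fut]; pose u' := invmx r *m u.
have eu : u = r *m u' by rewrite mulKVmx // SO0_unit.
have u'u' : dot u' u' = 0 by rewrite -(SO0_dot _ _ Sr) -eu.
have u'v : dot u' v0 = 0 by rewrite -(SO0_dot _ _ Sr) -eu.
pose k := dot u' tau.
have k0 : k != 0.
  apply/eqP => k0; have u'0 : u' = 0.
    by apply/eqP; apply: contraT => h; have := space_neg u'v k0 h; rewrite u'u' ltxx.
  by move: fut; rewrite eu u'0 mulmx0 !dot0l !mulr0 subrr ltxx.
pose y := k^-1 *: u' - tau.
have X0p_vec : dot y v0 = 0 by rewrite /y !dotE u'v (dotC tau v0) v0t; ring.
have yt : dot y tau = 0 by rewrite /y !dotE tt -/k mulVf // subrr.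
have yy : dot y y = -1.
  by rewrite /y !dotE u'u' tt (dotC tau u') -/k; field.
have eu' : u = k *: (r *m (tau + y)).
  by rewrite eu /y addrC subrK -scalemxAr scalerA mulfV // scale1r.
exists k; last by exists y.
have [_ _ f1] := future_SO0 Sr X0p_vec yt yy.
move: fut; rewrite eu' !dotE => fut.
have : 0 < k * (dot (r *m v0) v0 * dot (r *m (tau + y)) tau -
   dot (r *m v0) tau * dot (r *m (tau + y)) v0) by move: fut; lra.
by rewrite pmulr_lgt0.
Qed.

Lemma bh_hits v u : dot v v = 1 -> bh_vec v -> future v u ->
  exists2 s, 0 < s & sing_vec (v + s *: u).
Proof.
move=> vv [/andP[m0 m1] tv] [uu uv fut].
have [y [ev yt yx X0p_vec]] := frame_split v; have [z [eu zt zx zv]] := frame_split u.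
have nv := vv; rewrite {1 2}ev frame_dot // in nv.
have nu := uu; rewrite {1 2}eu frame_dot // in nu.
have nuv := uv; rewrite dotC {1}ev {1}eu frame_dot // in nuv.
have cs := space_cauchy X0p_vec yt zv zt.
have [|||||s s0 hs] := @future_hits R (dot v tau) (dot v xi) (dot v v0) (dot u tau) (dot u xi)
   (dot u v0) (- dot y y) (- dot z z) (- dot y z) m0 m1 tv.
- by rewrite !expr2; lra.
- by rewrite !expr2; lra.
- by lra.
- by rewrite sqrrN mulrNN.
- exact: fut.
by exists s => //; rewrite /sing_vec !dotE.
Qed.

(** The direction is sought in the span of tau, xi, v0 and one unit space-like vector c along the
    rest of v, which reduces the problem to four real coordinates. *)
Lemma escape_exists v : dot v v = 1 -> ~ bh_vec v ->
  exists2 u, future v u & forall s, 0 < s -> ~ sing_vec (v + s *: u).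
Proof.
move=> vv nb; have [y [ev yt yx X0p_vec]] := frame_split v.
have bt : dot b tau = 0 by rewrite dotC (tau_b hl hD).
have bx : dot b xi = 0 by rewrite dotC; case: (xi_dots hl hD).
pose rho := Num.sqrt (- dot y y).
have rho0 : 0 <= rho by exact: sqrtr_ge0.
have rr : rho ^+ 2 = - dot y y by rewrite sqr_sqrtr // oppr_ge0 space_le0.
have [c [ec ct cx cv cc]] : exists c, [/\ y = rho *: c, dot c tau = 0, dot c xi = 0,
    dot c v0 = 0 & dot c c = -1].
  have [y0|y0] := eqVneq y 0.
    (* When nothing is left of v, c may be any unit space-like vector orthogonal to tau, xi and
       v0. *)
    exists b; rewrite bt bx (b_v0 hD) (dot_b hl hD); split=> //.
    by rewrite /rho y0 dot0l oppr0 sqrtr0 scale0r.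
  have rn : rho != 0.
    by rewrite -sqrf_eq0 rr oppr_eq0 lt_eqF // space_neg.
  exists (rho^-1 *: y); rewrite !dotE yt yx X0p_vec !mulr0 scalerA mulfV // scale1r; split=> //.
  by rewrite mulrA -expr2 exprVn rr invrN mulNr mulVf // lt_eqF // space_neg.
have nv := vv; rewrite {1 2}ev frame_dot // in nv.
have [|u1 [x [u2 [nu [h1 h2 h3 h4]]]]] := good_direction_exists rho0 _ nb.
  by rewrite rr !expr2; lra.
have nc (k : R) : [/\ dot (k *: c) tau = 0, dot (k *: c) xi = 0 & dot (k *: c) v0 = 0].
  by rewrite !dotZl ct cx cv mulr0.
have [c1 c2 c3] := nc nu; have [r1 r2 r3] := nc rho.
have [ut ux uv] := frame_coord u1 x u2 c1 c2 c3.
exists (u1 *: tau - x *: xi + u2 *: v0 + nu *: c).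
  split.
  - rewrite frame_dot // !dotE cc; move: h1; rewrite !expr2; lra.
  - rewrite [in dot _ v]ev ec frame_dot // !dotE cc; lra.
  - by rewrite ut uv; lra.
move=> s s0; rewrite /sing_vec dotDl dotDl [dot (_ *: _) tau]dotZl [dot (s *: _) xi]dotZl ut ux.
by apply/eqP; exact: h4.
Qed.

(** E is [wedge u v0] with u null and orthogonal to v0, so E u = 0 and the exponential series stops
    at first order on v0. *)
Lemma geodesic r (w : 'rV[R]_l.-1) s : G r -> unit_sphere w ->
  pt D (r *m expmx (s *: direction D w)) = fib D (r *m v0 + s *: (r *m (direction D w *m v0))) /\
  dot (r *m v0 + s *: (r *m (direction D w *m v0)))
      (r *m v0 + s *: (r *m (direction D w *m v0))) = 1.
Proof.
move=> Sr hw; set E := direction D w; pose u := E *m v0.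
have [y eu [X0p_vec yt yy]] : exists2 y, u = tau + y &
    [/\ dot y v0 = 0, dot y tau = 0 & dot y y = -1].
  by apply/(directionP hl hD); exists w.
have uu : dot u u = 0 by rewrite eu !dotE tt yt yy (dotC tau y) yt; ring.
have uv : dot u v0 = 0 by rewrite eu !dotE X0p_vec (dotC tau v0) v0t; ring.
have EE : E = wedge u v0 by exact: direction_wedge.
have Eg : E \in so R l by rewrite EE wedge_so.
have Eu : E *m u = 0 by rewrite EE wedgeE (dotC v0 u) uv uu !scale0r subrr.
have SE : G (expmx (s *: E)) by apply: expmx_SO0; rewrite memvZ.
have ev : expmx (s *: E) *m v0 = v0 + s *: u.
  have E2 : (s *: E) *m (s *: u) = 0 by rewrite -scalemxAl -scalemxAr Eu !scaler0.
  have E1 : (s *: E) *m v0 = s *: u by rewrite -scalemxAl.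
  by rewrite expmx_nil3 E1 E2 ?mulmx0 // scaler0 addr0.
split.
  by rewrite (pt_fib D (SO0M Sr SE)) -mulmxA ev mulmxDr -scalemxAr.
by rewrite scalemxAr -mulmxDr -/u SO0_dot // !dotE v00 uu uv (dotC v0 u) uv; ring.
Qed.

Lemma escapesE r (w : 'rV[R]_l.-1) : G r -> unit_sphere w ->
  escapes D r w <-> forall s, 0 < s -> ~ sing_vec (r *m v0 + s *: (r *m (direction D w *m v0))).
Proof.
move=> Sr hw; have ptsE' := @ptsE _ _ D tau v00 tt v0t.
split=> h s s0; have := h s s0; have [-> nn] := geodesic s Sr hw;
  by rewrite singularity_vec => H hs; apply: H; apply/(ptsE' _ _ nn).
Qed.

Lemma BHE : BH D = pts D bh_vec.
Proof.
apply/seteqP; split=> [_ [r [Sr h] <-]|_ [v [vv hv] <-]].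
  rewrite pt_fib //; have vv : dot (r *m v0) (r *m v0) = 1 by rewrite SO0_dot.
  exists (r *m v0) => //; split=> //; apply: contrapT => nb.
  have [u fu hu] := escape_exists vv nb.
  have [k k0 [y ey hy]] := futureP Sr fu.
  have [w hw ew] : exists2 w, unit_sphere w & direction D w *m v0 = tau + y.
    by apply/(directionP hl hD); exists y.
  apply: (h w hw); apply/(escapesE Sr hw) => s s0; rewrite ew.
  (* The escaping vector u is k times the direction of parameter w, hence the change of
     parameter. *)
  have := hu (s / k); rewrite ey scalerA divfK ?gt_eqF //; apply.
  exact: divr_gt0.
have [r Sr rv] := SO0_transitive v00 tt v0t vv.
exists r; last by rewrite pt_fib // rv.
split=> // w hw /(escapesE Sr hw) esc.
have [y ey [X0p_vec yt yy]] : exists2 y, direction D w *m v0 = tau + y &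
    [/\ dot y v0 = 0, dot y tau = 0 & dot y y = -1].
  by apply/(directionP hl hD); exists w.
have fut := future_SO0 Sr X0p_vec yt yy; rewrite rv in fut.
have [s s0 hs] := bh_hits vv hv fut.
by apply: (esc s s0); rewrite rv ey.
Qed.

End BlackHole.

(** * Inclusion and sweeping *)

Lemma comm_invmx (R : comUnitRingType) n (g J : 'M[R]_n) : g \in unitmx ->
  g *m J = J *m g -> invmx g *m J = J *m invmx g.
Proof.
move=> u gJ; rewrite -[RHS](mulKmx u) (mulmxA g) gJ -(mulmxA J) mulmxV //.
by rewrite mulmx1.
Qed.

(** * Isometries commuting with J1 *)

Section Symmetries.
Variables (R : realType) (l : nat) (D : ads_data R l).
Hypotheses (hl : (3 <= l)%N) (hD : ads_axioms D).
Local Notation M := 'M[R]_l.+1.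
Local Notation V := 'cV[R]_l.+1.
Local Notation G := (SO0 R l).
Local Notation v0 := (base_vec D).
Implicit Types (v w : V) (g r : M).

Let v00 := dot_v0 hD.
Let tt := dot_tau hl hD.
Let v0t : dot v0 (tau D) = 0. Proof. by rewrite dotC (tau_v0 hl hD). Qed.

Lemma sing_vecE v : sing_vec D v <-> dot (J1 D *m v) (J1 D *m v) = 0.
Proof.
have [J1e ee] := J1_wedge hl hD.
have -> : dot (J1 D *m v) (J1 D *m v) = dot v (xi D) ^+ 2 - dot v (tau D) ^+ 2.
  rewrite {1 2}J1e -scalemxAl wedgeE (xiE hl hD) tauE !dotE (dotC (e_minus D) (e_plus D)) ee.
  by rewrite (dot_e_plus hl hD) (dot_e_minus hl hD) (dotC (e_minus D)) (dotC (e_plus D)); field.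
rewrite /sing_vec; split=> [->|/eqP]; first by rewrite subrr.
by rewrite subr_eq0 => /eqP.
Qed.

Variable g : M.
Hypotheses (Sg : G g) (gJ : g *m J1 D = J1 D *m g).

Lemma sing_vec_act v : sing_vec D (g *m v) <-> sing_vec D v.
Proof. by rewrite !sing_vecE mulmxA -gJ -mulmxA SO0_dot. Qed.

(** The condition T S < 0 is not visibly invariant. But g maps the geodesics from [r] to those from
    [g r] with the same w, and it preserves the singularity, so no direction escapes from the image
    either. *)
Lemma bh_vec_act v : dot v v = 1 -> bh_vec D v -> bh_vec D (g *m v).
Proof.
move=> vv hv; have gv : dot (g *m v) (g *m v) = 1 by rewrite SO0_dot.
have ptsE' := @ptsE _ _ D (tau D) v00 tt v0t.
apply/(ptsE' _ _ gv); rewrite -BHE //.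
have : BH D (fib D v) by rewrite BHE //; apply/(ptsE' _ _ vv).
case=> r [Sr esc] e; have [r' Sr' rv'] := SO0_transitive v00 tt v0t vv.
have rv : r *m v0 = v.
  by apply: (fib_inj v00 tt v0t); rewrite ?SO0_dot // -e pt_fib.
have Sgr : G (g *m r) by exact: SO0M.
exists (g *m r); last by rewrite pt_fib // -mulmxA rv.
split=> // w hw /(escapesE hl hD Sgr hw) h; apply: (esc w hw).
apply/(escapesE hl hD Sr hw) => s s0 hs; apply: (h s s0).
by rewrite -!mulmxA scalemxAr -mulmxDr; apply/sing_vec_act.
Qed.

Lemma vboundary_act (P : V -> Prop) v : (forall w, dot w w = 1 -> P (g *m w) <-> P w) ->
  vboundary P v -> vboundary P (g *m v).
Proof.
move=> hP hv N nN.
have nN' : nbhs v [set w | N (g *m w)] by exact: (@continuous_mulmx _ _ 1 g v _ nN).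
have [[w [Nw ww Pw]] [z [Nz zz Pz]]] := hv _ nN'.
split; [exists (g *m w) | exists (g *m z)]; split; rewrite ?SO0_dot //.
  by apply/hP.
by move/(hP _ zz).
Qed.

End Symmetries.

(** * Adding one negative coordinate *)

Section InclusionLemmas.
Variables (R : realType) (l : nat).
Hypothesis l1 : (0 < l)%N.
Local Notation V := 'cV[R]_l.+1.
Local Notation V' := 'cV[R]_l.+2.
Implicit Types (u v w : V) (A B : 'M[R]_l.+1) (z : V') (c d : R).

Lemma castmx_mul (m n p m' n' p' : nat) (em : m = m') (en : n = n') (ep : p = p')
    (A : 'M[R]_(m, n)) (B : 'M[R]_(n, p)) :
  castmx (em, en) A *m castmx (en, ep) B = castmx (em, ep) (A *m B).
Proof. by case: m' / em; case: n' / en; case: p' / ep. Qed.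

Definition ext_vec v (k : R) : V' :=
  castmx (addn1 l.+1, erefl 1%N) (col_mx v (k%:M : 'cV[R]_1)).

Lemma incl_vecE v : incl_vec v = ext_vec v 0.
Proof. by rewrite /ext_vec raddf0. Qed.

Lemma incl_mx_ext c A v (k : R) : incl_mx c A *m ext_vec v k = ext_vec (A *m v) (c * k).
Proof.
by rewrite /incl_mx /ext_vec castmx_mul mul_block_col !mul0mx addr0 add0r scalar_mxM.
Qed.

Lemma incl_mx_vec c A v : incl_mx c A *m incl_vec v = incl_vec (A *m v).
Proof. by rewrite !incl_vecE incl_mx_ext mulr0. Qed.

Let wd (i : 'I_l.+1) : 'I_l.+2 := widen_ord (leqnSn _) i.

Definition proj_vec z : V := \col_i z (wd i) 0.

Lemma ext_vec_widen v (k : R) i : ext_vec v k (wd i) 0 = v i 0.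
Proof.
rewrite /ext_vec castmxE /= cast_ord_id.
have -> : cast_ord (esym (addn1 l.+1)) (wd i) = lshift 1 i by exact: val_inj.
by rewrite col_mxEu.
Qed.

Lemma ext_vec_last v (k : R) : ext_vec v k ord_max 0 = k.
Proof.
rewrite /ext_vec castmxE /= cast_ord_id.
have -> : cast_ord (esym (addn1 l.+1)) ord_max = rshift l.+1 (0 : 'I_1).
  by apply: val_inj; rewrite /= addn0.
by rewrite col_mxEd mxE.
Qed.

Lemma ord_wd (i : 'I_l.+2) : (exists i', i = wd i') \/ i = ord_max.
Proof.
case: (unliftP ord_max i) => [i' ->|->]; [left|by right].
by exists i'; apply: val_inj; rewrite /= /bump leqNgt ltn_ord.
Qed.

Lemma proj_ext v (k : R) : proj_vec (ext_vec v k) = v.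
Proof. by apply/matrixP => i j; rewrite mxE ext_vec_widen ord1. Qed.

Lemma ext_proj z : z = ext_vec (proj_vec z) (z ord_max 0).
Proof.
apply/matrixP => i j; rewrite ord1.
case: (ord_wd i) => [[i' ->]|->]; last by rewrite ext_vec_last.
by rewrite ext_vec_widen mxE.
Qed.

Lemma dot_ext z1 z2 :
  dot z1 z2 = dot (proj_vec z1) (proj_vec z2) - z1 ord_max 0 * z2 ord_max 0.
Proof.
(* The last index is at least 2, hence the minus sign. *)
rewrite !dot_sum big_ord_recr /= ifF; last by apply/negbTE; rewrite -leqNgt.
by rewrite mulN1r; congr (_ - _); apply: eq_bigr => i _; rewrite !mxE.
Qed.

Lemma proj_incl v : proj_vec (incl_vec v) = v.
Proof. by rewrite incl_vecE proj_ext. Qed.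

Lemma dot_incl_r z v : dot z (incl_vec v) = dot (proj_vec z) v.
Proof. by rewrite incl_vecE dot_ext ext_vec_last mulr0 subr0 proj_ext. Qed.

Lemma dot_incl u v : dot (incl_vec u) (incl_vec v) = dot u v.
Proof. by rewrite dot_incl_r proj_incl. Qed.

Lemma incl_grp_isometry A : eta_isometry A -> eta_isometry (incl_grp A).
Proof.
move=> hA; apply: dot_isometry => z w.
rewrite (ext_proj z) (ext_proj w) /incl_grp !incl_mx_ext !mul1r.
by rewrite !dot_ext !proj_ext !ext_vec_last isometry_dot.
Qed.

Lemma incl_grp1 : incl_grp (1%:M : 'M[R]_l.+1) = 1%:M.
Proof.
apply: eqmx_vec => z; rewrite mul1mx (ext_proj z).
by rewrite /incl_grp incl_mx_ext mul1mx mul1r.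
Qed.

Lemma continuous_incl_grp : continuous (@incl_grp R l).
Proof.
move=> A; have FF := nbhs_filter A; apply: cvg_mx => i j.
rewrite /incl_grp /incl_mx castmxE /=.
rewrite (_ : (fun B => _) = (fun B : 'M[R]_l.+1 => block_mx B 0 0 (1%:M : 'M[R]_1)
  (cast_ord (esym (addn1 l.+1)) i) (cast_ord (esym (addn1 l.+1)) j))); last first.
  by apply/funext => B; rewrite castmxE.
case: (split_ordP (cast_ord (esym (addn1 l.+1)) i)) => i' ->;
  case: (split_ordP (cast_ord (esym (addn1 l.+1)) j)) => j' ->.
- rewrite block_mxEul (_ : (fun B => _) = (fun B : 'M[R]_l.+1 => B i' j')).
    exact: coord_continuous.
  by apply/funext => B; rewrite block_mxEul.
- rewrite (_ : (fun B => _) = (fun=> block_mx A 0 0 (1%:M : 'M[R]_1) (lshift 1 i') (rshift l.+1 j'))).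
    exact: cvg_cst.
  by apply/funext => B; rewrite !block_mxEur.
- rewrite (_ : (fun B => _) = (fun=> block_mx A 0 0 (1%:M : 'M[R]_1) (rshift l.+1 i') (lshift 1 j'))).
    exact: cvg_cst.
  by apply/funext => B; rewrite !block_mxEdl.
- rewrite (_ : (fun B => _) = (fun=> block_mx A 0 0 (1%:M : 'M[R]_1) (rshift l.+1 i') (rshift l.+1 j'))).
    exact: cvg_cst.
  by apply/funext => B; rewrite !block_mxEdr.
Qed.

Lemma continuous_incl_vec : continuous (@incl_vec R l).
Proof.
move=> v; have FF := nbhs_filter v; apply: cvg_mx => i j; rewrite ord1.
case: (ord_wd i) => [[i' ->]|->].
  have e : (fun w => incl_vec w (wd i') 0) = (fun w => w i' 0).
    by apply/funext => w; rewrite incl_vecE ext_vec_widen.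
  by rewrite e incl_vecE ext_vec_widen; exact: coord_continuous.
have e : (fun w => incl_vec w ord_max 0) = (fun=> 0).
  by apply/funext => w; rewrite incl_vecE ext_vec_last.
by rewrite e incl_vecE ext_vec_last; exact: cvg_cst.
Qed.

Lemma continuous_proj_vec : continuous proj_vec.
Proof.
move=> z; have FF := nbhs_filter z; apply: cvg_mx => i j; rewrite mxE.
rewrite (_ : (fun x => _) = (fun x : V' => x (wd i) 0)); last first.
  by apply/funext => x; rewrite mxE.
exact: coord_continuous.
Qed.

Lemma incl_grp_SO0 A : SO0 R l A -> SO0 R l.+1 (incl_grp A).
Proof.
move=> SA; apply: (@connected_SO0 _ _ (@incl_grp R l @` SO0 R l) 1%:M) => //.
- apply: connected_continuous_connected (@SO0_connected R l) _.
  exact: (continuous_subspaceT continuous_incl_grp).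
- by move=> _ [B SB <-]; apply: incl_grp_isometry; exact: SO0_isometry.
- by exists 1%:M; [exact: SO0_1 | exact: incl_grp1].
- exact: SO0_1.
Qed.

End InclusionLemmas.

(** * Comparison of the two spaces and the sweep *)

Section Main.
Variables (R : realType) (l : nat) (D : ads_data R l) (D' : ads_data R l.+1).
Hypotheses (hl : (3 <= l)%N) (hD : ads_axioms D) (hD' : ads_axioms D') (hDD' : compatible D D').
Local Notation V := 'cV[R]_l.+1.
Local Notation V' := 'cV[R]_l.+2.
Local Notation v0 := (base_vec D).
Local Notation b := (J2 D *m v0).
Implicit Types (v w : V) (z : V').

Let l1 : (0 < l)%N. Proof. by lia. Qed.
Let hl' : (3 <= l.+1)%N. Proof. by lia. Qed.
Let v00 := dot_v0 hD.
Let tt := dot_tau hl hD.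
Let v0t : dot v0 (tau D) = 0. Proof. by rewrite dotC (tau_v0 hl hD). Qed.
Let v00' := dot_v0 hD'.
Let tt' := dot_tau hl' hD'.
Let v0t' : dot (base_vec D') (tau D') = 0. Proof. by rewrite dotC (tau_v0 hl' hD'). Qed.

Lemma tau_incl : tau D' = incl_vec (tau D).
Proof.
rewrite -(q0_v0 hl' hD') (compat_q hDD') ?(compat_vec hDD'); last by lia.
by rewrite /incl_alg incl_mx_vec (q0_v0 hl hD).
Qed.

Lemma xi_incl : xi D' = incl_vec (xi D).
Proof. by rewrite /xi tau_incl (compat_J1 hDD') /incl_alg incl_mx_vec. Qed.

Lemma coords_incl z : [/\ dot z (tau D') = dot (proj_vec z) (tau D),
  dot z (xi D') = dot (proj_vec z) (xi D) &
  dot z (base_vec D') = dot (proj_vec z) v0].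
Proof. by rewrite tau_incl xi_incl (compat_vec hDD') !(dot_incl_r l1). Qed.

Lemma sing_vec_incl v : sing_vec D' (incl_vec v) <-> sing_vec D v.
Proof. by rewrite /sing_vec; have [-> -> _] := coords_incl (incl_vec v); rewrite proj_incl. Qed.

Lemma bh_vec_proj z : bh_vec D' z <-> bh_vec D (proj_vec z).
Proof. by rewrite /bh_vec; have [-> -> ->] := coords_incl z. Qed.

Lemma bh_vec_incl v : bh_vec D' (incl_vec v) <-> bh_vec D v.
Proof. by rewrite bh_vec_proj proj_incl. Qed.

Lemma embed_fib v : dot v v = 1 -> embed D' (fib D v) = fib D' (incl_vec v).
Proof.
move=> vv; apply/seteqP; split=> [_ [r [Sr rv] [k [Sk kv] <-]]|h [Sh hv]].
  split; first by apply: SO0M => //; exact: (incl_grp_SO0 l1).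
  by rewrite -mulmxA kv (compat_vec hDD') /incl_grp incl_mx_vec rv.
have [r Sr rv] := SO0_transitive v00 tt v0t vv; have Si := incl_grp_SO0 l1 Sr.
have u := SO0_unit Si.
exists r; first by split.
exists (invmx (incl_grp r) *m h); last by rewrite mulKVmx.
split; first by apply: SO0M => //; exact: SO0V.
by rewrite -mulmxA hv -rv -(incl_mx_vec 1 r) -(compat_vec hDD') mulKmx.
Qed.

(* Absorbs the last coordinate of z into the coordinate along b. This preserves the square norm and
   the coordinates along tau, xi and v0; for the right sign s it is continuous at a point of the
   image of incl_vec and fixes it. *)
Definition retract (s : R) z : V :=
  let p := proj_vec z in
  p + (dot p b - s * Num.sqrt (dot p b ^+ 2 + z ord_max 0 ^+ 2)) *: b.

Lemma retract_dot s z : s ^+ 2 = 1 -> dot (retract s z) (retract s z) = dot z z.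
Proof.
move=> ss; rewrite /retract (dot_ext l1); set p := proj_vec z; set be := dot p b.
set zl := z ord_max 0; set k := Num.sqrt _.
have kk : k ^+ 2 = be ^+ 2 + zl ^+ 2 by rewrite sqr_sqrtr // addr_ge0 // sqr_ge0.
rewrite !dotE (dot_b hl hD) (dotC b p) -/be.
have : (s * k) ^+ 2 = be ^+ 2 + zl ^+ 2 by rewrite exprMn ss mul1r.
rewrite !expr2; lra.
Qed.

Lemma bh_vec_retract s z : bh_vec D (retract s z) <-> bh_vec D' z.
Proof.
have h1 : dot b (tau D) = 0 by rewrite dotC (tau_b hl hD).
have h2 : dot b (xi D) = 0 by rewrite dotC; case: (xi_dots hl hD).
rewrite bh_vec_proj /bh_vec /retract.
rewrite ![dot (proj_vec z + _) _]dotDl ![dot (_ *: b) _]dotZl h1 h2 (b_v0 hD).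
by rewrite !mulr0 !addr0.
Qed.

Lemma cvg_retract v : exists2 s, s ^+ 2 = 1 & retract s z @[z --> incl_vec v] --> v.
Proof.
(* With this sign s |<v, b>| = <v, b>, so the retraction sends the image of v back to v. *)
pose s : R := if 0 <= dot v b then 1 else -1; exists s.
  by rewrite /s; case: ifP; rewrite ?sqrrN expr1n.
have FF := nbhs_filter (incl_vec v).
have rv : retract s (incl_vec v) = v.
  rewrite /retract proj_incl incl_vecE ext_vec_last expr0n addr0 sqrtr_sqr.
  rewrite (_ : _ - _ = 0) ?scale0r ?addr0 // /s; case: ifP => h.
    by rewrite ger0_norm // mul1r subrr.
  by rewrite ltr0_norm ?ltNge ?h // mulN1r opprK subrr.
rewrite -[X in _ --> X]rv /retract.
have cp : proj_vec z @[z --> incl_vec v] --> proj_vec (incl_vec v).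
  exact: (@continuous_proj_vec R l (incl_vec v)).
have cb : dot (proj_vec z) b @[z --> incl_vec v] --> dot (proj_vec (incl_vec v)) b.
  by apply: cvg_dot cp (cvg_cst _).
have cl : z ord_max 0 @[z --> incl_vec v] --> incl_vec v ord_max 0.
  exact: coord_continuous.
have sq (h : V' -> R) (r : R) : h z @[z --> incl_vec v] --> r ->
    h z ^+ 2 @[z --> incl_vec v] --> r ^+ 2.
  move=> hr; rewrite expr2 (_ : (fun z => _) = (fun z => h z * h z)).
    exact: cvgM.
  by apply/funext => z; rewrite expr2.
have hs := cvgD (sq _ _ cb) (sq _ _ cl).
apply: cvg_addmx cp _; apply: cvg_scalemx; last exact: cvg_cst.
apply: cvgB cb _; apply: cvgM; first exact: cvg_cst.
apply: continuous_cvg; first exact: sqrt_continuous.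
exact: hs.
Qed.

Lemma vboundary_incl v : vboundary (bh_vec D') (incl_vec v) <-> vboundary (bh_vec D) v.
Proof.
split=> hv N nN.
  have [s ss cr] := cvg_retract v.
  have [[z [Nz zz Pz]] [w [Nw ww Pw]]] := hv _ (cr _ nN).
  split; [exists (retract s z) | exists (retract s w)]; split=> //.
  - by rewrite retract_dot.
  - exact/bh_vec_retract.
  - by rewrite retract_dot.
  - by move/bh_vec_retract.
have [[z [Nz zz Pz]] [w [Nw ww Pw]]] := hv _ (@continuous_incl_vec R l v _ nN).
split; [exists (incl_vec z) | exists (incl_vec w)]; split=> //; rewrite ?(dot_incl l1) //.
- exact/bh_vec_incl.
- by move/bh_vec_incl.
Qed.

Variable X : 'M[R]_l.+2.
Hypotheses (hX : X \in so R l.+1) (hXJ1 : bracket X (J1 D') = 0).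
Hypothesis hR : sweep X (embed D' @` AdS D) = AdS D'.

Local Notation flow k := (expmx (k *: X)).

Let Sflow (k : R) : SO0 R l.+1 (flow k).
Proof. by apply: expmx_SO0; rewrite memvZ. Qed.

Let flowJ (k : R) : flow k *m J1 D' = J1 D' *m flow k.
Proof.
apply: expmx_comm; rewrite -scalemxAl -scalemxAr; congr (_ *: _).
by move/eqP: hXJ1; rewrite /bracket subr_eq0 => /eqP.
Qed.

(** One implication for all g is enough, since the inverse of the flow also commutes with J1. *)
Lemma flow_invariant (P' : V' -> Prop) :
  (forall g, SO0 R l.+1 g -> g *m J1 D' = J1 D' *m g ->
     forall z, dot z z = 1 -> P' z -> P' (g *m z)) ->
  forall k z, dot z z = 1 -> P' (flow k *m z) <-> P' z.
Proof.
move=> h k z zz; split=> [hz|]; last exact: h.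
rewrite -[z](mulKmx (SO0_unit (Sflow k))); apply: h hz.
- exact: SO0V.
- exact: comm_invmx (SO0_unit (Sflow k)) (flowJ k).
- by rewrite SO0_dot.
Qed.

(** Surjectivity of the sweep writes each z as the flow of an included v; invariance carries [P']
    from z to the image of v, and agreement on the image turns it into [P v]. *)
Lemma sweep_pts (P : V -> Prop) (P' : V' -> Prop) :
  (forall v, dot v v = 1 -> P' (incl_vec v) <-> P v) ->
  (forall k z, dot z z = 1 -> P' (flow k *m z) <-> P' z) ->
  sweep X (embed D' @` pts D P) = pts D' P'.
Proof.
move=> hP hP'; apply/seteqP; split=> [_ [k _ [_ [_ [v [vv Pv] <-] <-] <-]]|_ [z [zz Pz] <-]].
  have iv : dot (incl_vec v) (incl_vec v) = 1 by rewrite (dot_incl l1).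
  rewrite embed_fib // act_fib //; exists (flow k *m incl_vec v) => //.
  by split; [rewrite SO0_dot | apply/(hP' k _ iv)/hP].
have := AdS_fib v00' tt' v0t' zz; rewrite -hR.
case=> k _ [_ [x Ax <-] e]; move: Ax e; rewrite (AdS_pts v00 tt v0t) => -[v [vv _] <-].
have iv : dot (incl_vec v) (incl_vec v) = 1 by rewrite (dot_incl l1).
rewrite embed_fib // act_fib // => e.
have ez : flow k *m incl_vec v = z.
  by apply: (fib_inj v00' tt' v0t') e; rewrite SO0_dot.
exists k => //; exists (embed D' (fib D v)).
  exists (fib D v) => //; exists v => //; split=> //.
  by apply/hP => //; apply/(hP' k _ iv); rewrite ez.
by rewrite embed_fib // act_fib // ez.
Qed.

End Main.

Theorem theorem83 (R : realType) (l : nat) (hl : (3 <= l)%N)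
    (D : ads_data R l) (D' : ads_data R l.+1)
    (hD : ads_axioms D) (hD' : ads_axioms D') (hDD' : compatible D D')
    (X : 'M[R]_l.+2) (hX : X \in so R l.+1) (hXJ1 : bracket X (J1 D') = 0)
    (hR : sweep X (embed D' @` AdS D) = AdS D') :
  [/\ sweep X (embed D' @` singularity D) = singularity D',
      sweep X (embed D' @` free_part D) = free_part D',
      sweep X (embed D' @` BH D) = BH D'
    & sweep X (embed D' @` horizon D) = horizon D'].
Proof.
have hl' : (3 <= l.+1)%N by exact: leqW.
have v00 := dot_v0 hD; have v00' := dot_v0 hD'.
have tt := dot_tau hl hD; have tt' := dot_tau hl' hD'.
have v0t : dot (base_vec D) (tau D) = 0 by rewrite dotC (tau_v0 hl hD).
have v0t' : dot (base_vec D') (tau D') = 0 by rewrite dotC (tau_v0 hl' hD').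
have inv := flow_invariant hX hXJ1.
have sweepP := sweep_pts hl hD hD' hDD' hX hR.
have bhk : forall k z, dot z z = 1 -> bh_vec D' (expmx (k *: X) *m z) <-> bh_vec D' z.
  by apply: inv => g Sg gJ z zz; exact: bh_vec_act.
rewrite /free_part /horizon !singularity_vec // !BHE //.
rewrite !(ads_boundary_pts v00 tt v0t) !(ads_boundary_pts v00' tt' v0t').
rewrite (pts_compl v00 tt v0t) (pts_compl v00' tt' v0t').
(* All eight sets are now given by predicates on vectors; each equality asks for agreement on
   included vectors and invariance under the flow. *)
split; apply: sweepP.
- by move=> v _; exact: sing_vec_incl.
- by apply: inv => g Sg gJ z _ /(sing_vec_act hl' hD' Sg gJ).
- by move=> v _; split; apply: contra_not => /(bh_vec_incl hl hD hD' hDD' v).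
- by move=> k z zz; split; apply: contra_not => /(bhk k z zz).
- by move=> v _; exact: bh_vec_incl.
- exact: bhk.
- by move=> v _; exact: vboundary_incl.
- apply: inv => g Sg gJ z zz hz.
  apply: (vboundary_act Sg _ hz) => w ww.
  split; last exact: bh_vec_act.
  move=> hw; rewrite -[w](mulKmx (SO0_unit Sg)); apply: bh_vec_act => //.
  + exact: SO0V.
  + exact: comm_invmx (SO0_unit Sg) gJ.
  + by rewrite SO0_dot.
Qed.
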